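(* Let $(R,\mathfrak m,K)$ be an $F$-finite local ring of prime characteristic $p>0$ and dimension $d$, and let $M$ be an $R$-module of finite length. Suppose that there is a regular local ring $(A,\mathfrak n,L)$ and a local homomorphism $\phi:R\to A$ such that $A$ is finitely generated as an $R$-module and $\dim A=d$. If, for some integer $j\ge 0$, $$\beta^F_j(M,R)=\beta^F_{j+1}(M,R)=\cdots=\beta^F_{j+d}(M,R)=0,$$ then $M$ has finite projective dimension.
   Context: Rings are commutative and Noetherian. A ring of prime characteristic $p$ is $F$-finite if it is a finitely generated module over itself via the Frobenius endomorphism. For an $R$-module $N$ and $e\ge 0$, ${}^eN$ denotes $N$ with the $R$-module structure $r*n=r^{p^e}n$. For a local ring $(R,\mathfrak m,K)$ put $d=\dim R$, $\alpha=\log_p[K:K^p]$ and $q=p^e$; $\lambda$ denotes length of $R$-modules. For $M$ of finite length and $N$ finitely generated, $\beta_i^F(M,N)=\lim_{e\to\infty}\lambda(\operatorname{Tor}^R_i(M,{}^eN))/q^{d+\alpha}$; this limit is known to exist. The zero module counts as having finite projective dimension ($-\infty$). *)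

(* Defs.v *)
From HB Require Import structures.
From mathcomp Require Import all_boot all_order all_algebra.
From mathcomp Require Import finmap.
From mathcomp Require Import all_classical all_reals all_analysis.

Set Implicit Arguments.
Unset Strict Implicit.
Unset Printing Implicit Defensive.

Import Order.TTheory GRing.Theory Num.Theory.
Import numFieldNormedType.Exports.

Local Open Scope classical_set_scope.
Local Open Scope ring_scope.

Section Modules.
Variable R : comNzRingType.

Definition surjective_map (U V : Type) (f : U -> V) : Prop :=
  forall y, exists x, f x = y.

Definition exact_at (U V W : lmodType R) (f : {linear U -> V})
  (g : {linear V -> W}) : Prop := forall y, g y = 0 <-> exists x, f x = y.

(* In a submodule [U] of [M], the generators [g i] automatically lie in [U]. *)
Definition generated_by (M : lmodType R) (n : nat) (U : {pred M}) : Prop :=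
  exists g : 'I_n -> M,
    forall x, x \in U <-> exists a : 'I_n -> R, x = \sum_i a i *: g i.

Definition fin_gen (M : lmodType R) : Prop :=
  exists n, generated_by n (predT : {pred M}).

(* [n] counts the inclusions; the chain has [n.+1] terms. *)
Definition submod_chain (M : lmodType R) (n : nat) : Prop :=
  exists U : nat -> {pred M},
    (forall i, (i <= n)%N -> submod_closed (U i)) /\
    (forall i, (i < n)%N -> {subset U i <= U i.+1} /\
                            exists2 x, x \in U i.+1 & x \notin U i).

Definition finite_length (M : lmodType R) : Prop :=
  exists n, ~ submod_chain M n.

Definition length (Re : realType) (M : lmodType R) : \bar Re :=
  ereal_sup [set (n%:R)%:E | n in submod_chain M].

End Modules.

Section Kernel.
Variables (R : comNzRingType) (V W : lmodType R) (g : {linear V -> W}).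

Definition ker_pred : {pred V} := fun x => g x == 0.

Lemma ker_pred_closed : submod_closed ker_pred.
Proof.
split=> [|a x y]; first by rewrite unfold_in raddf0.
by rewrite !unfold_in => /eqP gx /eqP gy; rewrite linearP gx gy scaler0 addr0.
Qed.

HB.instance Definition _ := GRing.isSubmodClosed.Build R V ker_pred ker_pred_closed.

Definition kermod : Type := {x : V | ker_pred x}.

HB.instance Definition _ := SubChoice.on kermod.
HB.instance Definition _ := [SubChoice_isSubLmodule of kermod by <:].

End Kernel.

Section QuotientModule.
Variables (R : comNzRingType) (V : lmodType R) (U : submodClosed V).

(* [submodClosed] does not join with [zmodClosed], which [Quotient.quot] needs. *)
Definition submod_zpred : {pred V} := fun x => x \in U.

Lemma submod_zpred_closed : zmod_closed submod_zpred.
Proof. exact: (submodClosedP U). Qed.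

HB.instance Definition _ := GRing.isZmodClosed.Build V submod_zpred submod_zpred_closed.

Definition quotmod : Type := Quotient.quot submod_zpred.

HB.instance Definition _ := GRing.Zmodule.on quotmod.

Definition quot_pi (x : V) : quotmod := \pi_(Quotient.quot submod_zpred)%qT x.

Definition quot_repr (y : quotmod) : V := repr (y : Quotient.quot submod_zpred).

Lemma quot_reprK y : quot_pi (quot_repr y) = y.
Proof. exact: reprK. Qed.

Lemma quot_piP x y : quot_pi x = quot_pi y <-> x - y \in U.
Proof.
have -> : (x - y \in U) = (x - y \in submod_zpred) by [].
by rewrite Quotient.idealrBE; split=> /eqP.
Qed.

Lemma quot_piB : {morph quot_pi : x y / x - y}.
Proof. by move=> x y; rewrite /quot_pi raddfB. Qed.

Lemma quot_piD : {morph quot_pi : x y / x + y}.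
Proof. by move=> x y; rewrite /quot_pi raddfD. Qed.

Definition quot_scale (a : R) (y : quotmod) : quotmod := quot_pi (a *: quot_repr y).

Lemma quot_piZ a x : quot_pi (a *: x) = quot_scale a (quot_pi x).
Proof.
by apply/quot_piP; rewrite -scalerBr rpredZ //; apply/quot_piP; rewrite quot_reprK.
Qed.

Lemma quot_scaleA a b y : quot_scale a (quot_scale b y) = quot_scale (a * b) y.
Proof. by rewrite -[y]quot_reprK -!quot_piZ scalerA. Qed.

Lemma quot_scale1 : left_id 1 quot_scale.
Proof. by move=> y; rewrite -[y]quot_reprK -!quot_piZ scale1r. Qed.

Lemma quot_scaleDr : right_distributive quot_scale +%R.
Proof.
move=> a x y; rewrite -[x]quot_reprK -[y]quot_reprK -quot_piD -!quot_piZ.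
by rewrite scalerDr quot_piD.
Qed.

Lemma quot_scaleDl y : {morph quot_scale^~ y : a b / a + b}.
Proof.
by move=> a b /=; rewrite -[y]quot_reprK -!quot_piZ scalerDl quot_piD.
Qed.

HB.instance Definition _ := GRing.Zmodule_isLmodule.Build R quotmod
  quot_scaleA quot_scale1 quot_scaleDr quot_scaleDl.

Lemma quot_pi_linear : linear quot_pi.
Proof. by move=> a x y; rewrite quot_piD quot_piZ. Qed.

HB.instance Definition _ := GRing.isLinear.Build R V quotmod _ quot_pi quot_pi_linear.

End QuotientModule.

Definition quot_lift (R : comNzRingType) (V W : lmodType R) (U : submodClosed V)
    (f : {linear V -> W}) of (forall x, x \in U -> f x = 0) :=
  fun y : quotmod U => f (quot_repr y).

Section QuotientLift.
Variables (R : comNzRingType) (V W : lmodType R) (U : submodClosed V).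
Variables (f : {linear V -> W}) (fU : forall x, x \in U -> f x = 0).

Lemma quot_lift_pi x : quot_lift fU (quot_pi U x) = f x.
Proof.
apply/eqP; rewrite -subr_eq0 -raddfB; apply/eqP/fU/quot_piP.
exact: quot_reprK.
Qed.

Lemma quot_lift_linear : linear (quot_lift fU).
Proof.
move=> a x y; rewrite -[x]quot_reprK -[y]quot_reprK -linearP !quot_lift_pi.
exact: linearP.
Qed.

HB.instance Definition _ :=
  GRing.isLinear.Build R (quotmod U) W _ (quot_lift fU) quot_lift_linear.

End QuotientLift.

Section Homology.
Variables (R : comNzRingType) (U V W : lmodType R).
Variables (f : {linear U -> V}) (g : {linear V -> W}).

Definition boundary_pred : {pred kermod g} :=
  fun z => `[< exists x, f x = val z >].

Lemma boundary_pred_closed : submod_closed boundary_pred.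
Proof.
split=> [|a x y]; first by apply/asboolP; exists 0; rewrite !raddf0.
move=> /asboolP[u fu] /asboolP[v fv]; apply/asboolP; exists (a *: u + v).
by rewrite !linearP fu fv.
Qed.

HB.instance Definition _ :=
  GRing.isSubmodClosed.Build R (kermod g) boundary_pred boundary_pred_closed.

(* [ker g / (im f :&: ker g)]; used only when [g \o f = 0]. *)
Definition homology : lmodType R := quotmod boundary_pred.

End Homology.

Section Free.
Variables (R : comNzRingType) (X : choiceType).

Definition finsupp_pred : {pred X -> R^o} :=
  fun f => `[< finite_set [set x | f x != 0] >].

Lemma finsupp_pred_closed : submod_closed finsupp_pred.
Proof.
split=> [|a f g /asboolP ff /asboolP fg]; apply/asboolP.
  by apply: (sub_finite_set _ (@finite_set0 X)) => x /=; rewrite eqxx.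
apply: (@sub_finite_set _ _ ([set x | f x != 0] `|` [set x | g x != 0])); last first.
  by rewrite finite_setU.
move=> x /=; apply: contraNP => /not_orP[/negP + /negP].
by rewrite !negbK !fctE => /eqP -> /eqP ->; rewrite scaler0 addr0.
Qed.

HB.instance Definition _ :=
  GRing.isSubmodClosed.Build R (X -> R^o) finsupp_pred finsupp_pred_closed.

Definition free_mod : Type := {f : X -> R^o | finsupp_pred f}.

HB.instance Definition _ := SubChoice.on free_mod.
HB.instance Definition _ := [SubChoice_isSubLmodule of free_mod by <:].

Lemma free_basis_subproof (x : X) :
  finsupp_pred (fun y => (y == x)%:R : R^o).
Proof.
apply/asboolP; apply: (@sub_finite_set _ _ [set x]); last exact: finite_set1.
by move=> y /=; case: (eqVneq y x) => [->//|_] /eqP.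
Qed.

Definition free_basis (x : X) : free_mod := Sub _ (free_basis_subproof x).

Variables (W : lmodType R) (h : X -> W).

Definition free_lift (u : free_mod) : W := \sum_(x \in setT) (val u x : R) *: h x.

Lemma free_liftE (A : {fset X}) (u : free_mod) :
  (forall x, val u x != 0 -> x \in A) ->
  free_lift u = \sum_(x <- A) (val u x : R) *: h x.
Proof.
move=> uA; rewrite /free_lift (fsbigTE A) // => x xA.
by have [->|/uA] := eqVneq (val u x) 0; rewrite ?scale0r // (negPf xA).
Qed.

Lemma free_lift_linear : linear free_lift.
Proof.
move=> a u v.
have finA : finite_set ([set x | val u x != 0] `|` [set x | val v x != 0]).
  rewrite finite_setU; split; apply/asboolP; [exact: (valP u)|exact: (valP v)].
pose A := fset_set ([set x | val u x != 0] `|` [set x | val v x != 0]).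
have uA x : val u x != 0 -> x \in A.
  by move=> ux; rewrite in_fset_set // inE; left.
have vA x : val v x != 0 -> x \in A.
  by move=> vx; rewrite in_fset_set // inE; right.
rewrite (@free_liftE A) => [|x]; last first.
  move=> uvx; have {}uvx : a * (val u x : R) + (val v x : R) != 0 := uvx.
  have [ux0|/uA //] := eqVneq (val u x) 0.
  by apply: vA; move: uvx; rewrite ux0 mulr0 add0r.
rewrite (free_liftE uA) (free_liftE vA) scaler_sumr -big_split /=.
apply: eq_bigr => x _.
by rewrite scalerA -scalerDl.
Qed.

HB.instance Definition _ :=
  GRing.isLinear.Build R free_mod W _ free_lift free_lift_linear.

End Free.

Section Span.
Variables (R : comNzRingType) (V : lmodType R) (G : set V).

Definition span_pred : {pred V} :=
  fun x => `[< forall U : {pred V}, submod_closed U ->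
                 (forall y, G y -> y \in U) -> x \in U >].

Lemma span_pred_closed : submod_closed span_pred.
Proof.
split=> [|a x y /asboolP xU /asboolP yU]; apply/asboolP => U Ucl GU.
  by case: Ucl.
by case: (Ucl) => _; apply; [exact: xU|exact: yU].
Qed.

HB.instance Definition _ :=
  GRing.isSubmodClosed.Build R V span_pred span_pred_closed.

Lemma mem_span x : G x -> x \in span_pred.
Proof. by move=> Gx; apply/asboolP => U _; apply. Qed.

End Span.

Section Tensor.
Variable R : comNzRingType.

Section Object.
Variables M N : lmodType R.
Local Notation "<< m , n >>" :=
  (free_basis R ((m, n) : (M * N)%type)) (m, n at level 10).

Definition tensor_relations : set (free_mod R (M * N)%type) :=
  [set z | (exists a m m' n, z = <<(a *: m + m'), n>> - (a *: <<m, n>> + <<m', n>>)) \/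
           (exists a m n n', z = <<m, (a *: n + n')>> - (a *: <<m, n>> + <<m, n'>>))].

Definition tensor : lmodType R := quotmod (span_pred tensor_relations).

Definition tens (m : M) (n : N) : tensor := quot_pi _ <<m, n>>.

Lemma tensPl a m m' n : tens (a *: m + m') n = a *: tens m n + tens m' n.
Proof.
rewrite /tens -linearP; apply/quot_piP/mem_span; left.
by exists a, m, m', n.
Qed.

Lemma tensPr a m n n' : tens m (a *: n + n') = a *: tens m n + tens m n'.
Proof.
rewrite /tens -linearP; apply/quot_piP/mem_span; right.
by exists a, m, n, n'.
Qed.

End Object.

Lemma free_lift_basis (X : choiceType) (W : lmodType R) (h : X -> W) x :
  free_lift h (free_basis R x) = h x.
Proof.
rewrite (@free_liftE _ _ _ _ [fset x]%fset) => [|y] /=.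
  by rewrite big_seq_fset1 eqxx scale1r.
by rewrite inE; case: (y == x) => //; rewrite eqxx.
Qed.

Section Map.
Variables (M M' N : lmodType R) (f : {linear M -> M'}).

Definition tensor_map0 : {linear free_mod R (M * N)%type -> tensor M' N} :=
  free_lift (fun mn : (M * N)%type => tens (f mn.1) mn.2).

Lemma tensor_map_subproof z :
  z \in span_pred (@tensor_relations M N) -> tensor_map0 z = 0.
Proof.
move=> /asboolP /(_ (ker_pred tensor_map0) (ker_pred_closed _)) zK.
apply/eqP; apply: zK => y yrel; rewrite unfold_in; apply/eqP.
case: yrel => [[a [m [m' [n ->]]]]|[a [m [n [n' ->]]]]];
  rewrite linearB (linearP tensor_map0) /= !free_lift_basis /=.
  by rewrite linearP tensPl subrr.
by rewrite tensPr subrr.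
Qed.

(* [f (x) id_N]. *)
Definition tensor_map : {linear tensor M N -> tensor M' N} :=
  quot_lift tensor_map_subproof.

Lemma tensor_mapE m n : tensor_map (tens m n) = tens (f m) n.
Proof.
exact: etrans (quot_lift_pi _ _) (free_lift_basis _ _).
Qed.

End Map.
End Tensor.

Section Tor.
Variable R : comNzRingType.

(* The standard free resolution of [M]: [free_res M i] is free on the underlying
   set of the [i]-th syzygy module, [syz M i.+1] being the kernel of the
   augmentation [free_res M i -> syz M i]. *)
Fixpoint syz (M : lmodType R) (i : nat) : lmodType R :=
  if i is i'.+1
  then kermod (@free_lift R (syz M i') (syz M i') id : {linear _ -> _})
  else M.

Definition free_res (M : lmodType R) (i : nat) : lmodType R :=
  free_mod R (syz M i).

Definition free_res_diff (M : lmodType R) (i : nat) :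
    {linear free_res M i.+1 -> free_res M i} :=
  free_lift (fun x : syz M i.+1 => val x).

(* In degree 0 every chain is a cycle, whence the zero map. *)
Definition Tor (i : nat) (M N : lmodType R) : lmodType R :=
  if i is i'.+1
  then homology (tensor_map N (free_res_diff M i'.+1))
                (tensor_map N (free_res_diff M i'))
  else homology (tensor_map N (free_res_diff M 0))
                (\0 : {linear tensor (free_res M 0) N -> tensor M N}).

Definition projective (P : lmodType R) : Prop :=
  forall (V W : lmodType R) (g : {linear V -> W}) (f : {linear P -> W}),
    surjective_map g -> exists h : {linear P -> V}, forall x, g (h x) = f x.

Definition finite_proj_dim (M : lmodType R) : Prop :=
  exists (n : nat) (P : nat -> lmodType R)
         (d : forall i, {linear P i.+1 -> P i}) (eps : {linear P 0 -> M}),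
    [/\ forall i, projective (P i),
        forall i, (n < i)%N -> forall x : P i, x = 0,
        surjective_map eps,
        exact_at (d 0) eps
      & forall i, exact_at (d i.+1) (d i)].

End Tor.

Section Rings.
Variable R : comNzRingType.

(* Ideals are the submodules of the regular module [R^o]. *)
Definition noetherian : Prop :=
  forall I : {pred R^o}, submod_closed I -> exists n, generated_by n I.

(* [idealr_closed] includes properness. *)
Definition maximal_ideal (m : {pred R}) : Prop :=
  idealr_closed m /\
  forall I : {pred R}, idealr_closed I -> {subset m <= I} -> I =i m.

(* Local rings are Noetherian by convention. *)
Definition local_ring (m : {pred R}) : Prop :=
  [/\ noetherian, maximal_ideal m
    & forall m' : {pred R}, maximal_ideal m' -> m' =i m].

(* As for [submod_chain], [n] counts the inclusions. *)
Definition prime_chain (n : nat) : Prop :=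
  exists P : nat -> {pred R},
    (forall i, (i <= n)%N -> idealr_closed (P i) /\ prime_idealr_closed (P i)) /\
    (forall i, (i < n)%N -> {subset P i <= P i.+1} /\
                            exists2 x, x \in P i.+1 & x \notin P i).

Definition krull_dim_is (d : nat) : Prop :=
  prime_chain d /\ forall n, prime_chain n -> (n <= d)%N.

Definition regular_local_ring (m : {pred R}) : Prop :=
  local_ring m /\
  exists d, krull_dim_is d /\ @generated_by R R^o d m.

End Rings.

Definition restrict_scalars (R S : comNzRingType) (f : {rmorphism R -> S})
  (N : lmodType S) : Type := N.

Section RestrictScalars.
Variables (R S : comNzRingType) (f : {rmorphism R -> S}) (N : lmodType S).
Local Notation restrict_scalars := (restrict_scalars f N).

HB.instance Definition _ := GRing.Zmodule.on restrict_scalars.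

Definition restrict_scale (a : R) (x : restrict_scalars) : restrict_scalars :=
  f a *: (x : N).

Lemma restrict_scaleA a b x :
  restrict_scale a (restrict_scale b x) = restrict_scale (a * b) x.
Proof. by rewrite /restrict_scale scalerA rmorphM. Qed.

Lemma restrict_scale1 : left_id 1 restrict_scale.
Proof. by move=> x; rewrite /restrict_scale rmorph1 scale1r. Qed.

Lemma restrict_scaleDr : right_distributive restrict_scale +%R.
Proof. by move=> a x y; rewrite /restrict_scale scalerDr. Qed.

Lemma restrict_scaleDl x : {morph restrict_scale^~ x : a b / a + b}.
Proof. by move=> a b; rewrite /restrict_scale rmorphD scalerDl. Qed.

HB.instance Definition _ := GRing.Zmodule_isLmodule.Build R restrict_scalars
  restrict_scaleA restrict_scale1 restrict_scaleDr restrict_scaleDl.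

End RestrictScalars.

Definition frob (R : comNzRingType) (p : nat) of p \in [pchar R] :=
  fun (e : nat) (x : R) => x ^+ (p ^ e).

Section Frobenius.
Variables (R : comNzRingType) (p : nat) (charRp : p \in [pchar R]).

Lemma frob_monoid_morphism e : monoid_morphism (frob charRp e).
Proof.
by split=> [|x y]; rewrite /frob ?expr1n // exprMn.
Qed.

Lemma frob_nmod_morphism e : nmod_morphism (frob charRp e).
Proof.
have p_gt0 : (0 < p)%N by case/andP: charRp => /prime_gt0.
split=> [|x y]; first by rewrite /frob expr0n expn_eq0 (gtn_eqF p_gt0).
rewrite /frob; elim: e => [|e IH]; first by rewrite expn0 !expr1.
rewrite expnSr !exprM IH -!(pFrobenius_autE charRp).
exact: rmorphD.
Qed.

HB.instance Definition _ e :=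
  GRing.isNmodMorphism.Build R R (frob charRp e) (frob_nmod_morphism e).
HB.instance Definition _ e :=
  GRing.isMonoidMorphism.Build R R (frob charRp e) (frob_monoid_morphism e).

(* The module written [^e N]. *)
Definition frob_mod (e : nat) (N : lmodType R) : lmodType R :=
  restrict_scalars (frob charRp e) N.

Definition F_finite : Prop := fin_gen (frob_mod 1 R^o).

End Frobenius.

(* [b] is a basis of [K] over [K^p]; for a field of characteristic [p] the
   coordinates [a i ^+ p] and their [p]-th roots [a i] determine each other. *)
Definition pbasis (K : comNzRingType) (p n : nat) (b : 'I_n -> K) : Prop :=
  forall y, exists! a : {ffun 'I_n -> K}, y = \sum_i a i ^+ p * b i.

(* The degree [K : K^p], finite whenever [K] is the residue field of an F-finite
   local ring; 0 otherwise. *)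
Definition pdegree (K : comNzRingType) (p : nat) : nat :=
  xget 0%N [set n | exists b : 'I_n -> K, pbasis p b].

Section HilbertKunz.
Variables (Re : realType) (R : comNzRingType) (m : idealr R) (p : nat).
Variable charRp : p \in [pchar R].

(* [log_p] of the degree of the residue field over its [p]-th powers. *)
Definition alpha : Re :=
  ln (pdegree {ideal_quot m} p)%:R / ln p%:R.

(* [beta_i^F(M, N) = l], where [d] is the dimension of [R]. Being a relation, it
   includes the existence of the limit. *)
Definition betaF_is (d i : nat) (M N : lmodType R) (l : \bar Re) : Prop :=
  (fun e : nat => (length Re (Tor i M (frob_mod charRp e N))
     * (((p ^ e)%:R `^ (d%:R + alpha))^-1)%:E)%E) @ \oo --> l.

End HilbertKunz.

(* Main.v *)
Require Import Defs.
From HB Require Import structures.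
From mathcomp Require Import all_boot all_order all_algebra.
From mathcomp Require Import finmap ring.
From mathcomp Require Import all_classical all_reals all_analysis.

Set Implicit Arguments.
Unset Strict Implicit.
Unset Printing Implicit Defensive.

Import Order.TTheory GRing.Theory Num.Theory.

Local Open Scope ring_scope.

(** Let [q = p^e].  The vanishing of [beta_i^F(M, R)] passes to [A] because [A] is an
    [R]-direct summand of a finite power of some [^{E}R]: the kernel of [phi] is a minimal
    prime [P] of [R] (both rings have dimension [d] and [A] is finite over [R]), so
    multiplication by some [c <> 0] of [A] factors through a power of [^{e'}R], and since
    [^{e}A] is free over [A] (Kunz) the element [c] is part of a basis of [^{e}A] for
    large [e], which splits off [A].  Moreover [^{e}A] is free of rank
    [(p^d [L : L^p])^e >= q^(d + alpha)], so a nonzero [Tor_i(M, A)] would make the length of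
    [Tor_i(M, ^{e + E}R)] grow at least like a positive multiple of [q^(d + alpha)].  Hence
    [Tor_i(M, A) = 0] for [j <= i <= j + d].  Dividing [A] successively by a regular
    system of parameters yields [Tor_(j + d)(M, L) = 0] for the residue field [L] of [A],
    a nonzero vector space over the residue field of [R], and a minimal free resolution
    of [M] therefore stops. *)

(** * Submodules, spans and Nakayama's lemma *)

(** Lengths are bounded below by exhibiting chains of submodules. A splitting of copies of [A] off
    copies of [^{e + E}R] is kept as a matrix of linear maps [f], [g] with [\sum_k g w k (f w' k a)]
    equal to [a] for [w = w'] and to 0 otherwise, an identity that every additive functor, in
    particular Tor, preserves. Here [E] and the number [t] of copies are independent of [e], so they
    cost only a constant factor. The passage from [A] to [R] is delicate because [R] may have
    nilpotents: coordinates of [A] over [R] are linear only modulo the kernel of [phi]. This kernel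
    being a minimal prime, one element outside it kills the [q]-th powers of all its elements for
    some [q], and multiplying [q]-th powers by that element restores linearity. Tor is computed from
    the standard free resolution, whose terms are in general not finitely generated, out of reach of
    Nakayama's lemma. Its syzygies are therefore compared with the minimal ones, by maps composing
    to the identity up to a map through a projective module. Localization at a prime is expressed
    throughout by multipliers outside that prime. *)

Section Submodules.
Variables (R : comNzRingType) (V : lmodType R).
Implicit Types (U N : V -> Prop) (P : R -> Prop) (s : seq V).

Definition submod U := U 0 /\ forall a x y, U x -> U y -> U (a *: x + y).

Lemma submod0 U : submod U -> U 0. Proof. by case. Qed.

Lemma submodZ U a x : submod U -> U x -> U (a *: x).
Proof. by move=> [U0 Ul] Ux; rewrite -[_ *: _]addr0; apply: Ul. Qed.

Lemma submodD U x y : submod U -> U x -> U y -> U (x + y).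
Proof. by move=> [U0 Ul] Ux Uy; rewrite -[x]scale1r; apply: Ul. Qed.

Lemma submodN U x : submod U -> U x -> U (- x).
Proof. by move=> sU Ux; rewrite -scaleN1r; apply: submodZ. Qed.

Lemma submodB U x y : submod U -> U x -> U y -> U (x - y).
Proof. by move=> sU Ux Uy; apply: submodD => //; apply: submodN. Qed.

Lemma submod_sum U (I : Type) (r : seq I) (Q : pred I) (F : I -> V) : submod U ->
  (forall i, Q i -> U (F i)) -> U (\sum_(i <- r | Q i) F i).
Proof.
move=> sU UF; apply: (big_ind U) => //; first exact: submod0.
by move=> x y; apply: submodD.
Qed.

(** For an ideal [P] this is [P] times the span of [s]. Recursion on the list lets inductions peel
    off one generator at a time. *)
Fixpoint cspan P s (x : V) : Prop :=
  if s is g :: s' then exists a y, [/\ P a, cspan P s' y & x = a *: g + y]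
  else x = 0.

Definition lspan := cspan (fun=> True).

Definition fin_gen_sub U := exists s, forall x, U x <-> lspan s x.

Definition ideal P := P 0 /\ forall a x y, P x -> P y -> P (a * x + y).

Lemma cspan_submod P s : ideal P -> submod (cspan P s).
Proof.
move=> [P0 Pl]; elim: s => [|g s [s0 sl]] /=.
  by split=> // a x y -> ->; rewrite scaler0 addr0.
split; first by exists 0, 0; rewrite scale0r addr0.
move=> a x y [b [x' [Pb sx ->]]] [c [y' [Pc sy ->]]].
exists (a * b + c), (a *: x' + y'); split; [exact: Pl|exact: sl|].
by rewrite scalerDl scalerDr scalerA addrACA.
Qed.

Lemma cspanW P (P' : R -> Prop) s x :
  (forall a, P a -> P' a) -> cspan P s x -> cspan P' s x.
Proof.
move=> PP'; elim: s x => [|g s IH] x //= [a [y [/PP' Pa /IH sy ->]]].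
by exists a, y.
Qed.

Lemma cspan_lspan P s x : cspan P s x -> lspan s x.
Proof. exact: cspanW. Qed.

Lemma lspan_submod s : submod (lspan s). Proof. exact: cspan_submod. Qed.

Lemma lspan_sub s U x : submod U -> (forall g, g \in s -> U g) -> lspan s x -> U x.
Proof.
move=> sU; elim: s x => [|g s IH] x /= sUs; first by move=> ->; apply: submod0.
move=> [a [y [_ sy ->]]]; apply: sU.2; first by apply: sUs; rewrite mem_head.
by apply: IH sy => h hs; apply: sUs; rewrite inE hs orbT.
Qed.

Lemma mem_lspan s g : g \in s -> lspan s g.
Proof.
elim: s => //= h s IH; rewrite inE => /orP[/eqP ->|/IH sg].
  by exists 1, 0; rewrite scale1r addr0; split=> //; exact: (lspan_submod s).1.
by exists 0, g; rewrite scale0r add0r.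
Qed.

Lemma lspan_subP s s' x : (forall g, g \in s -> lspan s' g) -> lspan s x -> lspan s' x.
Proof. by move=> H; apply: lspan_sub H; exact: lspan_submod. Qed.

Lemma lspan_catl s s' x : lspan s x -> lspan (s ++ s') x.
Proof. by apply: lspan_subP => g gs; apply: mem_lspan; rewrite mem_cat gs. Qed.

Lemma lspan_catr s s' x : lspan s' x -> lspan (s ++ s') x.
Proof. by apply: lspan_subP => g gs; apply: mem_lspan; rewrite mem_cat gs orbT. Qed.

Lemma lspan_ord (k : nat) (g : 'I_k -> V) x :
  lspan [seq g i | i <- enum 'I_k] x <-> exists a, x = \sum_i a i *: g i.
Proof.
split; last first.
  move=> [a ->]; apply: submod_sum => [|i _]; first exact: lspan_submod.
  apply: submodZ; first exact: lspan_submod.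
  by apply/mem_lspan/mapP; exists i; rewrite ?mem_enum.
pose U x := exists a, x = \sum_i a i *: g i.
apply: (@lspan_sub _ U) => [|_ /mapP[i _ ->]].
  split; first by exists (fun=> 0); rewrite big1 // => i; rewrite scale0r.
  move=> c _ _ [a ->] [b ->]; exists (fun i => c * a i + b i).
  rewrite scaler_sumr -big_split; apply: eq_bigr => i _ /=.
  by rewrite scalerA scalerDl.
exists (fun i' => (i' == i)%:R); rewrite (bigD1 i) //= eqxx scale1r big1 ?addr0 //.
by move=> i' /negPf ->; rewrite scale0r.
Qed.

Lemma cspan_nth P s x : P 0 -> cspan P s x <->
  exists a : 'I_(size s) -> R, (forall i, P (a i)) /\ x = \sum_i a i *: s`_i.
Proof.
move=> P0; elim: s x => [|g s IH] x /=.
  split=> [->|[a [_ ->]]]; last by rewrite big_ord0.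
  by exists (fun=> 0); rewrite big_ord0.
split=> [[a [y [Pa /IH[b [Pb ->]] ->]]]|[a [Pa ->]]].
  exists (fun i => oapp b a (unlift ord0 i)); split.
    by move=> i; case: unliftP => [j|] /=.
  rewrite big_ord_recl unlift_none /=; congr (_ + _).
  by apply: eq_bigr => i _; rewrite liftK.
exists (a ord0), (\sum_(i < size s) a (lift ord0 i) *: s`_i).
rewrite big_ord_recl; split=> //; apply/IH.
by exists (fun i => a (lift ord0 i)).
Qed.

(* The submodule [P N]. *)
Definition smul P N (z : V) : Prop :=
  forall U, submod U -> (forall a x, P a -> N x -> U (a *: x)) -> U z.

Lemma smul_submod P N : submod (smul P N).
Proof.
split=> [|a x y Px Py] U sU PU; first exact: submod0.
by apply: sU.2; [exact: Px|exact: Py].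
Qed.

Lemma mem_smul P N a x : P a -> N x -> smul P N (a *: x).
Proof. by move=> Pa Nx U _; apply. Qed.

Lemma smulW P N N' z : (forall x, N x -> N' x) -> smul P N z -> smul P N' z.
Proof.
move=> NN' Nz U sU PU; apply: Nz => // a x Pa /NN'; exact: PU.
Qed.

Lemma smul_lspan P s z : ideal P -> smul P (lspan s) z -> cspan P s z.
Proof.
move=> iP; apply; first exact: cspan_submod.
move=> a x Pa; elim: s x => [|g s IH] x /=; first by move=> ->; rewrite scaler0.
move=> [b [y [_ sy ->]]]; exists (a * b), (a *: y).
by rewrite scalerDr scalerA; split=> //; [rewrite mulrC -[b * a]addr0; apply: iP.2 Pa iP.1|exact: IH].
Qed.

Definition prime_ideal P :=
  [/\ ideal P, ~ P 1 & forall x y, P (x * y) -> P x \/ P y].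

End Submodules.

Section Ideals.
Variable R : comNzRingType.
Implicit Types P I : R -> Prop.

Lemma ideal_submod I : ideal I -> @submod R R^o I. Proof. by []. Qed.

Lemma idealM I a x : ideal I -> I x -> I (a * x).
Proof. by move=> iI; apply: (submodZ a (ideal_submod iI)). Qed.
Lemma idealMr I a x : ideal I -> I x -> I (x * a).
Proof. by rewrite mulrC; apply: idealM. Qed.
Lemma idealD I x y : ideal I -> I x -> I y -> I (x + y).
Proof. by move/ideal_submod; apply: submodD. Qed.
Lemma idealB I x y : ideal I -> I x -> I y -> I (x - y).
Proof. by move/ideal_submod; apply: submodB. Qed.
Lemma idealN I x : ideal I -> I x -> I (- x).
Proof. by move/ideal_submod; apply: submodN. Qed.
Lemma ideal0 I : ideal I -> I 0. Proof. by case. Qed.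
Lemma ideal_sum I (T : Type) (r : seq T) (Q : pred T) (F : T -> R) : ideal I ->
  (forall i, Q i -> I (F i)) -> I (\sum_(i <- r | Q i) F i).
Proof. by move/ideal_submod; apply: submod_sum. Qed.

Lemma prime_id P : prime_ideal P -> ideal P. Proof. by case. Qed.
Lemma prime1 P : prime_ideal P -> ~ P 1. Proof. by case. Qed.
Lemma primeM P x y : prime_ideal P -> ~ P x -> ~ P y -> ~ P (x * y).
Proof. by case=> _ _ PM Px Py /PM[]. Qed.
Lemma primeX P x k : prime_ideal P -> P (x ^+ k) -> P x.
Proof.
move=> pP; elim: k => [|k IH]; first by rewrite expr0 => /(prime1 pP).
by rewrite exprS => Px; case: pP => _ _ /(_ _ _ Px) [].
Qed.
(** Localized at [P], the hypothesis puts [N] inside [N' + P N]; the multipliers [u] are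
    denominators. Induction on generators of [N]: in the relation for [g] the coefficient [a] of [g]
    on the right is in [P], so [u - a] is a denominator and the relation can be solved for [g]. *)
Lemma nakayama (V : lmodType R) (P : R -> Prop) (N N' : V -> Prop) :
    prime_ideal P -> submod N' -> fin_gen_sub N ->
    (forall x, N x -> exists u y, [/\ ~ P u, N' y & smul P N (u *: x - y)]) ->
  forall x, N x -> exists u, ~ P u /\ N' (u *: x).
Proof.
move=> pP sN' [s Ns] H.
suff K : forall x, lspan s x -> exists u, ~ P u /\ N' (u *: x) by move=> x /Ns /K.
have {Ns}H x : lspan s x -> exists u y z, [/\ ~ P u, N' y, cspan P s z & u *: x = y + z].
  move=> /Ns /H[u [y [Pu N'y sz]]]; exists u, y, (u *: x - y); split=> //.
    by apply: smul_lspan; [case: pP|apply: smulW sz => t /Ns].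
  by rewrite addrC subrK.
have iP := prime_id pP.
elim: s H => [|g s IH] H x /=.
  by move=> ->; exists 1; rewrite scaler0; split; [exact: prime1|exact: submod0].
have [|u [y [_ [Pu N'y [a [z [Pa sz ->]]] Hg]]]] := H g.
  by apply: mem_lspan; rewrite mem_head.
pose v := u - a.
have Pv : ~ P v by move=> /(idealD iP Pa); rewrite addrC subrK.
have vg : v *: g = y + z by rewrite scalerBl Hg [_ *: g + z]addrC addrA addrK.
have {}IH : forall x, lspan s x -> exists u, ~ P u /\ N' (u *: x).
  apply: IH => x' sx'.
  have [|w [y' [_ [Pw N'y' [b [z' [Pb sz' ->]]] Hx]]]] := H x'.
    exact: (@lspan_catr _ _ [:: g] s).
  (* Multiplying by [v] turns the term [b *: g] into [b *: (y + z)], which no longer involves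
     [g]. *)
  exists (v * w), (v *: y' + b *: y), (b *: z + v *: z'); split.
  - exact: primeM.
  - by apply: sN'.2 => //; apply: submodZ.
  - by apply: (cspan_submod s iP).2 => //; apply: submodZ => //; apply: cspan_submod.
  - rewrite -scalerA Hx !scalerDr scalerA mulrC -scalerA vg scalerDr.
    by rewrite -!addrA; congr (_ + _); rewrite addrA.
have [t [Pt N't]] := IH z (cspan_lspan sz).
move=> [b [x' [_ /IH[w [Pw N'w]] ->]]].
exists (w * t * v); split; first by do !apply: primeM.
rewrite scalerDr.
have -> : (w * t * v) *: (b *: g) = (w * b) *: (t *: y + t *: z).
  by rewrite -scalerDr -vg !scalerA; congr (_ *: _); ring.
have -> : (w * t * v) *: x' = (t * v) *: (w *: x').
  by rewrite !scalerA; congr (_ *: _); ring.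
by apply: submodD => //; apply: submodZ => //; apply: submodD => //; apply: submodZ.
Qed.

Definition iadd I (x z : R) : Prop := exists a y, I y /\ z = a * x + y.

Lemma iadd_ideal I x : ideal I -> ideal (iadd I x).
Proof.
move=> iI; split; first by exists 0, 0; rewrite mul0r addr0; split=> //; apply: ideal0.
move=> c _ _ [a [y [Iy ->]]] [b [z [Iz ->]]].
exists (c * a + b), (c * y + z); split; first exact: iI.2.
ring.
Qed.

Lemma iadd_sub I x z : I z -> iadd I x z.
Proof. by exists 0, z; rewrite mul0r add0r. Qed.

Lemma iadd_gen I x : ideal I -> iadd I x x.
Proof. by move=> iI; exists 1, 0; rewrite mul1r addr0; split=> //; apply: ideal0. Qed.

Lemma iadd_min I J x z : ideal J -> (forall y, I y -> J y) -> J x -> iadd I x z -> J z.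
Proof. by move=> iJ IJ Jx [a [y [/IJ Jy ->]]]; apply: iJ.2. Qed.

Definition noeth := forall I : R -> Prop, ideal I -> @fin_gen_sub R R^o I.

(** Induction on the generators: the coefficients that [g] takes in elements of [U] form an ideal.
    Finitely many elements of [U] realize its generators; what remains of [U] lies in the span of
    the other generators. *)
Lemma noeth_fin_gen_sub (V : lmodType R) (s : seq V) (U : V -> Prop) : noeth ->
  submod U -> (forall x, U x -> lspan s x) -> fin_gen_sub U.
Proof.
move=> nR; elim: s U => [|g s IH] U sU Us.
  exists [::] => x; split; first exact: Us.
  by move=> ->; apply: submod0.
pose I (a : R) := exists y, lspan s y /\ U (a *: g + y).
have iI : ideal I.
  split; first by exists 0; rewrite scale0r addr0; split; apply: submod0 => //; apply: lspan_submod.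
  move=> c a b [x [sx Ux]] [y [sy Uy]]; exists (c *: x + y); split.
    exact: (lspan_submod s).2.
  by rewrite scalerDl -scalerA addrACA -scalerDr; apply: sU.2.
have [t It] := nR I iI.
have [r Hr] : exists r : seq V, (forall x, x \in r -> U x) /\
   forall a, @lspan R R^o t a -> exists y, lspan s y /\ lspan r (a *: g + y).
  have {It} : forall a, a \in t -> I a by move=> a /(@mem_lspan R R^o) /It.
  elim: t => [|a t IHt] It.
    by exists [::]; split=> // a -> /=; exists 0; rewrite scale0r addr0; split=> //; apply: (lspan_submod s).1.
  have [|r [rU Hr]] := IHt; first by move=> b bt; apply: It; rewrite inE bt orbT.
  have [x [sx Ux]] := It a (mem_head _ _).
  exists (a *: g + x :: r); split; first by move=> y; rewrite inE => /orP[/eqP ->//|/rU].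
  move=> _ [c [b [_ /Hr[y [sy ry]] ->]]]; exists (c *: x + y); split.
    exact: (lspan_submod s).2.
  exists c, (b *: g + y); split=> //.
  by rewrite scalerDl scalerDr scalerA addrACA.
have [||r' Hr'] := IH (fun x => U x /\ lspan s x).
- split; first by split; apply: submod0 => //; apply: lspan_submod.
  by move=> a x y [Ux sx] [Uy sy]; split; [exact: sU.2|exact: (lspan_submod s).2].
- by move=> x [].
exists (r ++ r') => x; split=> [Ux|]; last first.
  apply: lspan_sub => // y; rewrite mem_cat => /orP[/Hr.1//|/mem_lspan /Hr'[]//].
have [a [y [_ sy xE]]] := Us x Ux.
have [|z [sz rz]] := Hr.2 a; first by apply/It; exists y; rewrite -xE.
have -> : x = (a *: g + z) + (y - z) by rewrite addrACA subrr addr0 xE.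
apply: submodD; [exact: lspan_submod|exact: lspan_catl|apply/lspan_catr/Hr'].
split; last by apply: submodB => //; apply: lspan_submod.
have -> : y - z = x - (a *: g + z) by rewrite xE opprD addrACA subrr add0r.
apply: submodB => //; apply: lspan_sub rz => // h /Hr.1 //.
Qed.

(** Otherwise choice yields a strictly increasing sequence in [F]. Its union is finitely generated,
    so the generators all occur at one stage, where the sequence must stop. *)
Lemma noeth_acc (V : lmodType R) (s : seq V) (F : (V -> Prop) -> Prop) U0 : noeth ->
    (forall x, lspan s x) -> (forall U, F U -> submod U) -> F U0 ->
  exists U, [/\ F U, forall x, U0 x -> U x &
     forall W, F W -> (forall x, U x -> W x) -> forall x, W x -> U x].
Proof.
move=> nR sV FU FU0; apply: contrapT => noU.
pose T := {U | F U /\ forall x, U0 x -> U x}.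
have {noU}step (U : T) : exists W : T, (forall x, sval U x -> sval W x) /\
    exists2 x, sval W x & ~ sval U x.
  apply: contrapT => noW; apply: noU; exists (sval U); case: (svalP U) => FU' U0U.
  split=> // W FW UW x Wx; apply: contrapT => Ux; apply: noW.
  by exists (exist _ W (conj FW (fun y Uy => UW y (U0U y Uy)))); split=> //; exists x.
have [f Hf] := choice step.
pose u k : T := iter k f (exist _ U0 (conj FU0 (fun _ h => h))).
have umono i j x : (i <= j)%N -> sval (u i) x -> sval (u j) x.
  elim: j => [|j IH]; first by rewrite leqn0 => /eqP ->.
  by rewrite leq_eqVlt => /orP[/eqP->//|/IH ux /ux]; apply: (Hf (u j)).1.
have usub i : submod (sval (u i)) by apply: FU; case: (svalP (u i)).
have [||r Hr] := @noeth_fin_gen_sub V s (fun x => exists i, sval (u i) x) nR.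
- split; first by exists 0%N; apply: submod0.
  move=> a x y [i ux] [j uy]; exists (maxn i j).
  by apply: (usub _).2; [apply: umono ux; exact: leq_maxl|apply: umono uy; exact: leq_maxr].
- by [].
have [k Hk] : exists k, forall x, x \in r -> sval (u k) x.
  have {Hr} : forall x, x \in r -> exists i, sval (u i) x.
    by move=> x /mem_lspan /Hr.
  elim: r => [|x r IH] H; first by exists 0%N.
  have [|k Hk] := IH; first by move=> y yr; apply: H; rewrite inE yr orbT.
  have [i ui] := H x (mem_head _ _).
  exists (maxn i k) => y; rewrite inE => /orP[/eqP ->|/Hk uy].
    by apply: umono ui; exact: leq_maxl.
  by apply: umono uy; exact: leq_maxr.
have [_ [x ux nux]] := Hf (u k); apply: nux.
by apply: (lspan_sub (usub k) Hk); apply/Hr; exists k.+1.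
Qed.

Lemma noeth_acc_ideal (F : (R -> Prop) -> Prop) I0 : noeth ->
    (forall I, F I -> ideal I) -> F I0 ->
  exists I, [/\ F I, forall x, I0 x -> I x &
     forall J, F J -> (forall x, I x -> J x) -> forall x, J x -> I x].
Proof.
move=> nR FI; apply: (@noeth_acc R^o [:: 1]) => // x.
by exists x, 0; rewrite addr0; split=> //; rewrite /GRing.scale /= mulr1.
Qed.

End Ideals.

(** * Krull's height theorem and regular local rings *)

Section KrullHeight.
Variable R : comNzRingType.
Implicit Types P Q I J : R -> Prop.

(** An ideal that is maximal among the annihilators of nonzero elements of [R / I] is prime. *)
Lemma assoc_prime I : noeth R -> ideal I -> ~ I 1 ->
  exists a, ~ I a /\ prime_ideal (fun r => I (r * a)).
Proof.
move=> nR iI I1; pose F K := exists a, ~ I a /\ forall r, K r <-> I (r * a).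
have colon a : ideal (fun r => I (r * a)).
  split; first by rewrite mul0r; apply: ideal0.
  by move=> c x y Ix Iy; rewrite mulrDl -mulrA; apply: iI.2.
have [||K [[a [Ia Ka]] _ Kmax]] := @noeth_acc_ideal _ F I nR.
- move=> K [a [_ Ka]]; split; first by apply/Ka/(ideal0 (colon a)).
  by move=> c x y /Ka Kx /Ka Ky; apply/Ka/(colon a).2.
- by exists 1; split=> // r; rewrite mulr1.
exists a; split=> //; split=> //; first by rewrite mul1r.
move=> x y Ixy; have [Iy|Iy] := EM (I (y * a)); [by right|left].
apply/Ka/(Kmax (fun r => I (r * (y * a)))); last by rewrite mulrA.
  by exists (y * a).
by move=> r /Ka Ir; rewrite mulrCA; apply: idealM.
Qed.

(** For a prime [P], saturated ideals are the contractions of ideals of the localization at [P], and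
    stand in for them. *)
Definition saturated P I := forall s a, ~ P s -> I (s * a) -> I a.

Definition saturation P I a := exists s, ~ P s /\ I (s * a).

Lemma saturation_ideal P I : prime_ideal P -> ideal I -> ideal (saturation P I).
Proof.
move=> pP iI; split.
  by exists 1; rewrite mulr0; split; [exact: prime1|exact: ideal0].
move=> a x y [s [Ps Ix]] [t [Pt Iy]]; exists (s * t); split; first exact: primeM.
have -> : s * t * (a * x + y) = (t * a) * (s * x) + s * (t * y) by ring.
by apply: iI.2 => //; apply: idealM.
Qed.

Lemma saturation_sub P I x : prime_ideal P -> I x -> saturation P I x.
Proof. by move=> pP Ix; exists 1; rewrite mul1r; split=> //; apply: prime1. Qed.

Lemma saturation_sat P I : prime_ideal P -> saturated P (saturation P I).
Proof.
move=> pP s a Ps [t [Pt Ia]]; exists (t * s); rewrite -mulrA; split=> //.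
exact: primeM.
Qed.

(* If [P] is minimal over [J], then the localization at [P] of [R / J] is Artinian. *)
Lemma saturated_dcc P J (K : nat -> R -> Prop) : noeth R -> prime_ideal P -> ideal J ->
    (forall P', prime_ideal P' -> (forall x, J x -> P' x) -> (forall x, P' x -> P x) ->
       forall x, P x -> P' x) ->
    (forall k, [/\ ideal (K k), saturated P (K k), forall x, J x -> K k x &
       forall x, K k.+1 x -> K k x]) ->
  exists k, forall x, K k x -> K k.+1 x.
Proof.
move=> nR pP iJ Pmin HK.
have Kmono i j x : (i <= j)%N -> K j x -> K i x.
  elim: j => [|j IH]; first by rewrite leqn0 => /eqP ->.
  rewrite leq_eqVlt => /orP[/eqP->//|/IH Kji Kx]; apply: Kji.
  by case: (HK j) => _ _ _; apply.
have iK k : ideal (K k) by case: (HK k).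
have sK k : saturated P (K k) by case: (HK k).
have JK k x : J x -> K k x by case: (HK k) => _ _ + _; apply.
(* Inside [I] the sequence is constant from [k0] on. A maximal such [I] will turn out to contain
   1. *)
pose D I := exists k0, forall k x, (k0 <= k)%N -> K k0 x -> I x -> K k x.
pose F I := [/\ ideal I, saturated P I, forall x, J x -> I x & D I].
have [||I [[iI satI JI [k0 Hk0]] _ Imax]] := @noeth_acc_ideal _ F (saturation P J) nR.
- by move=> I [].
- split; [exact: saturation_ideal|exact: saturation_sat|by move=> x; apply: saturation_sub|].
  by exists 0%N => k x _ _ [s [Ps Jx]]; apply: (sK k s) => //; apply: JK.
have [I1|I1] := EM (I 1).
  exists k0 => x Kx; apply: Hk0 => //.
  by rewrite -[x]mulr1; apply: idealM.
exfalso; have [a [Ia pI]] := assoc_prime nR iI I1; apply: (Ia).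
(* The annihilator of [a] modulo [I] is a prime over [J] inside [P], hence equals [P]: locally,
   adjoining [a] to [I] adds one copy of the residue field. *)
have PI r : P r -> I (r * a).
  apply: (Pmin _ pI) => [x /JI Ix|x Ix]; first exact: idealMr.
  by apply: contrapT => Px; apply/Ia/(satI x).
have iIa : ideal (iadd I a) by apply: iadd_ideal.
apply: (Imax (saturation P (iadd I a))) => [|x Ix|]; last 2 first.
- exact/saturation_sub/iadd_sub.
- exact/saturation_sub/iadd_gen.
split; [exact: saturation_ideal|exact: saturation_sat| |].
  by move=> x /JI Ix; apply/saturation_sub/iadd_sub.
(* Either some [K k] meets the enlarged ideal only inside [I], and the sequence is constant there
   from [k] on; or each [K k] with [k >= k0] has an element [b] of the enlarged ideal outside [I],
   and multiples of [b] correct elements of [K k0] into [I]. *)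
have [[k [kk0 [_ KI]]]|noK] := EM (exists k, (k0 <= k)%N /\ (True /\
    forall x, K k x -> saturation P (iadd I a) x -> I x)).
  exists k => l x kl Kx Ix; apply: Hk0; first exact: leq_trans kl.
    exact: Kmono Kx.
  exact: KI.
exists k0 => k c k0k Kc [s' [Ps' [t' [i' [Ii' Ec]]]]].
have [b [Kb [[s [Ps [t [i [Ii Eb]]]]] Ib]]] :
    exists b, K k b /\ (saturation P (iadd I a) b /\ ~ I b).
  apply: contrapT => nob; apply: noK; exists k; split=> //; split=> // x Kx Ix.
  by apply: contrapT => nIx; apply: nob; exists x.
have Pt : ~ P t.
  move=> /PI Ita; apply: Ib; apply: (satI s) => //.
  by rewrite Eb; apply: idealD.
have E : t * s' * c - t' * s * b = t * i' - t' * i.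
  by rewrite -!mulrA Ec Eb; ring.
apply: (sK k (t * s')); first exact: primeM.
rewrite -[_ * c](subrK (t' * s * b)); apply: idealD => //; last exact: idealM.
apply: Hk0 => //; last by rewrite E; apply: idealB => //; apply: idealM.
by apply: idealB => //; apply: idealM => //; apply: Kmono Kb.
Qed.

(* The ideal [P0 + Q ^ k]. *)
Fixpoint pow_mod (P0 Q : R -> Prop) k : R -> Prop :=
  if k is k'.+1 then fun z => exists w, P0 w /\ @smul R R^o Q (pow_mod P0 Q k') (z - w)
  else fun=> True.

Lemma pow_mod_ideal P0 Q k : ideal P0 -> ideal (pow_mod P0 Q k).
Proof.
move=> i0; elim: k => //= k IH; split.
  by exists 0; rewrite subrr; split; [exact: ideal0|exact: (smul_submod _ _).1].
move=> a x y [v [Pv Qx]] [w [Pw Qy]]; exists (a * v + w); split; first exact: i0.2.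
have -> : a * x + y - (a * v + w) = a * (x - v) + (y - w) by ring.
exact: (smul_submod _ _).2.
Qed.

Lemma pow_mod_dec P0 Q k z : ideal P0 -> pow_mod P0 Q k.+1 z -> pow_mod P0 Q k z.
Proof.
move=> i0; elim: k z => // k IH z [w [Pw Qz]]; exists w; split=> //.
by apply: smulW Qz => x; apply: IH.
Qed.

Lemma pow_mod_exp P0 Q k z : ideal P0 -> Q z -> pow_mod P0 Q k (z ^+ k).
Proof.
move=> i0 Qz; elim: k => // k IH; exists 0; split; first exact: ideal0.
by rewrite subr0 exprS; apply: (@mem_smul R R^o).
Qed.

Lemma pow_mod_sub P0 Q k z : ideal P0 -> P0 z -> pow_mod P0 Q k z.
Proof.
case: k => // k _ P0z; exists z; split=> //.
by rewrite subrr; apply: (smul_submod _ _).1.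
Qed.

Definition psub P Q := (forall x, P x -> Q x) /\ exists y, Q y /\ ~ P y.

(* Otherwise [P] would be minimal over [P0 + (x)], so that the symbolic powers of [P1]
   modulo [P0] would become constant locally at [P]; by Nakayama's lemma, applied first
   at [P] and then at [P1], some power of [P1] would lie in [P0]. *)
Lemma krull_between P0 P1 P x : noeth R ->
    prime_ideal P0 -> prime_ideal P1 -> prime_ideal P ->
    psub P0 P1 -> psub P1 P -> P x ->
  exists P', [/\ prime_ideal P', psub P0 P', psub P' P & P' x].
Proof.
move=> nR p0 p1 pP [P01 [y1 [P1y1 P0y1]]] [P1P [y2 [Py2 P1y2]]] Px.
have [P0x|P0x] := EM (P0 x).
  by exists P1; split=> //; [split=> //; exists y1|split=> //; exists y2|apply: P01].
apply: contrapT => noP.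
have i0 := prime_id p0; have i1 := prime_id p1; have iP := prime_id pP.
have Pmin P' : prime_ideal P' -> (forall z, iadd P0 x z -> P' z) ->
    (forall z, P' z -> P z) -> forall z, P z -> P' z.
  move=> p' JP' P'P z Pz; apply: contrapT => P'z; apply: noP; exists P'.
  have P'x : P' x by apply/JP'/iadd_gen.
  split=> //; last by split=> //; exists z.
  by split; [move=> t Pt; apply/JP'/iadd_sub|exists x].
have P1x : ~ P1 x.
  move=> P1x; apply: P1y2; apply: (Pmin P1) => // z.
  exact: iadd_min.
pose T := pow_mod P0 P1; pose S k := saturation P1 (T k).
have iT k : ideal (T k) by apply: pow_mod_ideal.
have iS k : ideal (S k) by apply: saturation_ideal.
pose K k := saturation P (iadd (S k) x).
have [|||k Hk] := @saturated_dcc P (iadd P0 x) K nR pP.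
- exact: iadd_ideal.
- exact: Pmin.
- move=> k; split; first by apply: saturation_ideal => //; apply: iadd_ideal.
  + exact: saturation_sat.
  + move=> z Jz; apply: saturation_sub => //.
    apply: iadd_min Jz => [|y Py|]; [exact: iadd_ideal| |exact: iadd_gen].
    exact/iadd_sub/saturation_sub/pow_mod_sub.
  + move=> z [s [Ps [a [y [[t [Pt Ty]] E]]]]]; exists s; split=> //.
    by exists a, y; split=> //; exists t; split=> //; apply: pow_mod_dec Ty.
have SS a : S k a -> S k.+1 a.
  move=> Sa.
  have [b Sb|u [Pu [t [P1t Tu]]]] :=
      @nakayama _ R^o P (S k) (S k.+1) pP (iS _) (nR _ (iS k)) _ a Sa.
    have /Hk[s [Ps [c [y [Sy E]]]]] : K k b by apply/saturation_sub/iadd_sub.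
    exists s, y; split=> //.
    (* As [x] is outside [P1], the symbolic power contains [c] along with [c * x]; so the error term
       lies in [P] times [S k]. *)
    have Ecx : s * b - y = c * x by rewrite E addrK.
    have : S k (c * x).
      rewrite -Ecx; apply: idealB => //; first exact: idealM.
      by case: Sy => t [Pt Ty]; exists t; split=> //; apply: pow_mod_dec Ty.
    case=> t [Pt Tcx]; rewrite [_ *: _ - _]Ecx mulrC; apply: (@mem_smul R R^o) => //.
    by exists (t * x); split; [exact: primeM|rewrite -mulrA [x * c]mulrC].
  exists (t * u); rewrite -mulrA; split=> //; apply: primeM => // /P1P //.
have TP0 z : T k z -> P0 z.
  move=> Tz.
  have [b Tb|u [Pu P0u]] := @nakayama _ R^o P1 (T k) P0 p1 i0 (nR _ (iT k)) _ z Tz.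
    have /SS[t [P1t [w [P0w Tw]]]] : S k b by apply: saturation_sub.
    by exists t, w.
  by case: p0 => _ _ /(_ _ _ P0u)[/P01|].
apply: P0y1; apply: (@primeX _ _ _ k p0); apply: TP0.
exact: pow_mod_exp.
Qed.

(** The height of [P] over [I] is at least [m]. The chain is read from the top prime down; the empty
    predicate as [I] leaves its bottom unconstrained. *)
Fixpoint chain_above I m P : Prop := prime_ideal P /\
  if m is m'.+1 then exists Q, chain_above I m' Q /\ psub Q P
  else forall x, I x -> P x.

Lemma chain_above_sub I m P x : chain_above I m P -> I x -> P x.
Proof.
elim: m P => [|m IH] P [pP]; first by move=> IP; apply: IP.
by move=> [Q [/IH IQ [QP _]]] /IQ /QP.
Qed.

Lemma chain_above_prime I m P : chain_above I m P -> prime_ideal P.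
Proof. by case: m => [|m] []. Qed.

Lemma chain_aboveW I J m P : (forall x, J x -> I x) -> chain_above I m P ->
  chain_above J m P.
Proof.
move=> JI; elim: m P => [|m IH] P [pP H]; split=> //.
  by move=> x /JI; apply: H.
by have [Q [/IH HQ QP]] := H; exists Q.
Qed.

Lemma chain_above_bottom I m P : chain_above I m P ->
  exists Q, [/\ prime_ideal Q, forall x, I x -> Q x & chain_above Q m P].
Proof.
elim: m P => [|m IH] P [pP H]; first by exists P.
have [Q [/IH[Q0 [p0 IQ0 c0]] QP]] := H; exists Q0; split=> //; split=> //.
by exists Q.
Qed.

Lemma chain_above_ext I Q m P : prime_ideal I -> psub I Q -> chain_above Q m P ->
  chain_above I m.+1 P.
Proof.
move=> pI [IQ [y [Qy Iy]]]; elim: m P => [|m IH] P [pP H]; split=> //.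
  exists I; split; first by split.
  by split; [move=> x /IQ /H|exists y; split=> //; apply: H].
by have [Q' [/IH cQ' Q'P]] := H; exists Q'.
Qed.

(** Krull's height theorem in inductive form: [krull_between] pushes [x] down the chain, exchanging
    each prime for one that contains [x], until only the bottom prime is lost. *)
Lemma chain_above_drop I m P x : noeth R -> chain_above I m.+1 P -> P x ->
  chain_above (iadd I x) m P.
Proof.
move=> nR; elim: m P => [|m IH] P [pP [Q [cQ QP]]] Px.
  split=> // z; apply: iadd_min => //; first by apply: prime_id.
  by move=> y Iy; apply/QP.1/cQ.2.
split=> //; case: cQ => pQ [Q0 [c0 Q0Q]].
have [Q' [p' Q0Q' Q'P Q'x]] :=
  krull_between nR (chain_above_prime c0) pQ pP Q0Q QP Px.
by exists Q'; split=> //; apply: IH => //; split=> //; exists Q0.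
Qed.

Definition gen_ideal (s : seq R) : R -> Prop := @lspan R R^o s.

Lemma gen_ideal_ideal s : ideal (gen_ideal s). Proof. exact: lspan_submod. Qed.

Lemma gen_ideal_cons g s x : gen_ideal (g :: s) x <-> iadd (gen_ideal s) g x.
Proof. by split=> [[a [y [_ sy ->]]]|[a [y [sy ->]]]]; exists a, y. Qed.

(** A zipper on generators of [n]: those in [s] are factored out already, those in [pre] are still
    to come, and each one costs at most one step of the chain. *)
Lemma chain_above_leq (n : R -> Prop) pre s m : noeth R ->
    (forall x, gen_ideal (catrev pre s) x <-> n x) ->
  chain_above (gen_ideal s) m n -> (m <= size pre)%N.
Proof.
move=> nR; elim: pre s m => [|g pre IH] s [|m] //= Hn H.
  exfalso; case: H => _ [Q [cQ [_ [y [ny Qy]]]]]; apply: Qy.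
  by apply: (chain_above_sub cQ); apply/Hn.
apply: (IH (g :: s)) => //.
apply: (@chain_aboveW (iadd (gen_ideal s) g)); first by move=> x /gen_ideal_cons.
apply: chain_above_drop => //; apply/Hn/mem_lspan.
by rewrite catrevE mem_cat mem_head orbT.
Qed.

(* If [Q0] is the bottom of a chain of length [size pre] above [gen_ideal s], then by
   dimension [g] is not in [Q0], which is contained in the prime [gen_ideal (g :: s)]; hence
   [Q0 = gen_ideal s + g Q0], and [Q0 = gen_ideal s] by Nakayama's lemma. *)
Lemma regular_prime (n : R -> Prop) pre s : noeth R ->
    (forall u, ~ n u -> exists v, v * u = 1) ->
    (forall x, gen_ideal (catrev pre s) x <-> n x) ->
    chain_above (gen_ideal s) (size pre) n ->
  prime_ideal (gen_ideal s) /\ forall g pre', pre = g :: pre' -> ~ gen_ideal s g.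
Proof.
move=> nR nloc; elim: pre s => [|g pre IH] s Hn H.
  split=> //; have [in_ n1 nM] := chain_above_prime H.
  split; [exact: gen_ideal_ideal|by move/Hn|].
  by move=> x y /Hn /nM[] ?; [left|right]; apply/Hn.
have pn := chain_above_prime H.
rewrite /= in Hn; have ng : n g.
  by apply/Hn/mem_lspan; rewrite catrevE mem_cat mem_head orbT.
have [Q0 [p0 sQ0 c0]] := chain_above_bottom H.
have {H}Hg : chain_above (gen_ideal (g :: s)) (size pre) n.
  apply: (@chain_aboveW (iadd (gen_ideal s) g)); first by move=> x /gen_ideal_cons.
  exact: chain_above_drop.
have [pgs _] := IH (g :: s) Hn Hg.
have i0 := prime_id p0.
have Q0g : ~ Q0 g.
  move=> Q0g; suff : (size pre < size pre)%N by rewrite ltnn.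
  apply: (chain_above_leq nR Hn); apply: chain_aboveW c0 => x /gen_ideal_cons.
  exact: iadd_min.
(* Otherwise the prime generated by [g :: s] could be added strictly below a chain of length
   [size pre] that starts over both [Q0] and [g]. *)
have Q0s x : Q0 x -> gen_ideal (g :: s) x.
  have [Q1 [p1 Q01 c1]] := chain_above_bottom (chain_above_drop nR c0 ng).
  move=> /(iadd_sub g) /Q01 Q1x; apply: contrapT => sx.
  suff : (size pre < size pre)%N by rewrite ltnn.
  apply: (chain_above_leq nR Hn); apply: (chain_above_ext _ _ c1) => //.
  split; last by exists x.
  move=> y /gen_ideal_cons ysg; apply: Q01; apply: iadd_min ysg.
  - exact: iadd_ideal.
  - by move=> z /sQ0; apply: iadd_sub.
  - exact: iadd_gen.
have EQ x : Q0 x <-> gen_ideal s x.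
  split; last exact: sQ0.
  move=> Q0x.
  have [y Q0y|u [nu su]] :=
      @nakayama _ R^o n Q0 (gen_ideal s) pn (gen_ideal_ideal s) (nR _ i0) _ x Q0x.
    have /gen_ideal_cons[a [z [sz E]]] := Q0s _ Q0y.
    exists 1, z; split=> //; first exact: prime1.
    rewrite scale1r E addrK mulrC; apply: (@mem_smul R R^o) => //.
    have : Q0 (a * g) by rewrite -[a * g](addrK z) -E; apply: idealB => //; apply: sQ0.
    by case: p0 => _ _ QM /QM[].
  have [v vu] := nloc u nu.
  by rewrite -[x]mul1r -vu -mulrA; apply: idealM => //; apply: gen_ideal_ideal.
split; last by move=> _ _ [<- _] /EQ.
case: p0 => _ Q1 QM; split; [exact: gen_ideal_ideal|by move/EQ|].
by move=> x y /EQ /QM[] /EQ; [left|right].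
Qed.

End KrullHeight.

(** * Frobenius on a regular local ring *)

Section FrobeniusBasis.
Variables (A : comNzRingType) (p : nat) (charAp : p \in [pchar A]).
Variables (n : A -> Prop) (nA : noeth A) (pn : prime_ideal n).
Hypothesis nloc : forall u, ~ n u -> exists v, v * u = 1.
Implicit Types I J : A -> Prop.

Let p_pr : prime p := pcharf_prime charAp.
Let p_gt0 : (0 < p)%N := prime_gt0 p_pr.

Lemma exprDp (x y : A) : (x + y) ^+ p = x ^+ p + y ^+ p.
Proof. by rewrite -!(pFrobenius_autE charAp) rmorphD. Qed.

Lemma exprBp (x y : A) : (x - y) ^+ p = x ^+ p - y ^+ p.
Proof. by rewrite -!(pFrobenius_autE charAp) rmorphB. Qed.

Section Family.
Variables (T : finType) (B : T -> A).

Definition fcomb (c : T -> A) := \sum_t c t ^+ p * B t.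

Lemma fcombP a c c' : fcomb (fun t => a * c t + c' t) = a ^+ p * fcomb c + fcomb c'.
Proof.
rewrite /fcomb mulr_sumr -big_split; apply: eq_bigr => t _ /=.
by rewrite exprDp exprMn; ring.
Qed.

Lemma fcombB c c' : fcomb c - fcomb c' = fcomb (fun t => c t - c' t).
Proof.
by rewrite /fcomb -sumrB; apply: eq_bigr => t _; rewrite exprBp mulrBl.
Qed.

Lemma fcomb0 : fcomb (fun=> 0) = 0.
Proof. by rewrite /fcomb big1 // => t _; rewrite expr0n gtn_eqF // mul0r. Qed.

(** Together with [ffree], for an ideal [I]: [B] is a basis of [^1(A / I)] over [A / I]. For [I = n]
    it is a basis of the residue field over its [p]-th powers. *)
Definition fgen I := forall a, exists c, I (a - fcomb c).
Definition ffree I := forall c, I (fcomb c) -> forall t, I (c t).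

Lemma fcomb_ideal I c : ideal I -> (forall t, I (c t)) -> I (fcomb c).
Proof.
move=> iI Ic; apply: ideal_sum => // t _; rewrite -(prednK p_gt0) exprS -mulrA.
exact: idealMr.
Qed.

End Family.

Lemma local_saturated I u a : ideal I -> ~ n u -> I (u * a) -> I a.
Proof.
by move=> iI /nloc[v vu] Iua; rewrite -[a]mul1r -vu -mulrA; apply: idealM.
Qed.

Section Step.
Variables (I : A -> Prop) (x : A) (T : finType) (B : T -> A).
Hypotheses (iI : ideal I) (nx : n x).

Definition step_family (it : 'I_p * T) := x ^+ it.1 * B it.2.

Lemma fcomb_step c :
  fcomb step_family c = \sum_(i < p) x ^+ i * fcomb B (fun t => c (i, t)).
Proof.
rewrite /fcomb; under [RHS]eq_bigr do rewrite mulr_sumr.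
rewrite pair_bigA; apply: eq_bigr => -[i t] _ /=; exact: mulrCA.
Qed.

(** Dividing by [x] repeatedly writes [a] modulo [I] as a combination of [step_family] plus
    [x ^+ p * b']. In the pushforward this remainder is the scalar multiple [x *: b'], so Nakayama's
    lemma absorbs it. *)
Lemma fgen_step : fin_gen (frob_mod charAp 1 A^o) -> fgen B (iadd I x) -> fgen step_family I.
Proof.
move=> [m [g Hg]] genB a.
pose N' (y : frob_mod charAp 1 A^o) := exists c, I ((y : A) - fcomb step_family c).
have scE (c : A) (y : frob_mod charAp 1 A^o) : c *: y = c ^+ p * (y : A) :> A.
  by rewrite /GRing.scale /= /restrict_scale /frob expn1.
have sN' : submod N'.
  split; first by exists (fun=> 0); rewrite fcomb0 subr0; apply: ideal0.
  move=> c y z [d Id] [e Ie]; exists (fun t => c * d t + e t).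
  rewrite fcombP.
  have -> : (c *: y + z : A) = c ^+ p * (y : A) + (z : A) by rewrite -scE.
  have -> : c ^+ p * (y : A) + (z : A) - (c ^+ p * fcomb step_family d + fcomb step_family e) =
    c ^+ p * ((y : A) - fcomb step_family d) + ((z : A) - fcomb step_family e).
    by rewrite mulrBr opprD addrACA.
  exact: iI.2.
have expand k : forall b, exists c : nat -> T -> A, exists b',
    I (b - (\sum_(i < k) x ^+ i * fcomb B (c i) + x ^+ k * b')).
  elim: k => [|k IH] b.
    exists (fun _ _ => 0), b; rewrite big_ord0 add0r mul1r subrr; exact: ideal0.
  have [c [b' Ib]] := IH b; have [d [b'' [y [Iy E]]]] := genB b'.
  exists (fun i => if (i < k)%N then c i else d), b''.
  rewrite big_ord_recr /= ltnn.
  rewrite (eq_bigr (fun i : 'I_k => x ^+ i * fcomb B (c i))); last first.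
    by move=> i _; rewrite ltn_ord.
  set S := \sum_(i < k) _ in Ib *.
  have -> : b - (S + x ^+ k * fcomb B d + x ^+ k.+1 * b'') =
     b - (S + x ^+ k * b') + x ^+ k * (b' - fcomb B d - b'' * x).
    by rewrite exprSr; ring.
  apply: idealD => //; apply: idealM => //.
  by rewrite E addrC addKr.
have [|b _|u [nu [c Ic]]] := @nakayama _ (frob_mod charAp 1 A^o) n (fun=> True) N' pn sN' _ _ a Logic.I.
- exists [seq g i | i <- enum 'I_m] => y; split=> // _; apply/lspan_ord.
  exact/Hg.
- have [c [b' Ib]] := expand p b.
  pose d := (fun it : 'I_p * T => c it.1 it.2).
  have dE : fcomb step_family d = \sum_(i < p) x ^+ i * fcomb B (c i).
    exact: fcomb_step.
  exists 1, (b - (x *: (b' : frob_mod charAp 1 A^o))); split.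
  + exact: prime1.
  + exists d; rewrite dE scE.
    by move: Ib; congr I; ring.
  + rewrite scale1r opprB addrCA subrr addr0.
    exact: mem_smul.
have [v vu] := nloc nu.
exists (fun t => v * c t).
have -> : fcomb step_family (fun t => v * c t) = v ^+ p * fcomb step_family c.
  rewrite -[RHS]addr0 -(fcomb0 step_family) -fcombP; congr fcomb.
  by apply: funext => t; rewrite addr0.
have -> : a = v ^+ p * (u ^+ p * a) by rewrite mulrA -exprMn vu expr1n mul1r.
by rewrite -mulrBr; apply: idealM.
Qed.

(* In a relation modulo [I] between the [x ^+ i * B t], the coefficients at [i = 0] are
   divisible by [x] modulo [I], and dividing the relation by [x] rotates it.  After [p]
   rotations every coefficient has been divided by [x], so the ideal [K] of the
   coefficients occurring at a given position satisfies [K = I + x K]. *)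
Lemma ffree_step : (forall y, I (x * y) -> I y) -> ffree B (iadd I x) ->
  ffree step_family I.
Proof.
move=> regx freeB.
(* After [j] rotations the first [j] coefficients, divided by [x] modulo [I], stand at the end of
   the relation. At [j = p] all have been divided and every one is back at its position. *)
have rot (c : nat -> T -> A) : I (\sum_(i < p) x ^+ i * fcomb B (c i)) ->
  forall j, (j <= p)%N -> exists c' : nat -> T -> A,
    (forall i t, (i < j)%N -> I (c i t - x * c' i t)) /\
    I (\sum_(i < p - j) x ^+ i * fcomb B (c (j + i)%N)
       + \sum_(i < j) x ^+ (p - j + i) * fcomb B (c' i)).
  move=> Ic; elim=> [|j IH] jp.
    by exists c; rewrite subn0 big_ord0 addr0; split.
  have [c' [cc' E]] := IH (ltnW jp).
  have pj : (p - j = (p - j.+1).+1)%N by rewrite subnSK.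
  rewrite pj big_ord_recl /= expr0 mul1r addn0 in E.
  set S1 := \sum_(i < p - j.+1) x ^+ i * fcomb B (c (j.+1 + i)%N).
  set S2 := \sum_(i < j) x ^+ (p - j.+1 + i) * fcomb B (c' i).
  have {}E : I (fcomb B (c j) + x * (S1 + S2)).
    move: E; congr I; rewrite -addrA mulrDr !mulr_sumr; congr (_ + (_ + _)).
      by apply: eq_bigr => i _; rewrite exprS mulrA addSnnS.
    by apply: eq_bigr => i _; rewrite addSn exprS mulrA.
  have cj t : iadd I x (c j t).
    apply: freeB; exists (- (S1 + S2)), (fcomb B (c j) + x * (S1 + S2)).
    by split=> //; ring.
  have [e He] : exists e : T -> A, forall t, I (c j t - x * e t).
    suff /choice[e He] : forall t, exists a, I (c j t - x * a) by exists e.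
    by move=> t; have [a [y [Iy ->]]] := cj t; exists a; rewrite mulrC addrC addKr.
  exists (fun i => if (i < j)%N then c' i else e); split.
    move=> i t; rewrite ltnS leq_eqVlt => /orP[/eqP ->|ij]; first by rewrite ltnn.
    by rewrite ij; apply: cc'.
  rewrite big_ord_recr /= ltnn.
  rewrite (eq_bigr (fun i : 'I_j => x ^+ (p - j.+1 + i) * fcomb B (c' i))); last first.
    by move=> i _; rewrite ltn_ord.
  (* Modulo [I] the coefficient [c j] is [x * e], and [fcomb] turns this factor into [x ^+ p]: the
     term joins the top end and one [x] cancels from the whole relation. *)
  rewrite -/S1 -/S2; apply: regx; rewrite addrA mulrDr.
  have -> : x * (x ^+ (p - j.+1 + j) * fcomb B e) = x ^+ p * fcomb B e.
    by rewrite mulrA -exprS -addSn subnSK // subnK // ltnW.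
  have -> : x * (S1 + S2) + x ^+ p * fcomb B e = fcomb B (c j) + x * (S1 + S2)
     - fcomb B (fun t => c j t - x * e t).
    rewrite -fcombB.
    have -> : fcomb B (fun t => x * e t) = x ^+ p * fcomb B e.
      rewrite -[RHS]addr0 -(fcomb0 B) -fcombP; congr fcomb.
      by apply: funext => t; rewrite addr0.
    ring.
  by apply: idealB => //; apply: fcomb_ideal.
pose rel c := I (fcomb step_family c).
move=> c Ic it.
pose K a := exists c, rel c /\ c it = a.
have iK : ideal K.
  split; first by exists (fun=> 0); rewrite /rel fcomb0; split=> //; apply: ideal0.
  move=> a _ _ [d [Id <-]] [e [Ie <-]]; exists (fun t => a * d t + e t).
  by rewrite /rel fcombP; split=> //; apply: iI.2.
have [b [d [Id db]]||u [nu Iu]] := @nakayama _ A^o n K I pn iI (nA iK) _ (c it).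
- pose d' (i : nat) (t : T) := if insub i is Some i' then d (i', t) else 0.
  have d'E (i : 'I_p) t : d' i t = d (i, t) by rewrite /d' valK.
  have [||e [de]] := rot d' _ p.
  + move: Id; rewrite /rel fcomb_step; congr I; apply: eq_bigr => i _.
    by congr (_ * fcomb B _); apply: funext => t.
  + exact: leqnn.
  rewrite subnn big_ord0 add0r => Ie.
  pose e' := fun it : 'I_p * T => e it.1 it.2.
  exists 1, (b - x * e' it); split; first exact: prime1.
    rewrite -db; case: (it) => i t; rewrite -d'E; exact: de.
  rewrite scale1r opprB addrCA subrr addr0; apply: (@mem_smul A A^o) => //.
  exists e'; split=> //; rewrite /rel fcomb_step.
  by move: Ie; congr I; apply: eq_bigr => i _; rewrite add0n.
- by exists c.
exact: local_saturated Iu.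
Qed.

End Step.

(** Starting from the residue field, each regular parameter multiplies the size of the basis by [p].
    At [s = [::]] this is Kunz's theorem that [^1 A] is free. *)
Lemma frob_basis_regular (l : nat) (b : 'I_l -> A) pre s :
    fin_gen (frob_mod charAp 1 A^o) -> fgen b n -> ffree b n ->
    (forall x, gen_ideal (catrev pre s) x <-> n x) ->
    chain_above (gen_ideal s) (size pre) n ->
  exists (T : finType) (B : T -> A), [/\ #|T| = (p ^ size pre * l)%N,
    fgen B (gen_ideal s) & ffree B (gen_ideal s)].
Proof.
move=> fgA genb freeb; elim: pre s => [|g pre IH] s Hn H.
  exists 'I_l, b; rewrite card_ord mul1n; split=> //.
    by move=> a; have [c /Hn] := genb a; exists c.
  by move=> c /Hn /freeb nc t; apply/Hn.
have [ps sg] := regular_prime nA nloc Hn H.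
have {}sg := sg g pre erefl.
rewrite /= in Hn.
have ng : n g by apply/Hn/mem_lspan; rewrite catrevE mem_cat mem_head orbT.
have [|T [B [cT genB freeB]]] := IH (g :: s) Hn.
  apply: (@chain_aboveW _ (iadd (gen_ideal s) g)); first by move=> x /gen_ideal_cons.
  exact: chain_above_drop.
have is_ := gen_ideal_ideal s.
exists ('I_p * T)%type, (step_family g B); split.
- by rewrite card_prod card_ord cT expnS mulnA.
- apply: fgen_step => // a; have [c /gen_ideal_cons] := genB a; by exists c.
- apply: ffree_step => //.
    by move=> y; case: ps => _ _ sM /sM[].
  by move=> c /gen_ideal_cons /freeB Hc t; apply/gen_ideal_cons.
Qed.

End FrobeniusBasis.

(* [f] is linear when the source is given the scalar action of [a ^+ q]. *)
Definition root_linear (A : comNzRingType) (q : nat) (f : A -> A) :=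
  forall a y z, f (a ^+ q * y + z) = a * f y + f z.

(** * Splitting and coordinates in iterated Frobenius pushforwards *)

Section FrobeniusCoordinates.
Variables (A : comNzRingType) (p : nat) (charAp : p \in [pchar A]).
Variables (n : A -> Prop) (nA : noeth A) (pn : prime_ideal n).
Hypothesis nloc : forall u, ~ n u -> exists v, v * u = 1.
Variables (T : finType) (B : T -> A) (k : T -> A -> A).
Hypothesis kB : forall y, y = \sum_t k t y ^+ p * B t.
Hypothesis klin : forall t, root_linear p (k t).
Hypothesis kd : forall t t', k t (B t') = (t == t')%:R.

Let p_pr : prime p := pcharf_prime charAp.

Lemma root_linear0 q (f : A -> A) : root_linear q f -> f (0 : A) = 0.
Proof.
move=> fl; have := fl 1 0 0; rewrite mulr0 addr0 mul1r => /eqP.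
by rewrite -subr_eq subrr eq_sym => /eqP.
Qed.

Lemma root_linearD q (f : A -> A) x y : root_linear q f -> f (x + y) = f x + f y.
Proof. by move=> fl; have := fl 1 x y; rewrite expr1n !mul1r. Qed.

Lemma root_linearZ q (f : A -> A) a x : root_linear q f -> f (a ^+ q * x) = a * f x.
Proof.
move=> fl; have := fl a x 0; rewrite !addr0 => ->.
by rewrite (root_linear0 fl) addr0.
Qed.

(** The [A]-linear map from [A] to [^e A] that sends 1 to [c] has the linear retraction [f], for
    some [e]. *)
Definition splits c := exists e (f : A -> A), root_linear (p ^ e) f /\ f c = 1.

Lemma splits_unit e (f : A -> A) c : root_linear (p ^ e) f -> ~ n (f c) -> splits c.
Proof.
move=> fl /nloc[v vu]; exists e, (fun y => v * f y); split=> //.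
by move=> a y z; rewrite fl; ring.
Qed.

(* The elements that do not split form an ideal [Z] contained in [n]; the coordinates
   of an element of [Z] are again in [Z], so that [Z = n Z]. *)
Lemma neq0_splits c : c != 0 -> splits c.
Proof.
move=> c0; apply: contrapT => nc.
pose Z a := ~ splits a.
have Zn a : Z a -> n a.
  move=> Za; apply: contrapT => na; apply: Za.
  apply: (@splits_unit 0 id) => // b y z; by rewrite expn0 expr1.
have iZ : ideal Z.
  split.
    move=> [e [f [fl]]]; rewrite (root_linear0 fl) => /eqP.
    by rewrite eq_sym oner_eq0.
  move=> a x y Zx Zy [e [f [fl]]]; rewrite (root_linearD _ _ fl) => E.
  have nxy : ~ (n (f (a * x)) /\ n (f y)).
    by move=> [nx ny]; apply: (prime1 pn); rewrite -E; apply: idealD => //; apply: prime_id.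
  apply: nxy; split; apply: contrapT => nf.
    apply: Zx; apply: (@splits_unit e (fun z => f (a * z))) => // b z z'.
    by rewrite -fl; congr f; ring.
  by apply: Zy; apply: splits_unit nf.
have Zk a t : Z a -> Z (k t a).
  move=> Za [e [f [fl E]]]; apply: Za; exists e.+1, (fun y => f (k t y)); split=> //.
  by move=> b y z; rewrite expnSr exprM klin fl.
have i0 : ideal (fun x : A => x = 0).
  by split=> // a x y -> ->; rewrite mulr0 addr0.
have [b Zb|u [nu]] := @nakayama _ A^o n Z (fun x => x = 0) pn i0 (nA iZ) _ c nc.
  exists 1, 0; split=> //; first exact: prime1.
  rewrite scale1r subr0 (kB b); apply: (@submod_sum A A^o); first exact: smul_submod.
  move=> t _.
  (* As [p >= 2], the power has one factor to count as an element of [n] and another to keep the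
     rest in [Z]. *)
  have -> : k t b ^+ p * B t = k t b * (B t * k t b ^+ p.-2 * k t b).
    by rewrite -{1}(subnK (prime_gt1 p_pr)) exprD subn2 expr2; ring.
  apply: (@mem_smul A A^o); first exact/Zn/Zk.
  by apply: idealM => //; apply: Zk.
move=> uc; have [v vu] := nloc nu.
by move/eqP: c0; apply; rewrite -[c]mul1r -vu -mulrA [u * c]uc mulr0.
Qed.

(** [i w] and [h w] are the injections and projections of a free summand [A ^ W] of [^e A]; the step
    to [e.+1] applies the coordinates [k t] once more. *)
Lemma frob_iterated_basis e : exists (W : finType) (i h : W -> A -> A),
  [/\ #|W| = (#|T| ^ e)%N,
      forall w, root_linear (p ^ e) (h w),
      forall w a b c, i w (a * b + c) = a ^+ (p ^ e) * i w b + i w c &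
      forall w w' a, h w (i w' a) = if w == w' then a else 0].
Proof.
elim: e => [|e [W [i [h [cW hl il hi]]]]].
  exists unit, (fun _ a => a), (fun _ a => a); split.
  - exact: card_unit.
  - by move=> _ a y z; rewrite expn0 expr1.
  - by move=> _ a b c; rewrite expn0 expr1.
  - by move=> [] [] a; rewrite eqxx.
exists (T * W)%type, (fun tw a => i tw.2 a ^+ p * B tw.1), (fun tw y => h tw.2 (k tw.1 y)).
split.
- by rewrite card_prod cW expnS.
- by move=> [t w] a y z /=; rewrite expnSr exprM klin hl.
- move=> [t w] a b c /=.
  by rewrite il (exprDp charAp) exprMn expnSr exprM; ring.
move=> [t w] [t' w'] a /=.
rewrite (root_linearZ _ _ (klin t)) kd xpair_eqE.
have [_|_] := eqVneq t t'; first by rewrite mulr1 hi.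
by rewrite mulr0 (root_linear0 (hl w)).
Qed.

End FrobeniusCoordinates.

(** * Chains of submodules and independence modulo a prime *)

Section Chains.
Variables (R : comNzRingType).

Lemma submod_asbool (V : lmodType R) (U : V -> Prop) :
  submod U -> submod_closed (fun x => `[< U x >]).
Proof.
move=> [U0 Ul]; split; first exact/asboolP.
by move=> a x y /asboolP Ux /asboolP Uy; apply/asboolP/Ul.
Qed.

Lemma submod_closedP (V : lmodType R) (U : {pred V}) :
  submod_closed U <-> submod (fun x => x \in U).
Proof. by split=> -[U0 Ul]; split=> // a x y; apply: Ul. Qed.

(* The index set [S] marks steps that are known to be strict. *)
Lemma submod_chain_monotone (V : lmodType R) m (U : nat -> V -> Prop) (S : pred nat) :
    (forall i, submod (U i)) -> (forall i x, (i < m)%N -> U i x -> U i.+1 x) ->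
    (forall i, (i < m)%N -> S i -> exists x, U i.+1 x /\ ~ U i x) ->
  submod_chain V (count S (iota 0 m)).
Proof.
move=> sU Umono Ustrict.
suff [W [[Wsub Wlt] _]] : exists W : nat -> {pred V},
    ((forall i, (i <= count S (iota 0 m))%N -> submod_closed (W i)) /\
    (forall i, (i < count S (iota 0 m))%N -> {subset W i <= W i.+1} /\
                            exists2 x, x \in W i.+1 & x \notin W i)) /\
    forall x, x \in W (count S (iota 0 m)) -> U m x by exists W.
elim: m Umono Ustrict => [|m IH] Umono Ustrict.
  exists (fun _ x => `[< U 0%N x >]); split; last by move=> x /asboolP.
  by split=> // i _; apply: submod_asbool.
have [||W [[Wsub Wlt] Wm]] := IH.
- by move=> i x im; apply: Umono; apply: ltnW.
- by move=> i im; apply: Ustrict; apply: ltnW.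
rewrite -addn1 iotaD count_cat /= !add0n addn0 addn1.
set k := count _ _ in Wsub Wlt Wm *.
case Sm: (S m); last first.
  by rewrite addn0; exists W; split=> // x /Wm; apply: Umono.
rewrite addn1; exists (fun i => if (i <= k)%N then W i else fun x => `[< U m.+1 x >]).
split; last by move=> x; rewrite ltnn => /asboolP.
split=> i ik; first by case: ifP => [/Wsub//|_]; apply: submod_asbool.
rewrite -ltnS ik; move: ik; rewrite ltnS leq_eqVlt => /orP[/eqP ->|ik]; last first.
  by rewrite ik; apply: Wlt.
rewrite ltnn; split; first by move=> x /Wm /Umono Ux; apply/asboolP/Ux.
have [x [Ux nUx]] := Ustrict m (ltnSn m) Sm; exists x; first exact/asboolP.
by apply/negP => /Wm.
Qed.

(** Filter each [U i] by the common kernels [K s] of the first [s] maps. A strict step of the chain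
    stays strict in at least one graded piece, and the [s]-th pieces embed in [T] by [f s]; the
    longest of the [t] resulting chains has length at least [m / t]. *)
Lemma submod_chain_joint_inj (V T : lmodType R) t (f : 'I_t -> {linear V -> T}) m :
    (forall x, (forall k, f k x = 0) -> x = 0) -> submod_chain V m ->
  exists k, submod_chain T k /\ (m <= t * k)%N.
Proof.
move=> finj [U [Usub Ult]].
pose K (s : nat) x := forall k : 'I_t, (k < s)%N -> f k x = 0.
pose W (s : 'I_t) i y := exists x, [/\ x \in U (minn i m), K s x & f s x = y].
have sU i : submod_closed (U (minn i m)) by apply/Usub/geq_minr.
have sW s i : submod (W s i).
  split; first by exists 0; split; [case: (sU i)|move=> k _; rewrite linear0|rewrite linear0].
  move=> a _ _ [x [Ux Kx <-]] [y [Uy Ky <-]]; exists (a *: x + y).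
  split; [exact: (sU i).2| |exact: linearP].
  by move=> k ks; rewrite linearP Kx // Ky // scaler0 addr0.
have Umono i x : (i < m)%N -> x \in U (minn i m) -> x \in U (minn i.+1 m).
  move=> im; rewrite (minn_idPl (ltnW im)) (minn_idPl im).
  by case: (Ult i im) => + _; apply.
pose S s i := `[< exists y, W s i.+1 y /\ ~ W s i y >].
have strict i : (i < m)%N -> exists s, S s i.
  move=> im; apply: contrapT => nos.
  have [_ [x Ux /negP]] := Ult i im; apply.
  have {}Ux : x \in U (minn i.+1 m) by rewrite (minn_idPl im).
  rewrite -(minn_idPl (ltnW im)).
  have sV := (submod_closedP (U (minn i m))).1 (sU i).
  have sV' := (submod_closedP (U (minn i.+1 m))).1 (sU i.+1).
  (* If no piece is strict, corrections from [U i] kill the values of the maps at [x] one after the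
     other, until joint injectivity puts [x] itself in [U i]. *)
  have H s : (s <= t)%N -> exists u, u \in U (minn i m) /\ K s (x - u).
    elim: s => [|s IH] st; first by exists 0; split=> //; case: (sU i).
    have [u [Uu Ku]] := IH (ltnW st); pose s' := Ordinal st.
    have [u' [Uu' Ku' E]] : W s' i (f s' (x - u)).
      apply: contrapT => nW; apply: nos; exists s'; apply/asboolP.
      exists (f s' (x - u)); split=> //; exists (x - u); split=> //.
      by apply: (submodB sV') => //; apply: Umono.
    exists (u + u'); split; first exact: (submodD sV).
    move=> k; rewrite ltnS leq_eqVlt opprD addrA linearB => /orP[/eqP ks|ks].
      have -> : k = s' by exact/val_inj/ks.
      by rewrite E subrr.
    by rewrite Ku // Ku' // subrr.
  have [u [Uu Ku]] := H t (leqnn t).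
  have /eqP : x - u = 0 by apply: finj => k; apply: Ku.
  by rewrite subr_eq0 => /eqP ->.
have chainS s : submod_chain T (count (S s) (iota 0 m)).
  apply: (@submod_chain_monotone T m (W s)) => //.
    by move=> i y im [x [Ux Kx <-]]; exists x; split=> //; apply: Umono.
  by move=> i _ /asboolP.
have le_m : (m <= \sum_(s < t) count (S s) (iota 0 m))%N.
  have -> : (\sum_(s < t) count (S s) (iota 0 m) = \sum_(i <- iota 0 m) \sum_(s < t) S s i)%N.
    rewrite exchange_big; apply: eq_bigr => s _ /=.
    by rewrite -sum1_count big_mkcond; apply: eq_bigr => i _; case: (S s i).
  rewrite -{1}(size_iota 0 m) -sum1_size !big_seq; apply: leq_sum => i.
  rewrite mem_iota add0n => /= im; have [s Ss] := strict i im.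
  by rewrite (bigD1 s) //= Ss.
have [s Ts sP] : exists2 k, submod_chain T k & forall s, (count (S s) (iota 0 m) <= k)%N.
  case: (posnP t) => [t0|t0].
    exists 0%N; last by move=> s; have := leq_ltn_trans (leq0n s) (ltn_ord s); rewrite t0.
    by exists (fun _ _ => true); split.
  have [s _ sP] := @arg_maxnP 'I_t (Ordinal t0) xpredT (fun s => count (S s) (iota 0 m)) isT.
  by exists (count (S s) (iota 0 m)) => // s'; apply: sP.
exists s; split=> //; apply: (leq_trans le_m).
apply: (@leq_trans (\sum_(i < t) s)); first by apply: leq_sum => i _; apply: sP.
by rewrite sum_nat_const card_ord.
Qed.

End Chains.

Section Independence.
Variables (R : comNzRingType) (P : R -> Prop) (V : lmodType R) (N : V -> Prop).
Hypotheses (pP : prime_ideal P) (sN : submod N).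
Hypotheses (PN : forall a y, P a -> N (a *: y)).

Definition indep (I : finType) (w : I -> V) :=
  forall b, N (\sum_i b i *: w i) -> forall i, P (b i).

(** A generator joins [w] unless some multiple of it, by an element outside [P], already lies in the
    span of [w] modulo [N]; [c] collects these multipliers. *)
Lemma max_indep s : (forall u y, ~ P u -> N (u *: y) -> N y) ->
  exists k (w : 'I_k -> V) c, [/\ ~ P c, indep w &
    forall y, lspan s y -> exists b, N (c *: y - \sum_i b i *: w i)].
Proof.
move=> satN; elim: s => [|g s [k [w [c [Pc wI wS]]]]] /=.
  exists 0%N, (fun=> 0), 1; split; [exact: prime1|by move=> b _ []|].
  move=> y ->; exists (fun=> 0); rewrite big_ord0 scaler0 subr0; exact: submod0.
have [[a [b [Pa Nab]]]|noab] := EM (exists a b, ~ P a /\ N (a *: g - \sum_i b i *: w i)).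
  exists k, w, (c * a); split=> //; first exact: primeM.
  move=> _ [e [y [_ /wS[d Nd] ->]]]; exists (fun i => c * e * b i + a * d i).
  have -> : \sum_i (c * e * b i + a * d i) *: w i =
     (c * e) *: (\sum_i b i *: w i) + a *: (\sum_i d i *: w i).
    rewrite !scaler_sumr -big_split; apply: eq_bigr => i _ /=.
    by rewrite scalerDl !scalerA.
  have -> : (c * a) *: (e *: g + y) = (c * e) *: (a *: g) + a *: (c *: y).
    by rewrite scalerDr !scalerA; congr (_ *: _ + _ *: _); ring.
  rewrite opprD addrACA -!scalerBr; apply: submodD => //; exact: submodZ.
exists k.+1, (fun i => oapp w g (unlift ord0 i)), c; split=> //.
  move=> b; rewrite big_ord_recl unlift_none /=.
  under eq_bigr do rewrite liftK /=.
  have Pb0 : N (b ord0 *: g + \sum_(i < k) b (lift ord0 i) *: w i) -> P (b ord0).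
    move=> Nb; apply: contrapT => Pb; apply: noab.
    exists (b ord0), (fun i => - b (lift ord0 i)); split=> //.
    by under eq_bigr do rewrite scaleNr; rewrite sumrN opprK.
  move=> Nb; have P0 := Pb0 Nb.
  have /wI Pb : N (\sum_(i < k) b (lift ord0 i) *: w i).
    have -> : \sum_(i < k) b (lift ord0 i) *: w i =
      (b ord0 *: g + \sum_(i < k) b (lift ord0 i) *: w i) - b ord0 *: g.
      by rewrite addrC addKr.
    by apply: submodB => //; apply: PN.
  by move=> i; case: (unliftP ord0 i) => [j ->|->].
move=> _ [e [y [_ /wS[d Nd] ->]]]; exists (fun i => oapp d (c * e) (unlift ord0 i)).
rewrite big_ord_recl unlift_none /=; under eq_bigr do rewrite !liftK /=.
by rewrite scalerDr scalerA opprD addrACA subrr add0r.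
Qed.

Hypothesis Ploc : forall u, ~ P u -> exists v, v * u = 1.

(** Steinitz exchange over the field [R / P]: if some [u i0] has a coefficient outside [P] on the
    first [v], subtracting multiples of [u i0] clears that coefficient from the others. *)
Lemma steinitz_ord k l (u : 'I_k -> V) (v : 'I_l -> V) :
    (forall i, exists a, N (u i - \sum_j a j *: v j)) -> indep u -> (k <= l)%N.
Proof.
elim: l k u v => [|l IH] [|k] u v // Huv uI.
  exfalso; apply: (prime1 pP).
  suff /uI/(_ ord0) : N (\sum_(i < k.+1) (i == ord0)%:R *: u i) by move=> /=; rewrite ?eqxx.
  rewrite (bigD1 ord0) //= scale1r big1 ?addr0 => [|i /negPf ->]; last by rewrite scale0r.
  by have [a] := Huv ord0; rewrite big_ord0 subr0.
have [a Ha] := choice Huv.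
have [[i0 Pa]|allP] := EM (exists i0, ~ P (a i0 ord0)); last first.
  apply: leq_trans (leqnSn l); apply: (IH _ u (fun j => v (lift ord0 j))) => // i.
  exists (fun j => a i (lift ord0 j)).
  rewrite -[u i](subrK (\sum_j a i j *: v j)) -addrA; apply: submodD => //.
  rewrite big_ord_recl addrK; apply: PN.
  by apply: contrapT => Pa; apply: allP; exists i.
have [c ca] := Ploc Pa.
rewrite ltnS; apply: (IH _ (fun i => u (lift i0 i) - (a (lift i0 i) ord0 * c) *: u i0)
  (fun j => v (lift ord0 j))).
  move=> i; set e := _ * c; set i' := lift i0 i.
  exists (fun j => a i' (lift ord0 j) - e * a i0 (lift ord0 j)).
  have -> : u i' - e *: u i0 - \sum_j (a i' (lift ord0 j) - e * a i0 (lift ord0 j)) *: v (lift ord0 j)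
     = (u i' - \sum_j a i' j *: v j) - e *: (u i0 - \sum_j a i0 j *: v j).
    under eq_bigr do rewrite scalerBl -scalerA.
    rewrite sumrB -scaler_sumr !big_ord_recl scalerBr scalerDr scalerA.
    rewrite /e -[_ * c * _]mulrA ca mulr1 -/e.
    move: (u i') (e *: u i0) (a i' ord0 *: v ord0) => x y z.
    move: (\sum_(j < l) a i' (lift ord0 j) *: _) (e *: \sum_j _) => s1 s2.
    rewrite !opprB [in RHS]addrACA [- _ - y]addrC [in RHS]addrACA; congr (_ + _).
    by rewrite opprD addrACA subrr add0r addrC.
  by apply: submodB => //; apply: submodZ.
move=> d Nd.
pose b i := oapp d (- \sum_i d i * (a (lift i0 i) ord0 * c)) (unlift i0 i).
have /uI Pb : N (\sum_i b i *: u i).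
  move: Nd; congr N; rewrite [RHS](bigD1_ord i0) //= /b unlift_none /=.
  rewrite [X in _ = _ + X](eq_bigr (fun i => d i *: u (lift i0 i))); last first.
    by move=> i _; rewrite liftK.
  under eq_bigr do rewrite scalerBr scalerA.
  by rewrite sumrB scaleNr scaler_suml addrC.
by move=> i; have := Pb (lift i0 i); rewrite /b liftK.
Qed.

Lemma steinitz (I J : finType) (u : I -> V) (v : J -> V) :
    (forall i, exists a, N (u i - \sum_j a j *: v j)) -> indep u -> (#|I| <= #|J|)%N.
Proof.
move=> Huv uI; apply: (@steinitz_ord _ _ (u \o enum_val) (v \o enum_val)) => [i|b].
  have [a Ha] := Huv (enum_val i); exists (a \o enum_val).
  move: Ha; congr (N (_ - _)).
  by rewrite (reindex (@enum_val J J)) //; apply/onW_bij/enum_val_bij.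
move=> Nb i; rewrite -[i]enum_valK.
apply: (uI (b \o enum_rank)); move: Nb; congr N.
rewrite [RHS](reindex (@enum_val I I)) /=; last exact/onW_bij/enum_val_bij.
by apply: eq_bigr => k _; rewrite enum_valK.
Qed.

End Independence.

(** * Local rings, finite extensions and minimal primes *)

Section LocalRings.
Variable R : comNzRingType.

Lemma noetherianP : noetherian R -> noeth R.
Proof.
move=> nR I iI; have [k [g Hg]] := nR _ (submod_asbool (ideal_submod iI)).
exists [seq g i | i <- enum 'I_k] => x; split=> [Ix|].
  by apply/lspan_ord/Hg/asboolP.
by move=> /lspan_ord /Hg /asboolP.
Qed.

Lemma idealr_closedP (I : {pred R}) :
  idealr_closed I <-> ideal (fun x => x \in I) /\ 1 \notin I.
Proof. by split=> [[I0 I1 Il]|[[I0 Il] I1]]; split=> //; split. Qed.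

Lemma idealr_asbool (I : R -> Prop) : ideal I -> ~ I 1 ->
  idealr_closed (fun x => `[< I x >]).
Proof.
move=> [I0 Il] I1; split; [exact/asboolP|exact/asboolP|].
by move=> a x y /asboolP Ix /asboolP Iy; apply/asboolP/Il.
Qed.

Lemma local_unit (m : {pred R}) u : local_ring m -> u \notin m ->
  exists v, v * u = 1.
Proof.
move=> [/noetherianP nR _ mmax] mu.
apply: contrapT => nu.
pose F (I : R -> Prop) := ideal I /\ ~ I 1.
have i0 : ideal (fun x : R => x = 0) by split=> // a x y -> ->; rewrite mulr0 addr0.
have [||I [[iI I1] uI Imax]] := @noeth_acc_ideal _ F (iadd (fun x => x = 0) u) nR.
- by move=> I [].
- split; first exact: iadd_ideal.
  by move=> [a [y [-> E]]]; apply: nu; exists a; rewrite -[_ * _]addr0 -E.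
have Im : I u by apply/uI/iadd_gen.
move/negP: mu; apply; rewrite -(mmax (fun x => `[< I x >])); first exact/asboolP.
split; first exact: idealr_asbool.
move=> J /idealr_closedP[iJ J1] IJ x; apply/idP/idP; last by move/IJ.
move=> Jx; apply/asboolP; apply: (Imax (fun x => x \in J)) => //.
  by split=> //; apply/negP.
by move=> y Iy; apply/IJ/asboolP.
Qed.

Lemma local_prime (m : {pred R}) : local_ring m -> prime_ideal (fun x => x \in m).
Proof.
move=> lR; have [_ [/idealr_closedP[im m1] _] _] := lR.
split=> //; first exact/negP.
move=> x y mxy; have [mx|/(local_unit lR)[v vx]] := boolP (x \in m); [by left|right].
rewrite -[y]mul1r -vx -mulrA; exact: (idealM v im mxy).
Qed.

Lemma ideal_local (m : {pred R}) (I : R -> Prop) x : local_ring m -> ideal I -> ~ I 1 -> I x -> x \in m.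
Proof.
move=> lR iI I1 Ix; apply: contrapT => /negP/(local_unit lR)[v vx].
by apply: I1; rewrite -vx; apply: idealM.
Qed.

Lemma prime_chain_above d : prime_chain R d -> exists P, chain_above (fun _ : R => False) d P.
Proof.
move=> [P [Pprime Plt]].
have pP i : (i <= d)%N -> prime_ideal (fun x => x \in P i).
  move=> /Pprime[/idealr_closedP[iP /negP P1] PM]; split=> // x y /PM /orP //.
exists (fun x => x \in P d).
suff H i : (i <= d)%N -> chain_above (fun _ : R => False) i (fun x => x \in P i) by apply: H.
elim: i => [|i IH] id; split=> //; try exact: pP.
exists (fun x => x \in P i); split; first exact/IH/ltnW.
have [sub [x xP nxP]] := Plt i id; split; first exact: sub.
by exists x; split=> //; apply/negP.
Qed.

Lemma chain_above_prime_chain (I : R -> Prop) d P : chain_above I d P -> prime_chain R d.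
Proof.
suff H : forall P, chain_above I d P -> exists Q : nat -> {pred R},
   [/\ forall i, (i <= d)%N -> idealr_closed (Q i) /\ prime_idealr_closed (Q i),
      forall i, (i < d)%N -> {subset Q i <= Q i.+1} /\
                            exists2 x, x \in Q i.+1 & x \notin Q i
     & forall x, x \in Q d -> P x].
  by move=> /H[Q [H1 H2 _]]; exists Q.
have pc (P' : R -> Prop) : prime_ideal P' ->
    idealr_closed (fun x => `[< P' x >]) /\ prime_idealr_closed (fun x => `[< P' x >]).
  move=> [iP' P'1 P'M]; split; first exact: (idealr_asbool iP' P'1).
  by move=> x y /asboolP /P'M[] P'x; apply/orP; [left|right]; apply/asboolP.
elim: d => [|d IH] {}P.
  move=> [/pc pP _]; exists (fun _ x => `[< P x >]); split=> //.
  by move=> x /asboolP.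
move=> [pP [Q [/IH[W [Wp Wlt WQ]] [QP [y [Py Qy]]]]]].
exists (fun i => if (i <= d)%N then W i else fun x => `[< P x >]); split.
- by move=> i _; case: ifP => [/Wp//|_]; apply: pc.
- move=> i; rewrite ltnS => id; rewrite id; move: (id).
  rewrite leq_eqVlt => /orP[/eqP ->|id']; last by rewrite id'; apply: Wlt.
  rewrite ltnn; split; first by move=> x /WQ /QP Px; apply/asboolP.
  by exists y; [apply/asboolP|apply/negP => /WQ].
by move=> x; rewrite ltnn => /asboolP.
Qed.

End LocalRings.

Section RegularLocal.
Variables (A : comNzRingType) (n : {pred A}) (d : nat).
Hypotheses (hA : regular_local_ring n) (hdA : krull_dim_is A d).

Lemma regular_local_gens : exists xs : seq A, [/\ size xs = d,
  forall x, gen_ideal xs x <-> x \in n & chain_above (gen_ideal [::]) d (fun x => x \in n)].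
Proof.
have [lA [d' [dim' [g Hg]]]] := hA.
have dd : d' = d.
  by apply/eqP; rewrite eqn_leq (hdA.2 _ dim'.1) (dim'.2 _ hdA.1).
move: dd dim' g Hg => -> dim' g Hg.
exists [seq g i | i <- enum 'I_d]; split.
- by rewrite size_map size_enum_ord.
- by move=> x; rewrite /gen_ideal lspan_ord; split=> [/Hg|/Hg].
have [P cP] := prime_chain_above hdA.1.
have pP := chain_above_prime cP.
have Pn x : P x -> x \in n by apply: ideal_local lA (prime_id pP) (prime1 pP).
(* The top of a prime chain of length [d] is [n], since otherwise [n] could be added to it. *)
have nP x : x \in n -> P x.
  move=> nx; apply: contrapT => Px.
  have : prime_chain A d.+1.
    apply: (@chain_above_prime_chain _ (fun _ : A => False) _ (fun x => x \in n)).
    split; first exact: local_prime.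
    by exists P; split=> //; split=> //; exists x.
  by move/hdA.2; rewrite ltnn.
have EP : P = fun x => x \in n.
  by apply: funext => x; apply: propext; split; [exact: Pn|exact: nP].
rewrite -EP; have [Q [pQ _ cQ]] := chain_above_bottom cP.
apply: chain_aboveW cQ => x /= ->; exact: (ideal0 (prime_id pQ)).
Qed.

End RegularLocal.

Section FiniteExtension.
Variables (R A : comNzRingType) (phi : {rmorphism R -> A}).
Hypothesis nR : noeth R.
Hypothesis finA : fin_gen (restrict_scalars phi A^o).

(** [R] is Noetherian, so the values at [a] of polynomials form a finitely generated module. If
    polynomials of size at most [N] give its generators, then [a ^+ N] is the value of a polynomial
    of smaller degree. *)
Lemma fin_gen_integral (a : A) : exists q : {poly R}, q \is monic /\ (map_poly phi q).[a] = 0.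
Proof.
have [k [g Hg]] := finA.
pose V := restrict_scalars phi A^o.
have scE (c : R) (y : V) : c *: y = phi c * (y : A) :> A by [].
pose U (y : V) := exists q : {poly R}, (y : A) = (map_poly phi q).[a].
have [||r Hr] := @noeth_fin_gen_sub R V [seq g i | i <- enum 'I_k] U nR.
- split; first by exists 0; rewrite rmorph0 horner0.
  move=> c x y [q Hq] [q' Hq']; exists (c *: q + q').
  by rewrite -mul_polyC rmorphD rmorphM /= map_polyC /= hornerD hornerCM -Hq -Hq'.
- by move=> x _; apply/lspan_ord/Hg.
have [N HN] : exists N, forall y, lspan r y ->
    exists q : {poly R}, (size q <= N)%N /\ (y : A) = (map_poly phi q).[a].
  have {Hr} : forall y, y \in r -> U y by move=> y /mem_lspan /Hr.
  elim: r => [|z r IH] Ur.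
    by exists 0%N => y ->; exists 0; rewrite size_poly0 rmorph0 horner0.
  have [|N HN] := IH; first by move=> y yr; apply: Ur; rewrite inE yr orbT.
  have [q Hq] := Ur z (mem_head _ _).
  exists (maxn (size q) N) => _ [c [y [_ /HN[q' [sq' Hq']] ->]]].
  exists (c *: q + q'); split.
    apply: leq_trans (size_polyD _ _) _; rewrite geq_max.
    rewrite (leq_trans (size_scale_leq _ _)) ?leq_maxl //=.
    exact: leq_trans (leq_maxr _ _).
  by rewrite -mul_polyC rmorphD rmorphM /= map_polyC /= hornerD hornerCM -Hq -Hq'.
have [|q [sq Hq]] := HN (a ^+ N : V).
  by apply/Hr; exists 'X^N; rewrite map_polyXn hornerXn.
exists ('X^N - q); split.
  rewrite monicE lead_coefDl ?lead_coefXn //.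
  by rewrite size_polyN size_polyXn ltnS.
by rewrite rmorphB /= map_polyXn hornerD hornerXn hornerN -Hq subrr.
Qed.

(** Suppose the contractions agree and take a monic equation of an [a] in [Q2] outside [Q1]. Its
    constant term is in [Q2], hence in [Q1]; as [a] is not, the equation can be divided by [a]
    modulo [Q1], down to 1 in [Q1]. *)
Lemma incomparable (Q1 Q2 : A -> Prop) : prime_ideal Q1 -> prime_ideal Q2 ->
  psub Q1 Q2 -> psub (Q1 \o phi) (Q2 \o phi).
Proof.
move=> p1 p2 [Q12 [a [Q2a Q1a]]]; split; first by move=> x /Q12.
apply: contrapT => no21.
have {}no21 x : Q2 (phi x) -> Q1 (phi x).
  by move=> Q2x; apply: contrapT => Q1x; apply: no21; exists x.
have [q [mq qa]] := fin_gen_integral a.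
suff : ~ Q1 (map_poly phi q).[a] by rewrite qa; apply; apply: ideal0 (prime_id p1).
elim/poly_ind: q mq {qa} => [|q c IH].
  by rewrite monicE lead_coef0 eq_sym oner_eq0.
have [->|q0 mq] := eqVneq q 0.
  rewrite mul0r add0r monicE lead_coefC => /eqP ->.
  by rewrite map_polyC /= hornerC rmorph1; apply: prime1.
have {}mq : q \is monic.
  move: mq; rewrite !monicE lead_coefDl ?lead_coefMX //.
  by rewrite size_mulX // size_polyC; case: (c == 0) => //=; rewrite ltnS size_poly_gt0.
rewrite rmorphD rmorphM /= map_polyX map_polyC /= hornerD hornerMX hornerC => Q1q.
have [i1 i2] := (prime_id p1, prime_id p2).
have Q1c : Q1 (phi c).
  apply: no21.
  have -> : phi c = (map_poly phi q).[a] * a + phi c - (map_poly phi q).[a] * a.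
    by rewrite addrC addKr.
  by apply: idealB => //; [exact: Q12|exact: idealM].
have : Q1 ((map_poly phi q).[a] * a).
  by rewrite -[_ * a](addrK (phi c)); apply: idealB.
by case: p1 => _ _ Q1M /Q1M[/IH|].
Qed.

Lemma preim_prime (Q : A -> Prop) : prime_ideal Q -> prime_ideal (Q \o phi).
Proof.
move=> [iQ Q1 QM]; split; rewrite /comp.
- by split=> [|a x y Qx Qy]; rewrite ?rmorph0 ?rmorphD ?rmorphM; [exact: ideal0|exact: iQ.2].
- by rewrite rmorph1.
by move=> x y; rewrite rmorphM; apply: QM.
Qed.

Lemma preim_chain_above (I : A -> Prop) m Q : chain_above I m Q -> chain_above (I \o phi) m (Q \o phi).
Proof.
elim: m Q => [|m IH] Q [pQ H]; split; try exact: preim_prime.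
  by move=> x /H.
have [Q' [cQ' Q'Q]] := H; exists (Q' \o phi); split; first exact: IH.
by apply: incomparable => //; apply: chain_above_prime cQ'.
Qed.

(** A chain of length [d] in [A] contracts to one of length [d] in [R] above the kernel; a strictly
    smaller prime [P] would prolong it beyond the dimension of [R]. *)
Lemma kernel_minimal d (P : R -> Prop) : krull_dim_is R d -> krull_dim_is A d -> prime_ideal P ->
  (forall x, P x -> phi x = 0) -> forall x, phi x = 0 -> P x.
Proof.
move=> dR dA pP Pker x x0; apply: contrapT => Px.
have [Q /chain_above_bottom [Q0 [p0 _ c0]]] := prime_chain_above dA.1.
have [P' [p' P'Q c']] := chain_above_bottom (preim_chain_above c0).
have : prime_chain R d.+1.
  apply: (chain_above_prime_chain (I := P)).
  apply: (chain_above_ext pP _ c'); split.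
    by move=> y /Pker y0; apply: P'Q; rewrite /= y0; apply: ideal0 (prime_id p0).
  exists x; split=> //; apply: P'Q; rewrite /= x0; exact: ideal0 (prime_id p0).
by move/dR.2; rewrite ltnn.
Qed.

End FiniteExtension.

Section MinimalPrime.
Variables (R : comNzRingType) (p : nat) (charRp : p \in [pchar R]) (P : R -> Prop).
Hypotheses (nR : noeth R) (pP : prime_ideal P).
Hypothesis Pmin : forall Q, prime_ideal Q -> (forall x, Q x -> P x) -> forall x, P x -> Q x.

(** Otherwise an ideal maximal among those that miss every [s * r ^+ k] with [s] outside [P] would
    be a prime inside [P] not containing [r]. *)
Lemma minimal_prime_nilp r : P r -> exists s k, ~ P s /\ s * r ^+ k = 0.
Proof.
move=> Pr; apply: contrapT => no.
pose F I := ideal I /\ forall s k, ~ P s -> ~ I (s * r ^+ k).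
have [||I [[iI FI] _ Imax]] := @noeth_acc_ideal _ F (fun x => x = 0) nR.
- by move=> I [].
- split; first by split=> // a x y -> ->; rewrite mulr0 addr0.
  by move=> s k Ps srk; apply: no; exists s, k.
have IP x : I x -> P x.
  by move=> Ix; apply: contrapT => Px; apply: (FI x 0%N Px); rewrite mulr1.
have notF x : ~ I x -> exists s k, ~ P s /\ iadd I x (s * r ^+ k).
  move=> Ix; apply: contrapT => nos; apply: Ix.
  apply: (Imax (iadd I x)) => [|y|]; [|exact: iadd_sub|exact: iadd_gen].
  split; first exact: iadd_ideal.
  by move=> s k Ps Is; apply: nos; exists s, k.
have I1 : ~ I 1 by rewrite -[1]mulr1 -(expr0 r); apply/FI/prime1.
have pI : prime_ideal I.
  split=> // x y Ixy; apply: contrapT => /not_orP[].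
  move=> /notF[s [k [Ps [a [u [Iu Ex]]]]]] /notF[t [l [Pt [b [v [Iv Ey]]]]]].
  apply: (FI (s * t) (k + l)%N); first exact: primeM.
  have -> : s * t * r ^+ (k + l) = (s * r ^+ k) * (t * r ^+ l) by rewrite exprD; ring.
  rewrite Ex Ey.
  have -> : (a * x + u) * (b * y + v) = (a * b) * (x * y) + (u * (b * y + v) + v * (a * x)) by ring.
  apply: iI.2 => //; apply: idealD => //; exact: idealMr.
apply: (FI 1 1%N); first exact: prime1.
by rewrite mul1r expr1; apply: (Pmin pI).
Qed.

(** The Frobenius is additive, so one exponent good for the finitely many generators of [P] is good
    for all of [P]. *)
Lemma minimal_prime_frob : exists s e, ~ P s /\ forall r, P r -> s * r ^+ (p ^ e) = 0.
Proof.
have p1 : (1 < p)%N := prime_gt1 (pcharf_prime charRp).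
have [t Ht] := nR (prime_id pP).
suff [s [e [Ps Hs]]] : exists s e, ~ P s /\ forall r, @lspan R R^o t r -> s * r ^+ (p ^ e) = 0.
  by exists s, e; split=> // r /Ht /Hs.
have {Ht} : forall r, r \in t -> P r by move=> r /(@mem_lspan R R^o) /Ht.
elim: t => [|g t IH] Pt.
  exists 1, 0%N; split; first exact: prime1.
  by move=> r ->; rewrite expr1 mulr0.
have [|s [e [Ps Hs]]] := IH; first by move=> r rt; apply: Pt; rewrite inE rt orbT.
have [s' [k [Ps' Hs']]] := minimal_prime_nilp (Pt g (mem_head _ _)).
exists (s * s'), (e + k)%N; split; first exact: primeM.
move=> _ [a [r [_ /Hs sr ->]]].
rewrite -[_ ^+ _]/(frob charRp (e + k) (a * g + r)) rmorphD rmorphM /frob.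
have kill u x i j : (i <= j)%N -> u * x ^+ i = 0 -> u * x ^+ j = 0.
  by move=> ij ux; rewrite -(subnKC ij) exprD mulrA ux mul0r.
have sg : s' * g ^+ (p ^ (e + k)) = 0.
  apply: kill Hs'; apply: leq_trans (ltnW (ltn_expl k p1)) _.
  by rewrite leq_exp2l // leq_addl.
have {}sr : s * r ^+ (p ^ (e + k)) = 0.
  by apply: kill sr; rewrite leq_exp2l // leq_addr.
rewrite mulrDr.
have -> : forall y z, s * s' * (y * z) = s * y * (s' * z) by move=> *; ring.
by rewrite sg mulr0 add0r [s * s']mulrC -mulrA sr mulr0.
Qed.

End MinimalPrime.

Definition mk_linear (R : comNzRingType) (V W : lmodType R) (f : V -> W) (fl : linear f) :
  {linear V -> W} := HB.pack f (GRing.isLinear.Build R V W _ f fl).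

Section FGen.
Variables (R : comNzRingType) (V : lmodType R).

Lemma fin_gen_family (J : finType) (g : J -> V) :
  (forall x, exists a, x = \sum_j a j *: g j) -> fin_gen V.
Proof.
move=> H; exists #|J|, (g \o enum_val) => x; split=> // _.
have [a ->] := H x; exists (a \o enum_val).
by rewrite (reindex (@enum_val J J)) //; apply/onW_bij/enum_val_bij.
Qed.

Lemma fin_gen_lspan : fin_gen V -> exists s : seq V, forall x, lspan s x.
Proof.
move=> [k [g Hg]]; exists [seq g i | i <- enum 'I_k] => x.
exact/lspan_ord/Hg.
Qed.

End FGen.

Lemma frob_scaleE (R : comNzRingType) p (charRp : p \in [pchar R]) e
  (a : R) (x : frob_mod charRp e R^o) : a *: x = a ^+ (p ^ e) * (x : R) :> R.
Proof. by []. Qed.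

Lemma exprBpe (R : comNzRingType) p (charRp : p \in [pchar R]) e (x y : R) :
  (x - y) ^+ (p ^ e) = x ^+ (p ^ e) - y ^+ (p ^ e).
Proof. by rewrite -!/(frob charRp e _) raddfB. Qed.

Lemma exprDpe (R : comNzRingType) p (charRp : p \in [pchar R]) e (x y : R) :
  (x + y) ^+ (p ^ e) = x ^+ (p ^ e) + y ^+ (p ^ e).
Proof. by rewrite -!/(frob charRp e _) raddfD. Qed.

Lemma exprsump (R : comNzRingType) p (charRp : p \in [pchar R]) (J : finType) (F : J -> R) :
  (\sum_j F j) ^+ p = \sum_j F j ^+ p.
Proof.
rewrite -(pFrobenius_autE charRp) rmorph_sum; by apply: eq_bigr => j _; apply: pFrobenius_autE.
Qed.

(** * F-finiteness and factorization through Frobenius pushforwards *)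

Section FFinite.
Variables (R : comNzRingType) (p : nat) (charRp : p \in [pchar R]).
Hypothesis hFfin : F_finite charRp.

Lemma F_finiteE : exists k (g : 'I_k -> R), forall x, exists a, x = \sum_i a i ^+ p * g i.
Proof.
have [k [g Hg]] := hFfin; exists k, g => x.
by have [a ->] := (Hg x).1 isT; exists a.
Qed.

Lemma frob_mod_fin_gen e : fin_gen (frob_mod charRp e R^o).
Proof.
have [k [g Hg]] := F_finiteE.
suff [J [h Hh]] : exists (J : finType) (h : J -> R), forall x, exists a,
    x = \sum_j a j ^+ (p ^ e) * h j.
  by apply: (@fin_gen_family _ (frob_mod charRp e R^o) J h).
elim: e => [|e [J [h Hh]]].
  exists unit, (fun=> 1) => x; exists (fun=> x).
  by rewrite (big_pred1 tt) => [|[]]; rewrite ?expr1 ?mulr1.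
exists ('I_k * J)%type, (fun ij => h ij.2 ^+ p * g ij.1) => x.
have [a ->] := Hg x; have [b Hb] := choice (fun i => Hh (a i)).
exists (fun ij => b ij.1 ij.2).
rewrite -(pair_bigA _ (fun i j => b i j ^+ (p ^ e.+1) * (h j ^+ p * g i))) /=.
apply: eq_bigr => i _; rewrite {1}Hb (exprsump charRp) mulr_suml.
by apply: eq_bigr => j _; rewrite exprMn expnSr exprM mulrA.
Qed.

Variables (A : comNzRingType) (phi : {rmorphism R -> A}).
Hypothesis finA : fin_gen (restrict_scalars phi A^o).

Lemma restrict_fin_genE :
  exists k (g : 'I_k -> A), forall x, exists a, x = \sum_i phi (a i) * g i.
Proof.
have [k [g Hg]] := finA; exists k, g => x.
by have [a ->] := (Hg x).1 isT; exists a.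
Qed.

Lemma finite_F_finite (charAp : p \in [pchar A]) : fin_gen (frob_mod charAp 1 A^o).
Proof.
have [k [g Hg]] := F_finiteE; have [l [h Hh]] := restrict_fin_genE.
apply: (@fin_gen_family _ (frob_mod charAp 1 A^o) ('I_l * 'I_k)%type
  (fun ij => phi (g ij.2) * h ij.1)) => x.
have [a Ha] := Hh x; have [b Hb] := choice (fun i => Hg (a i)).
exists (fun ij => phi (b ij.1 ij.2)).
rewrite [LHS]Ha -(pair_bigA _ (fun i j => (phi (b i j) : A) *: (phi (g j) * h i : frob_mod charAp 1 A^o))) /=.
apply: eq_bigr => i _; rewrite {1}Hb rmorph_sum mulr_suml.
by apply: eq_bigr => j _; rewrite rmorphM rmorphXn -mulrA.
Qed.

Hypothesis domA : prime_ideal (fun x : A => x = 0).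

(** The coordinates [lam] of [c1 *: a] are linear in [a] only modulo the kernel, but [lam ^+ q * s0]
    is exactly linear, as [s0] kills the [q]-th powers of the kernel. On the way back the coordinate
    [mu] is read through [phi], which removes its ambiguity. *)
Lemma frobenius_factorization s0 e : phi s0 != 0 ->
    (forall r, phi r = 0 -> s0 * r ^+ (p ^ e) = 0) ->
  exists t (f : 'I_t -> A -> R) (g : 'I_t -> R -> A) c, [/\ c != 0,
    forall k r a b, f k (phi r * a + b) = r ^+ (p ^ e) * f k a + f k b,
    forall k r y z, g k (r ^+ (p ^ e) * y + z) = phi r * g k y + g k z &
    forall a, \sum_k g k (f k a) = c * a].
Proof.
move=> s0P s0N; set q := (p ^ e)%N in s0N *.
pose P r := phi r = 0.
have pP : prime_ideal P := preim_prime phi domA.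
pose V1 := restrict_scalars phi A^o.
have sN1 : submod (fun y : V1 => y = 0) by split=> // a x y -> ->; rewrite scaler0 addr0.
have PN1 a (y : V1) : P a -> a *: y = 0.
  by move=> Pa; rewrite [LHS](_ : _ = phi a * (y : A)) // Pa mul0r.
have sat1 a (y : V1) : ~ P a -> a *: y = 0 -> y = 0.
  by move=> Pa ay; case: domA => _ _ /(_ (phi a) y ay)[].
have [s Hs] := fin_gen_lspan finA.
have [t [w [c1 [Pc1 wI /= wS]]]] := max_indep pP sN1 PN1 s sat1.
have [lam Hlam] := choice (fun y => wS y (Hs y)).
have lamP r a b i : P (lam (phi r * a + b) i - (r * lam a i + lam b i)).
  apply: (wI (fun i => lam (phi r * a + b) i - (r * lam a i + lam b i))).
  under eq_bigr do rewrite scalerBl scalerDl -scalerA.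
  rewrite sumrB big_split -scaler_sumr /=.
  rewrite -(subr0_eq (Hlam a)) -(subr0_eq (Hlam b)) -(subr0_eq (Hlam _)).
  rewrite -[phi r * a + b]/(r *: (a : V1) + (b : V1)) scalerDr !scalerA.
  by rewrite [c1 * r]mulrC subrr.
pose V2 := frob_mod charRp e R^o.
(* The kernel of localizing [^e R] at [P]; the element [s0] shows that it contains [P] times
   [^e R]. *)
pose N2 (y : V2) := exists u, ~ P u /\ u * (y : R) = 0.
have sN2 : submod N2.
  split; first by exists 1; rewrite mulr0; split=> //; apply: prime1.
  move=> a x y [u [Pu ux]] [v [Pv vy]]; exists (u * v); split; first exact: primeM.
  have -> : (a *: x + y : R) = a ^+ q * (x : R) + (y : R) by [].
  have -> : forall z x y, u * v * (z * x + y) = z * v * (u * x) + u * (v * y) by move=> *; ring.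
  by rewrite ux vy !mulr0 addr0.
have PN2 a (y : V2) : P a -> N2 (a *: y).
  move=> Pa; exists s0; split; first exact/eqP.
  by rewrite frob_scaleE mulrA s0N // mul0r.
have sat2 a (y : V2) : ~ P a -> N2 (a *: y) -> N2 y.
  move=> Pa [u [Pu uay]]; exists (u * a ^+ q); split.
    by apply: primeM => // /(primeX pP).
  by rewrite -mulrA.
have [s' Hs'] := fin_gen_lspan (frob_mod_fin_gen e).
have [t2 [w2 [c2 [Pc2 w2I w2S]]]] := max_indep pP sN2 PN2 s' sat2.
have [mu Hmu] := choice (fun y => w2S y (Hs' y)).
have muP r y z i : P (mu (r ^+ q * y + z) i - (r * mu y i + mu z i)).
  apply: (w2I (fun i => mu (r ^+ q * y + z) i - (r * mu y i + mu z i))).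
  under eq_bigr do rewrite scalerBl scalerDl -scalerA.
  rewrite sumrB big_split -scaler_sumr /=.
  move: (Hmu y) (Hmu z) (Hmu (r ^+ q * y + z)).
  set S1 := \sum_i _; set S2 := \sum_i _; set S3 := \sum_i _ => H1 H2 H3.
  have -> : S3 - (r *: S1 + S2) = r *: (c2 *: (y : V2) - S1) + (c2 *: (z : V2) - S2)
     - (c2 *: (r ^+ q * y + z : V2) - S3).
    rewrite -[r ^+ q * y + z]/(r *: (y : V2) + (z : V2)) scalerBr [c2 *: (_ + _)]scalerDr !scalerA.
    rewrite [c2 * r]mulrC; move: (_ *: (y : V2)) (c2 *: (z : V2)) (r *: S1) => a b c.
    by rewrite [in RHS]addrACA -!opprD opprB [RHS]addrC addrA subrK.
  by apply: (submodB sN2) => //; apply: sN2.2.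
(* With all coordinates in [P], the element [c2 *: s0] would be killed by something outside [P],
   although [c2] and [s0] are outside this prime. *)
have [i0 Pi0] : exists i0, ~ P (mu s0 i0).
  apply: contrapT => noi.
  have [u [Pu]] : N2 (c2 *: (s0 : V2)).
    rewrite -[_ *: _](subrK (\sum_i mu s0 i *: w2 i)); apply: submodD => //.
    apply: submod_sum => // i _; apply: PN2; apply: contrapT => Pi.
    by apply: noi; exists i.
  rewrite frob_scaleE => E.
  have : ~ P (u * (c2 ^+ q * s0)).
    do 2![apply: primeM => //]; [by move/(primeX pP)|exact/eqP].
  by apply; rewrite E /P rmorph0.
exists t, (fun i a => lam a i ^+ q * s0), (fun i y => w i * phi (mu y i0)),
  (phi (mu s0 i0) * phi c1); split.
- apply/eqP; apply: (primeM domA); [exact: Pi0|exact: Pc1].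
- move=> i r a b; have /s0N := lamP r a b i.
  rewrite /q (exprBpe charRp) (exprDpe charRp) exprMn => E.
  by apply/eqP; rewrite -subr_eq0 -E; apply/eqP; ring.
- move=> i r y z; have /eqP := muP r y z i0.
  rewrite rmorphB rmorphD rmorphM subr_eq0 => /eqP ->; ring.
- move=> a.
  have muE i : phi (mu (lam a i ^+ q * s0) i0) = phi (lam a i) * phi (mu s0 i0).
    have mu0 : phi (mu 0 i0) = 0.
      have /eqP := muP 0 0 0 i0; rewrite mulr0 addr0 mul0r add0r subrr rmorph0.
      move=> _; have /eqP := muP 1 0 0 i0.
      rewrite expr1n mul1r addr0 mul1r rmorphB rmorphD opprD addrA subrr sub0r.
      by rewrite oppr_eq0 => /eqP.
    have /eqP := muP (lam a i) s0 0 i0.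
    by rewrite addr0 rmorphB rmorphD rmorphM mu0 addr0 subr_eq0 => /eqP.
  under eq_bigr do rewrite muE mulrA.
  rewrite -mulr_suml mulrC -mulrA; congr (_ * _).
  have <- : c1 *: (a : V1) = phi c1 * a by [].
  rewrite (subr0_eq (Hlam a)); apply: eq_bigr => i _; exact: mulrC.
Qed.

End FFinite.

(** * Direct summands of Frobenius pushforwards *)

Section ResidueBasis.
Variables (R : comNzRingType) (m : {pred R}) (lR : local_ring m).
Let P x := x \in m.
Let pP : prime_ideal P := local_prime lR.

Lemma local_unitN u : ~ P u -> exists v, v * u = 1.
Proof. by move=> /negP; apply: local_unit. Qed.

(** In a local ring the multiplier [c] of [max_indep] is a unit, so the independent elements
    represent a basis of [V / N] over the residue field. *)
Lemma minimal_generators (V : lmodType R) (N : V -> Prop) : fin_gen V -> submod N ->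
    (forall a y, P a -> N (a *: y)) ->
  exists k (w : 'I_k -> V), indep P N w /\
    forall y, exists b, N (y - \sum_i b i *: w i).
Proof.
move=> /fin_gen_lspan[s Hs] sN PN.
have satN u y : ~ P u -> N (u *: y) -> N y.
  move=> /local_unitN[v vu] Nuy.
  by rewrite -[y]scale1r -vu -scalerA; apply: submodZ.
have [k [w [c [Pc wI wS]]]] := max_indep pP sN PN s satN.
exists k, w; split=> // y; have [b Nb] := wS y (Hs y).
have [v vc] := local_unitN Pc; exists (fun i => v * b i).
under eq_bigr do rewrite -scalerA.
rewrite -scaler_sumr -[y in y - _]scale1r -vc -scalerA -scalerBr.
exact: submodZ.
Qed.

End ResidueBasis.

Section ResidueDegree.
Variables (R : comNzRingType) (m : idealr R) (lR : local_ring m).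
Variables (p : nat) (charRp : p \in [pchar R]).
Variables (A : comNzRingType) (n : {pred A}) (lA : local_ring n).
Variables (phi : {rmorphism R -> A}) (charAp : p \in [pchar A]).
Hypothesis phin : forall x, x \in m -> phi x \in n.
Hypothesis finA : fin_gen (restrict_scalars phi A^o).
Let P x := x \in m.
Let Q x := x \in n.
Let pP : prime_ideal P := local_prime lR.
Let pQ : prime_ideal Q := local_prime lA.
Let iQ : ideal Q := prime_id pQ.

Lemma pbasis_indep k (b : 'I_k -> {ideal_quot m}) : pbasis p b ->
  exists beta : 'I_k -> R, forall r, P (\sum_i r i ^+ p * beta i) -> forall i, P (r i).
Proof.
have p_gt0 : (0 < p)%N := prime_gt0 (pcharf_prime charRp).
pose pi (x : R) : {ideal_quot m} := \pi_{ideal_quot m}%qT x.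
have piE x y : pi x = pi y <-> P (x - y).
  by rewrite /P -[x - y \in m]/(x - y \in (m : {pred R})) Quotient.idealrBE; split=> /eqP.
move=> bP; exists (fun i => repr (b i)) => r Pr i.
have piX (x y : R) : pi (x ^+ p * y) = pi x ^+ p * pi y.
  by rewrite /pi !rmorphM rmorphXn.
have pi0 : pi 0 = 0 by rewrite /pi rmorph0.
have := bP 0; case=> a [a0 auniq].
have E : 0 = \sum_i (finfun (fun i => pi (r i))) i ^+ p * b i.
  under eq_bigr do rewrite ffunE -[b _]reprK -piX.
  have /piE : P (\sum_i r i ^+ p * repr (b i) - 0) by rewrite subr0.
  by rewrite pi0 /pi rmorph_sum => /esym.
have E0 : 0 = \sum_i (finfun (fun i => 0 : {ideal_quot m})) i ^+ p * b i.
  by rewrite big1 // => j _; rewrite ffunE expr0n gtn_eqF // mul0r.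
have /piE : pi (r i) = pi 0.
  have := congr1 (fun f : {ffun 'I_k -> {ideal_quot m}} => f i) (etrans (esym (auniq _ E)) (auniq _ E0)).
  by rewrite !ffunE pi0.
by rewrite subr0.
Qed.

(** Let $K$ and $L$ be the residue fields of [R] and [A], and $t = [L:K]$. The $kt$ products of
    [beta] and [w] are independent over $K^p$ in $L$, while the $lt$ products of [w ^+ p] and [B]
    generate $L$ over $K^p$; Steinitz gives $kt \le lt$. *)
Lemma pbasis_leq k (b : 'I_k -> {ideal_quot m}) l (B : 'I_l -> A) :
  pbasis p b -> fgen p B Q -> (k <= l)%N.
Proof.
move=> /pbasis_indep[beta betaI] genB.
have p_gt0 : (0 < p)%N := prime_gt0 (pcharf_prime charRp).
pose V1 := restrict_scalars phi A^o.
have PV1 a (y : V1) : P a -> Q (a *: y : A) by move=> /phin Qa; exact: (idealMr y iQ Qa).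
have sV1 : @submod R V1 Q by split; [exact: (ideal0 iQ)|move=> a x y; exact: (iQ.2 (phi a) x y)].
have [t [w [wI wS]]] := minimal_generators lR finA sV1 PV1.
have t0 : (0 < t)%N.
  case: t w wI wS => // w _ /(_ (1 : A))[c]; rewrite big_ord0 subr0.
  by move/(prime1 pQ).
suff : (#|{: 'I_k * 'I_t}| <= #|{: 'I_l * 'I_t}|)%N.
  by rewrite !card_prod !card_ord leq_pmul2r.
pose V := frob_mod charRp 1 V1.
have scE (a : R) (y : V) : a *: y = phi (a ^+ p) * (y : A) :> A by [].
apply: (@steinitz _ P V Q pP _ _ (local_unitN lR) _ _
  (fun ik => phi (beta ik.1) * w ik.2) (fun jk => w jk.2 ^+ p * B jk.1)).
- split; first exact: (ideal0 iQ).
  by move=> a x y; exact: (iQ.2 (phi (a ^+ p)) x y).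
- move=> a y Pa; rewrite scE; apply: (idealMr _ iQ); apply: phin.
  by rewrite -(prednK p_gt0) exprS; apply: (idealMr _ (prime_id pP) Pa).
- move=> ik; set x : A := phi _ * _.
  have [c Qc] := genB x; have [r Hr] := choice (fun j => wS (c j)).
  exists (fun jk => r jk.1 jk.2).
  rewrite -(pair_bigA _ (fun j k => r j k *: (w k ^+ p * B j : V))) /=.
  rewrite -[x](subrK (fcomb p B c)) -addrA; apply: (idealD iQ) => //.
  rewrite /fcomb -sumrB; apply: (ideal_sum _ iQ) => j _.
  have -> : \sum_k r j k *: (w k ^+ p * B j : V) = (\sum_k phi (r j k) * w k) ^+ p * B j.
    rewrite (exprsump charAp) mulr_suml; apply: eq_bigr => i _.
    by rewrite scE rmorphXn mulrA exprMn.
  rewrite -[_ - _]mulrBl -(exprBp charAp); apply: (idealMr _ iQ).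
  rewrite -(prednK p_gt0) exprS; apply: (idealMr _ iQ); exact: Hr.
- move=> r Qr [i k'].
  have : Q (\sum_k phi (\sum_i r (i, k) ^+ p * beta i) * w k).
    move: Qr; congr Q.
    transitivity (\sum_i \sum_k r (i, k) *: (phi (beta i) * w k : V)).
      by rewrite pair_bigA; apply: eq_bigr => -[].
    rewrite exchange_big; apply: eq_bigr => j _.
    rewrite rmorph_sum mulr_suml; apply: eq_bigr => i' _.
    by rewrite scE rmorphM mulrA.
  by move=> /(wI (fun k => \sum_i r (i, k) ^+ p * beta i))/(_ k') /betaI.
Qed.

End ResidueDegree.

Section Summands.
Variables (R : comNzRingType) (m : idealr R) (hR : local_ring m).
Variables (p : nat) (charRp : p \in [pchar R]) (hFfin : F_finite charRp).
Variables (d : nat) (hd : krull_dim_is R d).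
Variables (A : comNzRingType) (n : idealr A) (hA : regular_local_ring n).
Variables (phi : {rmorphism R -> A}) (hphi : forall x : R, x \in m -> phi x \in n).
Hypotheses (hfin : fin_gen (restrict_scalars phi A^o)) (hdA : krull_dim_is A d).

(** The matrices [f] and [g] split [A ^ W] off [t] copies of the pushforward of [R]. The bound on
    [l] later compares [#|W|] with the normalizing power of [p]. *)
Theorem regular_frobenius_summands : exists l E t, [/\ (0 < l)%N,
    forall k (b : 'I_k -> {ideal_quot m}), pbasis p b -> (k <= l)%N &
    forall e, exists (W : finType)
      (f : W -> 'I_t -> {linear restrict_scalars phi A^o -> frob_mod charRp (e + E) R^o})
      (g : W -> 'I_t -> {linear frob_mod charRp (e + E) R^o -> restrict_scalars phi A^o}),
      #|W| = ((p ^ d * l) ^ e)%N /\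
      forall w w' a, \sum_k g w k (f w' k a) = if w == w' then a else 0].
Proof.
have charAp : p \in [pchar A] := rmorph_pchar phi charRp.
have p_gt0 : (0 < p)%N := prime_gt0 (pcharf_prime charRp).
have [lA _] := hA; have [nA' _ _] := lA; have nA := noetherianP nA'.
have [nR' _ _] := hR; have nR := noetherianP nR'.
pose P x := x \in n.
have pP : prime_ideal P := local_prime lA.
have nloc : forall u, ~ P u -> exists v, v * u = 1 := local_unitN lA.
have FA : fin_gen (frob_mod charAp 1 A^o) := finite_F_finite hFfin hfin charAp.
have sP1 : @submod A (frob_mod charAp 1 A^o) P.
  split; first exact: (ideal0 (prime_id pP)).
  by move=> a x y; exact: ((prime_id pP).2 (a ^+ p) x y).
have PP1 a (y : frob_mod charAp 1 A^o) : P a -> P (a *: y).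
  move=> Pa; rewrite frob_scaleE expn1 -(prednK p_gt0) exprS -mulrA.
  exact: (idealMr _ (prime_id pP)).
have [l [b [bI bS]]] := minimal_generators lA FA sP1 PP1.
have l0 : (0 < l)%N.
  case: l b bI bS => // b _ /(_ (1 : A))[c]; rewrite big_ord0 subr0.
  by move/(prime1 pP).
have [xs [sxs xsn cxs]] := regular_local_gens hA hdA.
have Hxs x : gen_ideal (catrev (rev xs) [::]) x <-> P x.
  by rewrite catrevE cats0 revK.
have cn : chain_above (gen_ideal [::]) (size (rev xs)) P by rewrite size_rev sxs.
have [p0 _] := regular_prime nA nloc Hxs cn.
have domA : prime_ideal (fun x : A => x = 0) by exact: p0.
have [T [B [cT genB freeB]]] := frob_basis_regular nA pP nloc FA bS bI Hxs cn.
have [k0 Hk0] := choice genB.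
pose k t y := k0 y t.
have kB y : y = \sum_t k t y ^+ p * B t by apply: subr0_eq; apply: Hk0.
have kuniq (c c' : T -> A) : \sum_t c t ^+ p * B t = \sum_t c' t ^+ p * B t -> c =1 c'.
  move=> E t; apply: subr0_eq; apply: (freeB (fun t => c t - c' t)).
  by rewrite -(fcombB charAp) /fcomb E; apply: subrr.
have klin t : root_linear p (k t).
  move=> a y z; move: t; apply: (kuniq (k^~ _) (fun t => a * k t y + k t z)).
  rewrite -kB; rewrite -[RHS]/(fcomb p B (fun t => a * k t y + k t z)).
  by rewrite (fcombP charAp) /fcomb -!kB.
have kd t t' : k t (B t') = (t == t')%:R.
  move: t; apply: (kuniq (k^~ _) (fun t => (t == t')%:R)).
  rewrite -kB (bigD1 t') //= eqxx expr1n mul1r big1 ?addr0 // => t /negPf ->.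
  by rewrite expr0n gtn_eqF // mul0r.
pose K r := phi r = 0.
have pK : prime_ideal K := preim_prime phi domA.
have [s0 [e' [Ks0 Ks]]] : exists s e, ~ K s /\ forall r, K r -> s * r ^+ (p ^ e) = 0.
  apply: minimal_prime_frob => // Q pQ QK.
  exact: (kernel_minimal nR hfin hd hdA).
have s00 : phi s0 != 0 by apply/eqP.
have [t [f [g [c [c0 fl gl fg]]]]] := frobenius_factorization hFfin hfin domA s00 Ks.
have [e0 [pi [pil pic]]] := neq0_splits charAp nA pP nloc kB klin c0.
exists l, (e0 + e')%N, t; split=> //.
  by move=> N bN HbN; apply: (pbasis_leq hR charRp lA charAp hphi hfin HbN bS).
move=> e; have [W [i [h [cW hl il hi]]]] := frob_iterated_basis charAp klin kd e.
have powE (r : R) : r ^+ (p ^ (e + (e0 + e'))) = (r ^+ (p ^ (e + e0))) ^+ (p ^ e').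
  by rewrite -exprM -expnD addnA.
(* The path is [A -> ^e A -> ^(e + e0) A -> ^(e + e0 + e') R], by [i w], the Frobenius and [f u];
   then [g u], [pi] and [h w] lead back. Summing over [u] multiplies by [c] in the middle, and [pi]
   sends [c] to 1. *)
have fP w u : linear (fun a : restrict_scalars phi A^o =>
    f u (i w a ^+ (p ^ e0)) : frob_mod charRp (e + (e0 + e')) R^o).
  move=> r a a' /=.
  rewrite [r *: a]/(phi r * (a : A)) il (exprDpe charAp) exprMn -exprM -expnD -rmorphXn fl.
  by rewrite -powE.
have gP w u : linear (fun y : frob_mod charRp (e + (e0 + e')) R^o =>
    h w (pi (g u y)) : restrict_scalars phi A^o).
  move=> r a a' /=.
  rewrite [r *: a](_ : _ = r ^+ (p ^ (e + (e0 + e'))) * (a : R)) // powE gl.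
  by rewrite rmorphXn expnD exprM pil hl.
exists W, (fun w u => mk_linear (fP w u)), (fun w u => mk_linear (gP w u)); split.
  by rewrite cW cT size_rev sxs.
move=> w w' a /=.
have pi0 : pi 0 = 0 := root_linear0 pil.
have h0 : h w 0 = 0 := root_linear0 (hl w).
have sumE (F : 'I_t -> A) : \sum_u (h w (pi (F u)) : restrict_scalars phi A^o) = h w (pi (\sum_u F u)).
  symmetry; apply: (big_morph (fun y => h w (pi y))); last by rewrite pi0 h0.
  by move=> x y; rewrite (root_linearD _ _ pil) (root_linearD _ _ (hl w)).
by rewrite sumE fg mulrC (root_linearZ _ _ pil) pic mulr1 hi.
Qed.

End Summands.

(** * Tensor products with free modules *)

Section FreeModules.
Variables (R : comNzRingType) (X : choiceType).

Lemma free_mod_expand (u : free_mod R X) : exists A : {fset X},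
  forall A' : {fset X}, (A `<=` A')%fset -> u = \sum_(x <- A') (val u x : R) *: free_basis R x.
Proof.
have finu : finite_set [set x | val u x != 0] by apply/asboolP/(valP u).
exists (fset_set [set x | val u x != 0]) => A' AA'.
apply: val_inj; rewrite raddf_sum; apply: funext => y.
rewrite fct_sumE.
rewrite (eq_bigr (fun x => (val u x : R) * (y == x)%:R)) //.
have [yA|yA] := boolP (y \in A').
  rewrite (big_fsetD1 y) //= eqxx mulr1 big_seq big1 ?addr0 // => x.
  by rewrite !inE => /andP[xy _]; rewrite eq_sym (negPf xy) mulr0.
rewrite big_seq big1 => [|x xA].
  apply: contrapT => /eqP uy; move/negP: yA; apply; apply: (fsubsetP AA').
  by rewrite in_fset_set // inE.
by have [yx|_] := eqVneq y x; [rewrite yx xA in yA|rewrite mulr0].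
Qed.

Lemma free_mod_ext (W : lmodType R) (f g : {linear free_mod R X -> W}) :
  (forall x, f (free_basis R x) = g (free_basis R x)) -> f =1 g.
Proof.
move=> fg u; have [A /(_ A (fsubset_refl A)) ->] := free_mod_expand u.
by rewrite !linear_sum; apply: eq_bigr => x _; rewrite !linearZ /= fg.
Qed.

Lemma free_projective : projective (free_mod R X).
Proof.
move=> V W g f gsurj.
have [h Hh] := choice (fun x => gsurj (f (free_basis R x))).
exists (free_lift h : {linear _ -> _}) => u.
suff : (g \o free_lift h : {linear _ -> _}) =1 f by apply.
by apply: free_mod_ext => x /=; rewrite free_lift_basis.
Qed.

End FreeModules.

Section TensorTheory.
Variable R : comNzRingType.
Implicit Types M N W : lmodType R.

Lemma tensor_ind M N (Q : tensor M N -> Prop) : submod Q -> (forall m n, Q (tens m n)) ->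
  forall z, Q z.
Proof.
move=> sQ Qt z; rewrite -[z]quot_reprK.
have [A /(_ A (fsubset_refl A)) ->] := free_mod_expand (quot_repr z).
rewrite linear_sum; apply: submod_sum => // -[m n] _.
by rewrite linearZ; apply: submodZ => //; apply: Qt.
Qed.

Lemma tensor_ext M N W (f g : {linear tensor M N -> W}) :
  (forall m n, f (tens m n) = g (tens m n)) -> f =1 g.
Proof.
move=> fg; apply: (tensor_ind (Q := fun z => f z = g z)) => //.
split; first by rewrite !linear0.
by move=> a x y fx fy; rewrite !linearP fx fy.
Qed.

Section Lift.
Variables (M N W : lmodType R) (b : M -> N -> W).
Hypothesis bl : forall a m m' n, b (a *: m + m') n = a *: b m n + b m' n.
Hypothesis br : forall a m n n', b m (a *: n + n') = a *: b m n + b m n'.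

Definition tensor_lift0 : {linear free_mod R (M * N)%type -> W} :=
  free_lift (fun mn : (M * N)%type => b mn.1 mn.2).

Lemma tensor_lift_subproof z :
  z \in span_pred (@tensor_relations R M N) -> tensor_lift0 z = 0.
Proof.
move=> /asboolP /(_ (ker_pred tensor_lift0) (ker_pred_closed _)) zK.
apply/eqP; apply: zK => y yrel; rewrite unfold_in; apply/eqP.
case: yrel => [[a [m [m' [n ->]]]]|[a [m [n [n' ->]]]]];
  rewrite linearB (linearP tensor_lift0) /= !free_lift_basis /=.
  by rewrite bl subrr.
by rewrite br subrr.
Qed.

Definition tensor_lift : {linear tensor M N -> W} := quot_lift tensor_lift_subproof.

Lemma tensor_liftE m n : tensor_lift (tens m n) = b m n.
Proof. exact: etrans (quot_lift_pi _ _) (free_lift_basis _ _). Qed.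

End Lift.

Section MapRight.
Variables (M N N' : lmodType R) (g : {linear N -> N'}).

Lemma tensor_mapr_l a (m m' : M) n :
  tens (a *: m + m') (g n) = a *: tens m (g n) + tens m' (g n).
Proof. exact: tensPl. Qed.

Lemma tensor_mapr_r a (m : M) n n' :
  tens m (g (a *: n + n')) = a *: tens m (g n) + tens m (g n').
Proof. by rewrite linearP tensPr. Qed.

Definition tensor_mapr : {linear tensor M N -> tensor M N'} :=
  tensor_lift tensor_mapr_l tensor_mapr_r.

Lemma tensor_maprE m n : tensor_mapr (tens m n) = tens m (g n).
Proof. exact: tensor_liftE. Qed.

End MapRight.

Lemma tens0r M N (m : M) : tens m (0 : N) = 0.
Proof.
have := tensPr 1 m (0 : N) 0; rewrite scaler0 addr0 scale1r => /eqP.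
by rewrite -subr_eq subrr eq_sym => /eqP.
Qed.

Lemma tensZr M N a (m : M) (n : N) : tens m (a *: n) = a *: tens m n.
Proof. by have := tensPr a m n 0; rewrite tens0r !addr0. Qed.

Lemma tens0l M N (n : N) : tens (0 : M) n = 0.
Proof.
have := tensPl 1 (0 : M) 0 n; rewrite scaler0 addr0 scale1r => /eqP.
by rewrite -subr_eq subrr eq_sym => /eqP.
Qed.

Lemma tensZl M N a (m : M) (n : N) : tens (a *: m) n = a *: tens m n.
Proof. by have := tensPl a m 0 n; rewrite tens0l !addr0. Qed.

Lemma tensor_map_mapr M M' N N' (f : {linear M -> M'}) (g : {linear N -> N'}) z :
  tensor_map N' f (tensor_mapr M g z) = tensor_mapr M' g (tensor_map N f z).
Proof.
suff : (tensor_map N' f \o tensor_mapr M g : {linear _ -> _}) =1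
       (tensor_mapr M' g \o tensor_map N f : {linear _ -> _}) by apply.
apply: tensor_ext => m n.
rewrite -[LHS]/(tensor_map N' f (tensor_mapr M g (tens m n))).
rewrite -[RHS]/(tensor_mapr M' g (tensor_map N f (tens m n))).
by rewrite tensor_maprE !tensor_mapE tensor_maprE.
Qed.

Lemma tensor_mapr_surj M N N' (g : {linear N -> N'}) :
  surjective_map g -> surjective_map (tensor_mapr M g).
Proof.
move=> gs; apply: (tensor_ind (Q := fun z => exists y, tensor_mapr M g y = z)).
  split; first by exists 0; rewrite linear0.
  by move=> a _ _ [y <-] [y' <-]; exists (a *: y + y'); rewrite linearP.
by move=> m n; have [n' <-] := gs n; exists (tens m n'); rewrite tensor_maprE.
Qed.

Section Coordinates.
Variables (X : choiceType) (N : lmodType R).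

Lemma tensor_coord_l x a (u u' : free_mod R X) (n : N) :
  (val (a *: u + u') x : R) *: n = a *: ((val u x : R) *: n) + (val u' x : R) *: n.
Proof. by rewrite scalerA -scalerDl. Qed.

Lemma tensor_coord_r x a (u : free_mod R X) (n n' : N) :
  (val u x : R) *: (a *: n + n') = a *: ((val u x : R) *: n) + (val u x : R) *: n'.
Proof. by rewrite scalerDr !scalerA mulrC. Qed.

(** Tensoring with a free module gives a direct sum of copies of [N]; these projections yield its
    flatness. *)
Definition tensor_coord x : {linear tensor (free_mod R X) N -> N} :=
  tensor_lift (tensor_coord_l x) (tensor_coord_r x).

Lemma tensor_coordE x u n : tensor_coord x (tens u n) = (val u x : R) *: n.
Proof. exact: tensor_liftE. Qed.

Lemma tensor_coord_expand (z : tensor (free_mod R X) N) : exists A : {fset X},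
  forall A' : {fset X}, (A `<=` A')%fset ->
    z = \sum_(x <- A') tens (free_basis R x) (tensor_coord x z).
Proof.
move: z; apply: tensor_ind.
  split; first by exists fset0 => A' _; rewrite big1 // => x _; rewrite linear0 tens0r.
  move=> a y z [A HA] [B HB]; exists (A `|` B)%fset => C ABC.
  rewrite {1}(HA C) ?(fsubset_trans (fsubsetUl _ _) ABC) //.
  rewrite {1}(HB C) ?(fsubset_trans (fsubsetUr _ _) ABC) //.
  rewrite scaler_sumr -big_split; apply: eq_bigr => x _.
  by rewrite linearP tensPr.
move=> u n; have [A HA] := free_mod_expand u; exists A => B AB.
rewrite {1}(HA B AB).
transitivity (\sum_(x <- B) tens ((val u x : R) *: free_basis R x) n).
  elim/big_rec2: _ => [|x y v _ E]; first exact: tens0l.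
  by have := tensPl 1 ((val u x : R) *: free_basis R x) v n; rewrite !scale1r E.
by apply: eq_bigr => x _; rewrite tensor_coordE tensZl tensZr.
Qed.

Lemma tensor_coord_inj (z : tensor (free_mod R X) N) :
  (forall x, tensor_coord x z = 0) -> z = 0.
Proof.
move=> z0; have [A /(_ A (fsubset_refl A)) ->] := tensor_coord_expand z.
by rewrite big1 // => x _; rewrite z0 tens0r.
Qed.

End Coordinates.
Arguments tensor_coord {X N} x.

Lemma tensor_coord_mapr (X : choiceType) N N' (g : {linear N -> N'}) x z :
  tensor_coord x (tensor_mapr (free_mod R X) g z) = g (tensor_coord x z).
Proof.
suff : (tensor_coord x \o tensor_mapr (free_mod R X) g : {linear _ -> _}) =1
       (g \o tensor_coord x : {linear _ -> _}) by apply.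
apply: tensor_ext => m n.
rewrite -[LHS]/(tensor_coord x (tensor_mapr (free_mod R X) g (tens m n))).
rewrite -[RHS]/(g (tensor_coord x (tens m n))).
by rewrite tensor_maprE !tensor_coordE linearZ.
Qed.

Lemma free_mapr_inj (X : choiceType) N N' (g : {linear N -> N'}) z :
  (forall n, g n = 0 -> n = 0) -> tensor_mapr (free_mod R X) g z = 0 -> z = 0.
Proof.
move=> gi gz; apply: tensor_coord_inj => x; apply: gi.
by rewrite -tensor_coord_mapr gz linear0.
Qed.

Lemma free_mapr_exact (X : choiceType) N1 N N2 (f : {linear N1 -> N}) (g : {linear N -> N2}) z :
  (forall n, g n = 0 -> exists n', f n' = n) -> tensor_mapr (free_mod R X) g z = 0 ->
  exists y, tensor_mapr (free_mod R X) f y = z.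
Proof.
move=> ex gz.
have /choice[h Hh] : forall x, exists n', f n' = tensor_coord x z.
  by move=> x; apply: ex; rewrite -tensor_coord_mapr gz linear0.
have [A /(_ A (fsubset_refl A)) zE] := tensor_coord_expand z.
exists (\sum_(x <- A) tens (free_basis R x) (h x)).
by rewrite linear_sum [RHS]zE; apply: eq_bigr => x _; rewrite tensor_maprE Hh.
Qed.

End TensorTheory.

(** * Tor as a functor of the second argument *)

Section KernelLift.
Variables (R : comNzRingType) (U V W : lmodType R).
Variables (f : {linear U -> V}) (g : {linear V -> W}).
Hypothesis gf0 : forall x, g (f x) = 0.

Lemma ker_lift_subproof x : ker_pred g (f x). Proof. exact/eqP/gf0. Qed.

Definition ker_lift_fun x : kermod g := Sub (f x) (ker_lift_subproof x).

Lemma ker_lift_linear : linear ker_lift_fun.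
Proof. by move=> a x y; apply: val_inj; rewrite /= linearP. Qed.

Definition ker_lift : {linear U -> kermod g} := mk_linear ker_lift_linear.

End KernelLift.

Lemma kerP (R : comNzRingType) (V W : lmodType R) (g : {linear V -> W}) (x : kermod g) :
  g (val x) = 0.
Proof. exact/eqP/(valP x). Qed.

Lemma free_lift_val (R : comNzRingType) (V W : lmodType R) (g : {linear V -> W}) u :
  free_lift (fun x : kermod g => val x) u = val (free_lift id u : kermod g).
Proof.
suff : free_lift (fun x : kermod g => val x) =1
  (val \o (free_lift id : {linear free_mod R (kermod g) -> kermod g}) : {linear _ -> V}) by apply.
apply: free_mod_ext => x; rewrite [LHS]free_lift_basis.
by rewrite -[RHS]/(val (free_lift id (free_basis R x))) free_lift_basis.
Qed.

Lemma free_lift_val_comp (R : comNzRingType) (S : lmodType R)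
    (h0 := free_lift id : {linear free_mod R S -> S})
    (h := free_lift id : {linear free_mod R (kermod h0) -> kermod h0})
    (u : free_mod R (kermod h)) :
  free_lift (fun x : kermod h0 => val x) (free_lift (fun s : kermod h => val s) u) = 0.
Proof. by rewrite !free_lift_val kerP. Qed.

Lemma tensor_map_comp0 (R : comNzRingType) (U V W N : lmodType R)
    (f : {linear U -> V}) (g : {linear V -> W}) (y : tensor U N) :
  (forall x, g (f x) = 0) -> tensor_map N g (tensor_map N f y) = 0.
Proof.
move=> gf.
suff : (tensor_map N g \o tensor_map N f : {linear _ -> _}) =1 (\0 : {linear _ -> _}) by apply.
apply: tensor_ext => m n.
rewrite -[LHS]/(tensor_map N g (tensor_map N f (tens m n))).
by rewrite !tensor_mapE gf tens0l.
Qed.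

Section HomologyTheory.
Variable R : comNzRingType.

Lemma homology_eq0P (U V W : lmodType R) (f : {linear U -> V}) (g : {linear V -> W}) :
  (forall x : homology f g, x = 0) <-> forall z, g z = 0 -> exists y, f y = z.
Proof.
split=> [H z gz|H x].
  have zk : ker_pred g z by apply/eqP.
  have : quot_pi (boundary_pred (g := g) f) (Sub z zk) = quot_pi _ 0 by rewrite [LHS]H [RHS]H.
  by move=> /quot_piP; rewrite subr0 => /asboolP[y E]; exists y.
rewrite -[x]quot_reprK -[RHS](linear0 (quot_pi (boundary_pred (g := g) f))).
apply/quot_piP; rewrite subr0; apply/asboolP.
by apply: H; apply: kerP.
Qed.

Section Map.
Variables (U V W U' V' W' : lmodType R).
Variables (f : {linear U -> V}) (g : {linear V -> W}).
Variables (f' : {linear U' -> V'}) (g' : {linear V' -> W'}) (v : {linear V -> V'}).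
Hypothesis vg : forall z, g z = 0 -> g' (v z) = 0.
Hypothesis vf : forall u, exists u', f' u' = v (f u).

Lemma homology_map_subproof (z : kermod g) : g' ((v \o val) z) = 0.
Proof. exact/vg/kerP. Qed.

Definition ker_map : {linear kermod g -> kermod g'} := ker_lift homology_map_subproof.

Lemma homology_map_boundary z : z \in boundary_pred (g := g) f ->
  (quot_pi (boundary_pred (g := g') f') \o ker_map) z = 0.
Proof.
move=> /asboolP[u fu]; rewrite -(linear0 (quot_pi (boundary_pred (g := g') f'))).
apply/quot_piP; rewrite subr0; apply/asboolP.
by have [u' E] := vf u; exists u'; rewrite E fu.
Qed.

Definition homology_map : {linear homology f g -> homology f' g'} :=
  quot_lift homology_map_boundary.

Lemma homology_mapE z : homology_map (quot_pi _ z) = quot_pi _ (ker_map z).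
Proof. exact: quot_lift_pi. Qed.

End Map.
(** The boolean [b] treats the identity and the zero map at once, for the diagonal and off-diagonal
    entries of a matrix identity. *)
Lemma homology_map_sum (U V W U' V' W' : lmodType R)
    (f : {linear U -> V}) (g : {linear V -> W})
    (f' : {linear U' -> V'}) (g' : {linear V' -> W'}) t
    (v : 'I_t -> {linear V -> V'}) (v' : 'I_t -> {linear V' -> V})
    (vg : forall k z, g z = 0 -> g' (v k z) = 0)
    (vf : forall k u, exists u', f' u' = v k (f u))
    (vg' : forall k z, g' z = 0 -> g (v' k z) = 0)
    (vf' : forall k u, exists u', f u' = v' k (f' u)) (b : bool) :
    (forall z, \sum_k v' k (v k z) = if b then z else 0) ->
  forall x, \sum_k homology_map (vg' k) (vf' k) (homology_map (vg k) (vf k) x) =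
    if b then x else 0.
Proof.
move=> H x; rewrite -[x]quot_reprK; set z := quot_repr x.
have -> : (if b then quot_pi (boundary_pred (g := g) f) z else 0) =
    quot_pi _ (if b then z else 0) by case: b {H} => //; rewrite linear0.
under eq_bigr do rewrite !homology_mapE.
rewrite -linear_sum; congr quot_pi; apply: val_inj.
have -> : val (if b then z else 0) = if b then val z else 0 by case: b {H}.
by rewrite raddf_sum -H.
Qed.

End HomologyTheory.

Lemma tensor_mapr_sum (R : comNzRingType) (X N N' : lmodType R) t
    (f : 'I_t -> {linear N -> N'}) (g : 'I_t -> {linear N' -> N}) (b : bool) :
    (forall a, \sum_k g k (f k a) = if b then a else 0) ->
  forall y, \sum_k tensor_mapr X (g k) (tensor_mapr X (f k) y) = if b then y else 0.
Proof.
move=> H; apply: tensor_ind.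
  split; first by rewrite big1 => [|k _]; [case: b {H}|rewrite !linear0].
  move=> a u v Eu Ev; under eq_bigr do rewrite !linearP.
  rewrite big_split -scaler_sumr Eu Ev; case: b {H Eu Ev}; first by []. by rewrite scaler0; exact: addr0.
move=> m n; under eq_bigr do rewrite !tensor_maprE.
have : tens m (\sum_k g k (f k n)) = \sum_k tens m (g k (f k n)).
  elim/big_rec2: _ => [|k y u _ <-]; first exact: tens0r.
  by have := tensPr 1 m (g k (f k n)) u; rewrite !scale1r.
by move=> <-; rewrite H; case: b {H} => //; rewrite tens0r.
Qed.

(** The rows of [F] give [t] maps from [H1 ^ W] to [H2], jointly injective because [G] inverts them.
    A nonzero [H1] gives [H1 ^ W] a chain of length [#|W|]: vectors supported on the first [j]
    indices. *)
Lemma submod_chain_copies (R : comNzRingType) (H1 H2 : lmodType R) (W : finType) t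
    (F : W -> 'I_t -> {linear H1 -> H2}) (G : W -> 'I_t -> {linear H2 -> H1}) :
    (forall w w' x, \sum_k G w k (F w' k x) = if w == w' then x else 0) ->
    ~ (forall x : H1, x = 0) ->
  exists k, submod_chain H2 k /\ (#|W| <= t * k)%N.
Proof.
move=> FG /existsNP[tau tau0].
pose V := {ffun W -> H1}.
have fl k : linear (fun v : V => \sum_w F w k (v w)).
  move=> a u v; rewrite scaler_sumr -big_split; apply: eq_bigr => w _ /=.
  by rewrite !ffunE linearP.
apply: (@submod_chain_joint_inj R V H2 t (fun k => mk_linear (fl k))).
  move=> v v0; apply/ffunP => w; rewrite ffunE.
  have : \sum_k G w k (\sum_w' F w' k (v w')) = 0.
    by rewrite big1 // => k _; rewrite [X in G w k X](v0 k) linear0.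
  under eq_bigr do rewrite linear_sum.
  rewrite exchange_big /= (bigD1 w) //= FG eqxx big1 ?addr0 // => w' w'w.
  by rewrite FG eq_sym (negPf w'w).
exists (fun j => (fun v : V => `[< forall w, (j <= enum_rank w)%N -> v w = 0 >])); split.
  move=> j _; apply: submod_asbool; split; first by move=> w _; rewrite ffunE.
  by move=> a u v u0 v0 w jw; rewrite !ffunE u0 // v0 // scaler0 addr0.
move=> j jW; split.
  by move=> v /asboolP v0; apply/asboolP => w jw; apply: v0; apply: ltnW.
pose w0 := enum_val (Ordinal jW).
exists [ffun w => if w == w0 then tau else 0].
  apply/asboolP => w jw; rewrite ffunE; case: eqP => // ww0.
  by move: jw; rewrite ww0 enum_valK ltnn.
apply/asboolP => /(_ w0); rewrite ffunE eqxx enum_valK => /(_ (leqnn _)).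
exact: tau0.
Qed.

Section TorTheory.
Variables (R : comNzRingType) (M : lmodType R).
Implicit Types N : lmodType R.

(** The target of [tor_out], the differential leaving degree [i]; the two make one formula serve all
    degrees of Tor. *)
Definition tor_low i N : lmodType R :=
  if i is i'.+1 then tensor (free_res M i') N else tensor M N.

Definition tor_out i N : {linear tensor (free_res M i) N -> tor_low i N} :=
  match i with 0 => \0 | i'.+1 => tensor_map N (free_res_diff M i') end.

Lemma TorE i N : Tor i M N = homology (tensor_map N (free_res_diff M i)) (tor_out i N).
Proof. by case: i. Qed.

Lemma Tor_eq0P i N : (forall x : Tor i M N, x = 0) <->
  forall z, tor_out i N z = 0 -> exists y, tensor_map N (free_res_diff M i) y = z.
Proof. by rewrite TorE; apply: homology_eq0P. Qed.

Lemma free_res_diff_comp i u : free_res_diff M i (free_res_diff M i.+1 u) = 0.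
Proof.
move: u; unfold free_res_diff, free_res.
exact (@free_lift_val_comp R (syz M i)).
Qed.

Lemma tor_out_diff i N y : tor_out i N (tensor_map N (free_res_diff M i) y) = 0.
Proof.
case: i y => [|i] y; first by [].
exact: (tensor_map_comp0 (f := free_res_diff M i.+1) (g := free_res_diff M i) y (@free_res_diff_comp i)).
Qed.

Lemma tor_out_mapr i N N' (g : {linear N -> N'}) z :
  tor_out i N z = 0 -> tor_out i N' (tensor_mapr _ g z) = 0.
Proof.
case: i z => [|i] z E; first by [].
by rewrite [LHS]tensor_map_mapr [tensor_map _ _ _]E linear0.
Qed.

(** A piece of the long exact sequence, by a chase: lift [z] to [z1], whose boundary comes from a
    cycle [y] over [N1]; then [y] bounds some [y1], and the lift is corrected by the image of
    [y1]. *)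
Lemma Tor_vanish_quotient i N1 N N2 (f : {linear N1 -> N}) (g : {linear N -> N2}) :
    (forall x, f x = 0 -> x = 0) -> exact_at f g -> surjective_map g ->
    (forall x : Tor i M N1, x = 0) -> (forall x : Tor i.+1 M N, x = 0) ->
  forall x : Tor i.+1 M N2, x = 0.
Proof.
move=> finj ex gsurj /Tor_eq0P H1 /Tor_eq0P H; apply/Tor_eq0P => z z0.
have [z1 z1E] := tensor_mapr_surj (M := free_res M i.+1) gsurj z.
have [y yE] : exists y, tensor_mapr _ f y = tor_out i.+1 N z1.
  apply: (@free_mapr_exact _ _ _ _ _ f g); first by move=> n /ex.
  by rewrite -tensor_map_mapr z1E.
have [y1 y1E] : exists y1, tensor_map N1 (free_res_diff M i) y1 = y.
  (* In degree 0 every chain is a cycle; above it, [f] is injective on chains and maps [y] to a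
     boundary. *)
  apply: H1; case: i y z z0 z1 z1E yE {H} => [|i] y z z0 z1 z1E yE //.
  apply: (free_mapr_inj finj); rewrite -tensor_map_mapr yE.
  exact: (@tor_out_diff i.+1 N z1).
have [|w wE] := H (z1 - tensor_mapr _ f y1).
  rewrite linearB -yE -y1E; apply/eqP; rewrite subr_eq0; apply/eqP/esym.
  exact: tensor_map_mapr.
exists (tensor_mapr _ g w); rewrite tensor_map_mapr wE linearB z1E.
suff -> : tensor_mapr _ g (tensor_mapr _ f y1) = 0 by rewrite subr0.
suff : (tensor_mapr _ g \o tensor_mapr _ f : {linear tensor (free_res M i.+1) N1 -> _}) =1 (\0 : {linear _ -> _}) by apply.
apply: tensor_ext => m n; rewrite -[LHS]/(tensor_mapr _ g (tensor_mapr _ f (tens m n))).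
rewrite !tensor_maprE; have -> : g (f n) = 0 by apply/ex; exists n.
exact: tens0r.
Qed.

Section Functor.
Variables (i : nat) (N N' : lmodType R).

Lemma tor_map_boundary (g : {linear N -> N'}) u : exists u',
  tensor_map N' (free_res_diff M i) u' =
  tensor_mapr _ g (tensor_map N (free_res_diff M i) u).
Proof. by exists (tensor_mapr _ g u); rewrite tensor_map_mapr. Qed.

Definition tor_map (g : {linear N -> N'}) :=
  homology_map (fun z => @tor_out_mapr i N N' g z) (tor_map_boundary g).

End Functor.

Lemma tor_map_sum i N N' t (f : 'I_t -> {linear N -> N'}) (g : 'I_t -> {linear N' -> N}) (b : bool) :
    (forall a, \sum_k g k (f k a) = if b then a else 0) ->
  forall x, \sum_k tor_map i (g k) (tor_map i (f k) x) = if b then x else 0.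
Proof.
by move=> H; apply: homology_map_sum => z; apply: tensor_mapr_sum.
Qed.

Lemma Tor_retract_vanish i N N' (f : {linear N -> N'}) (g : {linear N' -> N}) :
    (forall a, g (f a) = a) -> (forall x : Tor i M N', x = 0) ->
  forall x : Tor i M N, x = 0.
Proof.
move=> gf; rewrite !TorE => H x.
have fg a : \sum_(k < 1) g (f a) = a by rewrite big_ord1.
have := @tor_map_sum i N N' 1 (fun=> f) (fun=> g) true fg x.
by rewrite big_ord1 (H (tor_map i f x)) linear0 => <-.
Qed.

Lemma Tor_chain i N N' (W : finType) t (f : W -> 'I_t -> {linear N -> N'})
    (g : W -> 'I_t -> {linear N' -> N}) :
    (forall w w' a, \sum_k g w k (f w' k a) = if w == w' then a else 0) ->
    ~ (forall x : Tor i M N, x = 0) ->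
  exists k, submod_chain (Tor i M N') k /\ (#|W| <= t * k)%N.
Proof.
by move=> H; rewrite !TorE; apply: submod_chain_copies => w w' x; apply: tor_map_sum.
Qed.

End TorTheory.

(** * Minimal resolutions *)

Section StableComparison.
Variable R : comNzRingType.

Lemma row_projective k : projective 'rV[R]_k.
Proof.
move=> V W g f gsurj.
have [h Hh] := choice (fun i : 'I_k => gsurj (f (delta_mx 0 i))).
have hl : linear (fun u : 'rV[R]_k => \sum_i u 0 i *: h i).
  move=> a u v; rewrite scaler_sumr -big_split; apply: eq_bigr => i _.
  by rewrite !mxE scalerDl scalerA.
exists (mk_linear hl) => u; rewrite [u in RHS]row_sum_delta !linear_sum.
by apply: eq_bigr => i _; rewrite !linearZ Hh.
Qed.

(** [K] is a retract of [S] up to a map through a projective module. Later [K] is a minimal syzygy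
    and [S] the corresponding one of the standard resolution. *)
Definition stable_retract (S K : lmodType R) : Prop :=
  exists (f : {linear K -> S}) (g : {linear S -> K}) (Q : lmodType R)
         (a : {linear K -> Q}) (b : {linear Q -> K}),
    projective Q /\ forall x, x = g (f x) + b (a x).

Lemma stable_retract_refl K : stable_retract K K.
Proof.
exists idfun, idfun, 'rV[R]_0, \0, \0; split; first exact: row_projective.
by move=> x; rewrite addr0.
Qed.

(** Lift [f], [g] and [b] to the covers. The error [h1] maps [G] into the kernel of [pG], and its
    last term vanishes on that kernel. The map [f1] is recorded because minimality is expressed
    inside the covers. *)
Lemma stable_retract_syzygy (S K F G : lmodType R)
    (pF : {linear F -> S}) (pG : {linear G -> K}) :
    stable_retract S K -> projective F -> projective G ->
    surjective_map pF -> surjective_map pG ->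
  exists (f1 : {linear G -> F}) (f : {linear kermod pG -> kermod pF})
    (g : {linear kermod pF -> kermod pG}) (b : {linear G -> kermod pG}),
    (forall x, val (f x) = f1 (val x)) /\ forall x, x = g (f x) + b (val x).
Proof.
move=> [f [g [Q [a [b [prQ fg]]]]]] prF prG surF surG.
have [f1 Hf1] := prG _ _ pF (f \o pG : {linear _ -> _}) surF.
have [g1 Hg1] := prF _ _ pG (g \o pF : {linear _ -> _}) surG.
have [b1 Hb1] := prQ _ _ pG b surG.
have f0 (x : kermod pG) : pF ((f1 \o val) x) = 0.
  by rewrite [LHS]Hf1 /= kerP linear0.
have g0 (x : kermod pF) : pG ((g1 \o val) x) = 0.
  by rewrite [LHS]Hg1 /= kerP linear0.
pose h1 : {linear G -> G} := (idfun \- (g1 \o f1)) \- (b1 \o (a \o pG)).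
have h1E x : h1 x = x - g1 (f1 x) - b1 (a (pG x)) by [].
have h0 x : pG (h1 x) = 0.
  rewrite h1E !linearB [pG (g1 _)]Hg1 [pG (b1 _)]Hb1 /= Hf1 /= {1}(fg (pG x)).
  by rewrite addrAC addrK subrr.
exists f1, (ker_lift f0), (ker_lift g0), (ker_lift h0); split=> // x.
apply: val_inj; rewrite linearD.
rewrite [X in _ = _ + X](h1E (val x)) kerP (linear0 a) (linear0 b1) subr0.
by rewrite addrC subrK.
Qed.

End StableComparison.

Lemma exact_cover (R : comNzRingType) (U V W : lmodType R) (c0 : {linear V -> W}) (c1 : {linear U -> kermod c0}) :
  surjective_map c1 -> exact_at (val \o c1 : {linear U -> V}) c0.
Proof.
move=> s1 y; split=> [y0|[x <-]]; last exact: kerP.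
have yk : ker_pred c0 y by apply/eqP.
by have [x xE] := s1 (Sub y yk); exists x; rewrite /= xE.
Qed.

Lemma exact_cover_val (R : comNzRingType) (U V W X : lmodType R) (h : {linear W -> X}) (c0 : {linear V -> kermod h})
    (c1 : {linear U -> kermod c0}) :
  surjective_map c1 ->
  exact_at (val \o c1 : {linear U -> V}) (val \o c0 : {linear V -> W}).
Proof.
move=> s1 y; rewrite -(exact_cover s1); split=> [y0|E]; first exact: val_inj.
exact: (congr1 val E).
Qed.

Section MinimalResolution.
Variables (R : comNzRingType) (m : {pred R}) (lR : local_ring m).
Let P x := x \in m.
Let nR : noeth R. Proof. by case: lR => /noetherianP. Qed.
Let all_of (V : lmodType R) : V -> Prop := fun=> True.

Lemma local_nakayama (V : lmodType R) : fin_gen V -> (forall x, smul P (all_of (V := V)) x) ->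
  forall x : V, x = 0.
Proof.
move=> /fin_gen_lspan[s Hs] H x.
have sub0 : submod (fun x : V => x = 0).
  by split=> // a y z -> ->; rewrite scaler0 addr0.
have fgV : fin_gen_sub (all_of (V := V)) by exists s.
have [y _|u [Pu ux]] := nakayama (local_prime lR) sub0 fgV _ (Logic.I : all_of x).
  by exists 1, 0; rewrite scale1r subr0; split=> //; exact: (prime1 (local_prime lR)).
have [v vu] := local_unitN lR Pu.
by rewrite -[x]scale1r -vu -scalerA ux scaler0.
Qed.

(** Lifts of a basis of [K / m K] generate by Nakayama's lemma, and by independence any relation
    between them has its coefficients in [m]. *)
Lemma minimal_cover (K : lmodType R) : fin_gen K -> exists k (pi : {linear 'rV[R]_k -> K}),
  [/\ surjective_map pi, forall u, pi u = 0 -> smul P (all_of (V := 'rV[R]_k)) u,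
      fin_gen (kermod pi) & (forall x : K, x = 0) -> k = 0%N].
Proof.
move=> fgK; pose N := smul P (all_of (V := K)).
have sN : submod N := smul_submod _ _.
have [k [w [wI wS]]] := minimal_generators lR fgK sN (fun a y Pa => @mem_smul R K P (all_of (V := K)) a y Pa Logic.I).
have pl : linear (fun u : 'rV[R]_k => \sum_i u 0 i *: w i).
  move=> a u v; rewrite scaler_sumr -big_split; apply: eq_bigr => i _.
  by rewrite !mxE scalerDl scalerA.
exists k, (mk_linear pl); split.
- have sI : submod (fun y => exists u, mk_linear pl u = y).
    split; first by exists 0; rewrite linear0.
    by move=> a _ _ [u <-] [v <-]; exists (a *: u + v); rewrite linearP.
  move=> y; have [s Hs] := fin_gen_lspan fgK.
  have fgV : fin_gen_sub (all_of (V := K)) by exists s.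
  have [z _|u [Pu [v uy]]] := nakayama (local_prime lR) sI fgV _ (Logic.I : all_of y).
    have [b Nb] := wS z; exists 1, (\sum_i b i *: w i); split.
    + exact: (prime1 (local_prime lR)).
    + by exists (\row_i b i); apply: eq_bigr => i _; rewrite mxE.
    + by rewrite scale1r.
  have [c cu] := local_unitN lR Pu.
  by exists (c *: v); rewrite linearZ uy [LHS]scalerA cu scale1r.
- move=> u u0; rewrite [u]row_sum_delta; apply: submod_sum; first exact: smul_submod.
  move=> i _; apply: mem_smul => //; apply: (wI (u 0)).
  by rewrite [X in N X]u0; apply: submod0.
- have [||r Hr] := @noeth_fin_gen_sub R 'rV[R]_k [seq delta_mx 0 i | i <- enum 'I_k]
      (fun u => mk_linear pl u = 0) nR.
  + by split=> [|a x y Hx Hy]; rewrite ?linear0 ?linearP ?Hx ?Hy ?scaler0 ?addr0.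
  + by move=> u _; apply/lspan_ord; exists (u 0); rewrite [LHS]row_sum_delta.
  have rk (i : 'I_(size r)) : ker_pred (mk_linear pl) r`_i.
    by apply/eqP/Hr/mem_lspan/mem_nth.
  apply: (@fin_gen_family _ _ 'I_(size r) (fun i => Sub r`_i (rk i) : kermod (mk_linear pl))) => x.
  have /Hr /(cspan_nth _ _ Logic.I)[a [_ xE]] := kerP x.
  exists a; apply: val_inj; rewrite raddf_sum [LHS]xE.
  by apply: eq_bigr => i _.
- move=> K0; case: k w wI {wS pl} => // k w wI.
  exfalso; apply: (prime1 (local_prime lR)).
  apply: (wI (fun=> 1) _ ord0); rewrite big1 => [|i _]; first exact: submod0.
  by rewrite (K0 (w i)) scaler0.
Qed.

(** Otherwise adjoining, again and again, an element outside the span of those chosen before gives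
    chains of every length. *)
Lemma finite_length_fin_gen (M : lmodType R) : finite_length M -> fin_gen M.
Proof.
move=> [N noN]; have [[s Hs]|nos] := EM (exists s : seq M, forall x, lspan s x).
  apply: (@fin_gen_family _ _ 'I_(size s) (fun i => s`_i)) => x.
  by have /(cspan_nth _ _ Logic.I)[a [_ ->]] := Hs x; exists a.
exfalso; apply: noN.
have /choice[h Hh] : forall s : seq M, exists x, ~ lspan s x.
  by move=> s; apply/existsNP => Hs; apply: nos; exists s.
pose U k := iter k (fun s => h s :: s) [::].
exists (fun k x => `[< lspan (U k) x >]); split.
  by move=> i _; apply/submod_asbool/lspan_submod.
move=> i _; split.
  by move=> x /asboolP Ux; apply/asboolP; apply: (@lspan_catr _ _ [:: h (U i)]).
exists (h (U i)); first by apply/asboolP/mem_lspan/mem_head.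
by apply/asboolP/Hh.
Qed.

Record cover (K : lmodType R) := Cover {
  cover_rank : nat;
  cover_map : {linear 'rV[R]_cover_rank -> K};
  cover_surj : surjective_map cover_map;
  cover_min : forall u, cover_map u = 0 -> smul P (all_of (V := 'rV[R]_cover_rank)) u;
  cover_ker : fin_gen (kermod cover_map);
  cover0 : (forall x : K, x = 0) -> cover_rank = 0%N
}.

Lemma cover_exists (K : lmodType R) : fin_gen K -> inhabited (cover K).
Proof.
by move=> /minimal_cover[k [pi [H1 H2 H3 H4]]]; constructor; exists k pi.
Qed.

Definition the_cover (K : {K : lmodType R | fin_gen K}) : cover (sval K) :=
  inhabited_witness (cover_exists (svalP K)).

Fixpoint min_syz (M : {K : lmodType R | fin_gen K}) (i : nat) :
    {K : lmodType R | fin_gen K} :=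
  if i is i'.+1
  then exist _ _ (cover_ker (the_cover (min_syz M i')))
  else M.

Lemma min_syz_proj_dim (M : {K : lmodType R | fin_gen K}) i :
  (forall x : sval (min_syz M i), x = 0) -> finite_proj_dim (sval M).
Proof.
move=> Ki0.
pose C j := the_cover (min_syz M j).
have rv0 k : k = 0%N -> forall x : 'rV[R]_k, x = 0.
  by move=> -> x; rewrite thinmx0.
have K0 j : (i <= j)%N -> forall x : sval (min_syz M j), x = 0.
  elim: j => [|j IH]; first by rewrite leqn0 => /eqP <-.
  rewrite leq_eqVlt => /orP[/eqP <-//|/IH Kj0 x].
  exact/val_inj/(rv0 _ (cover0 (the_cover (min_syz M j)) Kj0)).
exists i, (fun j => 'rV[R]_(cover_rank (C j))),
  (fun j => val \o cover_map (C j.+1) : {linear _ -> _}), (cover_map (C 0)); split.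
- by move=> j; apply: row_projective.
- by move=> j /ltnW/K0/(cover0 (C j)); apply: rv0.
- exact: cover_surj.
- exact: exact_cover (cover_surj (C 1%N)).
- by move=> j; apply: exact_cover_val (cover_surj (C j.+2)).
Qed.

End MinimalResolution.

Lemma ker_free_lift_val (R : comNzRingType) (V W : lmodType R) (g : {linear V -> W}) u :
  g (free_lift (fun x : kermod g => val x) u) = 0.
Proof. by rewrite free_lift_val kerP. Qed.

Lemma free_cover_surj (R : comNzRingType) (S : lmodType R) :
  surjective_map (free_lift id : {linear free_mod R S -> S}).
Proof. by move=> x; exists (free_basis R x); apply: free_lift_basis. Qed.

Section StableCover.
Variables (R : comNzRingType) (m : {pred R}).
Let P x := x \in m.
Variables (S K : lmodType R) (C : cover m K).
Hypothesis SK : stable_retract S K.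
Local Notation syz1 := (kermod (free_lift id : {linear free_mod R S -> S})).

Lemma stable_retract_cover : stable_retract syz1 (kermod (cover_map C)).
Proof.
have [f1 [f [g [b [_ fg]]]]] := stable_retract_syzygy SK (@free_projective R _)
  (@row_projective R _) (@free_cover_surj R S) (cover_surj C).
exists f, g, 'rV[R]_(cover_rank C), val, b; split=> //.
exact: row_projective.
Qed.

Lemma smul_linear (V W : lmodType R) (h : {linear V -> W}) x :
  smul P (fun=> True) x -> smul P (fun=> True) (h x).
Proof.
move=> /(_ (fun x => smul P (fun=> True) (h x))); apply.
  split; first by rewrite linear0; apply: (smul_submod _ _).1.
  by move=> a y z Hy Hz; rewrite linearP; apply: (smul_submod _ _).2.
by move=> a y Pa _; rewrite linearZ; apply: mem_smul.
Qed.

(* The minimality of [C] puts [kermod (cover_map C)] inside [m] times a free module. *)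
Lemma stable_retract_ker_smul :
    (forall s : syz1, smul P (fun=> True) (val s) -> smul P (fun=> True) s) ->
  forall x : kermod (cover_map C), smul P (fun=> True) x.
Proof.
move=> H x.
have [f1 [f [g [b [ff1 fg]]]]] := stable_retract_syzygy SK (@free_projective R _)
  (@row_projective R _) (@free_cover_surj R S) (cover_surj C).
have xm := cover_min (kerP x).
rewrite (fg x).
apply: (submodD (smul_submod P (fun _ : kermod (cover_map C) => True))); last exact: (smul_linear b xm).
apply: (smul_linear g); apply: H; rewrite ff1; exact: (smul_linear f1 xm).
Qed.

End StableCover.

Section ResidueTensor.
Variables (R : comNzRingType) (m : {pred R}) (lR : local_ring m).
Let P x := x \in m.
Let all_of (V : lmodType R) : V -> Prop := fun=> True.
Variables (L : lmodType R) (fgL : fin_gen L).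
Hypothesis PL : forall a (l : L), P a -> a *: l = 0.
Hypothesis L0 : exists l : L, l <> 0.

(** A coordinate of [L] over the residue field, lifted to [R]; the lift is linear only modulo
    [m]. *)
Lemma residue_functional : exists (theta : L -> R) (l0 : L), P (theta l0 - 1) /\
  forall a l l', P (theta (a *: l + l') - (a * theta l + theta l')).
Proof.
have sub0 : submod (fun x : L => x = 0).
  by split=> // a y z -> ->; rewrite scaler0 addr0.
have [k [w [wI /= wS]]] := minimal_generators lR fgL sub0 PL.
have [b Hb] := choice wS.
have {}Hb y : y = \sum_i b y i *: w i by apply: subr0_eq.
case: k w wI b Hb {wS} => [|k] w wI b Hb.
  by exfalso; case: L0 => l; rewrite (Hb l) big_ord0.
exists (fun l => b l ord0), (w ord0); split.
  have := wI (fun i => b (w ord0) i - (i == ord0)%:R) _ ord0; rewrite eqxx; apply.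
  under eq_bigr do rewrite scalerBl.
  rewrite sumrB -Hb (bigD1 ord0) //= scale1r big1 ?addr0 ?subrr // => i /negPf ->.
  by rewrite scale0r.
move=> a l l'; apply: (wI (fun i => b (a *: l + l') i - (a * b l i + b l' i))).
under eq_bigr do rewrite scalerBl scalerDl -scalerA.
by rewrite sumrB big_split -scaler_sumr /= -!Hb subrr.
Qed.

(** Pairing [theta] with the augmentation maps the tensor product to [S / m S]. This kills the image
    of [d] and sends [tens (free_basis R s) l0] to the class of [s]. *)
Lemma residue_tensor (S U : lmodType R) (d : {linear U -> free_mod R S}) :
    (forall u, free_lift id (d u) = 0) ->
  exists l0 : L, forall s : S,
    (exists y, tensor_map L d y = tens (free_basis R s) l0) -> smul P (all_of (V := S)) s.
Proof.
move=> d0; have [theta [l0 [tl0 tlin]]] := residue_functional.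
exists l0 => s [y yE].
pose G (z : S) := exists a x, P a /\ z = a *: x.
pose pi : {linear S -> quotmod (span_pred G)} := quot_pi (span_pred G).
have piP a x : P a -> pi (a *: x) = 0.
  move=> Pa; rewrite -(linear0 pi); apply/quot_piP; rewrite subr0.
  by apply: mem_span; exists a, x.
have piE a b x : P (a - b) -> pi (a *: x) = pi (b *: x).
  by move=> Pab; apply/eqP; rewrite -subr_eq0 -linearB -scalerBl piP.
pose B (u : free_mod R S) (l : L) := pi (theta l *: free_lift id u).
have Bl a u u' l : B (a *: u + u') l = a *: B u l + B u' l.
  by rewrite /B linearP scalerDr linearD scalerA mulrC -scalerA linearZ.
have Br a u l l' : B u (a *: l + l') = a *: B u l + B u l'.
  by rewrite /B (piE _ _ _ (tlin a l l')) scalerDl linearD -scalerA linearZ.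
have : tensor_lift Bl Br (tensor_map L d y) = 0.
  suff : (tensor_lift Bl Br \o tensor_map L d : {linear _ -> _}) =1 (\0 : {linear _ -> _}) by apply.
  apply: tensor_ext => u l.
  rewrite -[LHS]/(tensor_lift Bl Br (tensor_map L d (tens u l))) tensor_mapE tensor_liftE.
  by rewrite /B d0 scaler0 linear0.
rewrite yE tensor_liftE /B free_lift_basis (piE _ _ _ tl0) scale1r.
rewrite -(linear0 pi) => /quot_piP; rewrite subr0 => /asboolP sG.
have /asboolP : s \in (fun x => `[< smul P (all_of (V := S)) x >]).
  apply: sG; first exact/submod_asbool/smul_submod.
  by move=> _ [a [x [Pa ->]]]; apply/asboolP; exact: (@mem_smul R S P _ a x Pa Logic.I).
exact: id.
Qed.

Lemma Tor_residue_syz (M : lmodType R) i : (forall x : Tor i M L, x = 0) ->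
  forall s : syz M i, (forall l, tor_out M i L (tens (free_basis R s) l) = 0) ->
    smul P (all_of (V := syz M i)) s.
Proof.
move=> /Tor_eq0P H s s0.
have [|l0 Hl0] := @residue_tensor (syz M i) (free_res M i.+1) (free_res_diff M i).
  exact (@ker_free_lift_val R (free_mod R (syz M i)) (syz M i) (free_lift id)).
by apply: Hl0; apply: H.
Qed.

Lemma Tor_residue_ker (M : lmodType R) i : (forall x : Tor i.+1 M L, x = 0) ->
  forall s : syz M i.+1, smul P (all_of (V := free_res M i)) (val s) ->
    smul P (all_of (V := syz M i.+1)) s.
Proof.
move=> H s sm; apply: (Tor_residue_syz H) => l.
rewrite [LHS](tensor_mapE (free_res_diff M i) (free_basis R s) l).
have -> : free_res_diff M i (free_basis R s) = val s by apply: free_lift_basis.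
apply: (sm (fun u => tens u l = 0)); first split; first exact: tens0l.
  by move=> a x y Hx Hy; rewrite tensPl Hx Hy scaler0 addr0.
by move=> a x Pa _; rewrite tensZl -tensZr PL // tens0r.
Qed.

Variables (M : {K : lmodType R | fin_gen K}).

Lemma min_syz_stable i : stable_retract (syz (sval M) i) (sval (min_syz lR M i)).
Proof.
elim: i => [|i IH]; first exact: stable_retract_refl.
exact (stable_retract_cover (the_cover lR (min_syz lR M i)) IH).
Qed.

(** The vanishing makes the [i]-th minimal syzygy equal to [m] times itself, hence zero. *)
Theorem Tor_residue_proj_dim i : (forall x : Tor i (sval M) L, x = 0) ->
  finite_proj_dim (sval M).
Proof.
move=> H; apply: (min_syz_proj_dim (lR := lR) (i := i)); apply: (local_nakayama lR).
  exact: svalP.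
case: i H => [|i] H; first by move=> x; apply: (Tor_residue_syz H).
exact (stable_retract_ker_smul (C := the_cover lR (min_syz lR M i)) (min_syz_stable i)
  (Tor_residue_ker H)).
Qed.

End ResidueTensor.

(** * Vanishing of Tor over the regular ring *)

Section RegularQuotients.
Variables (R A : comNzRingType) (phi : {rmorphism R -> A}) (M : lmodType R).
Local Notation V := (restrict_scalars phi A^o).

Definition gen_sub (s : seq A) : V -> Prop := gen_ideal s.
Definition quo (s : seq A) : lmodType R := quotmod (span_pred (gen_sub s)).
Definition quo_pi s : {linear V -> quo s} := quot_pi (span_pred (gen_sub s)).

Lemma gen_sub_submod s : submod (gen_sub s).
Proof.
split; first exact: (ideal0 (gen_ideal_ideal s)).
by move=> a x y; apply: ((gen_ideal_ideal s).2 (phi a) x y).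
Qed.

Lemma mem_gen_sub s x : x \in span_pred (gen_sub s) <-> gen_sub s x.
Proof.
split=> [/asboolP sx|]; last exact: mem_span.
have /asboolP : x \in (fun y => `[< gen_sub s y >]).
  apply: sx; first exact/submod_asbool/gen_sub_submod.
  by move=> y sy; apply/asboolP.
exact: id.
Qed.

Lemma quo_pi0 s x : quo_pi s x = 0 <-> gen_sub s x.
Proof.
rewrite -mem_gen_sub -(linear0 (quo_pi s)); split=> [/quot_piP|sx].
  by rewrite subr0.
by apply/quot_piP; rewrite subr0.
Qed.

Lemma quo_surj s : surjective_map (quo_pi s).
Proof. by move=> y; exists (quot_repr y); apply: quot_reprK. Qed.

Lemma mulV_linear (g : A) : linear (fun x : V => g * (x : A) : V).
Proof. by move=> a x y /=; rewrite mulrDr; congr (_ + _); apply: mulrCA. Qed.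

Lemma quo_mul_subproof g s x : x \in span_pred (gen_sub s) ->
  (quo_pi s \o mk_linear (mulV_linear g)) x = 0.
Proof. by move=> /mem_gen_sub sx; apply/quo_pi0/(idealM g (gen_ideal_ideal s) sx). Qed.

Definition quo_mul g s : {linear quo s -> quo s} := quot_lift (@quo_mul_subproof g s).

Lemma quo_mulE g s x : quo_mul g s (quo_pi s x) = quo_pi s (g * (x : A) : A).
Proof. exact: quot_lift_pi. Qed.

Lemma quo_proj_subproof g s x : x \in span_pred (gen_sub s) -> quo_pi (g :: s) x = 0.
Proof. by move=> /mem_gen_sub sx; apply/quo_pi0/(@lspan_catr A A^o [:: g]). Qed.

Definition quo_proj g s : {linear quo s -> quo (g :: s)} := quot_lift (@quo_proj_subproof g s).

Lemma quo_projE g s x : quo_proj g s (quo_pi s x) = quo_pi (g :: s) x.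
Proof. exact: quot_lift_pi. Qed.

(** Multiplication by [g] is injective on the domain [A / (s)], with cokernel [A / (g :: s)]. *)
Lemma Tor_quo_cons g s i : prime_ideal (gen_ideal s) -> ~ gen_ideal s g ->
    (forall x : Tor i M (quo s), x = 0) -> (forall x : Tor i.+1 M (quo s), x = 0) ->
  forall x : Tor i.+1 M (quo (g :: s)), x = 0.
Proof.
move=> ps sg; apply: (@Tor_vanish_quotient _ _ _ _ _ _ (quo_mul g s) (quo_proj g s)).
- move=> y; have [x <-] := quo_surj y; rewrite quo_mulE => /quo_pi0 sx.
  by apply/quo_pi0; case: ps => _ _ /(_ _ _ sx)[].
- move=> y; have [x <-] := quo_surj y; rewrite quo_projE; split.
    move=> /quo_pi0 /gen_ideal_cons[a [z [sz ->]]]; exists (quo_pi s a).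
    rewrite quo_mulE; apply/eqP; rewrite -subr_eq0 -linearB; apply/eqP/quo_pi0.
    have -> : (g * a - (a * g + z) : A) = - z by rewrite mulrC opprD addrA subrr sub0r.
    exact: (idealN (gen_ideal_ideal s) sz).
  move=> [y']; have [x' <-] := quo_surj y'; rewrite quo_mulE => E.
  have : quo_pi s ((g * x' : A) - x) = 0 by rewrite linearB E subrr.
  move=> /quo_pi0 sx; apply/quo_pi0/gen_ideal_cons.
  exists x', (- ((g * x' : A) - x)); split; first exact: (idealN (gen_ideal_ideal s) sx).
  by rewrite mulrC opprB addrC subrK.
- by move=> y; have [x <-] := quo_surj y; exists (quo_pi s x); rewrite quo_projE.
Qed.

Lemma Tor_quo_nil i : (forall x : Tor i M V, x = 0) ->
  forall x : Tor i M (quo [::]), x = 0.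
Proof.
have H x : x \in span_pred (gen_sub [::]) -> (idfun : {linear V -> V}) x = 0.
  by move=> /mem_gen_sub.
apply: (@Tor_retract_vanish _ _ _ _ _ (quot_lift H : {linear quo [::] -> V}) (quo_pi [::])).
move=> y; have [x <-] := quo_surj y; congr (quo_pi _ _).
exact: quot_lift_pi.
Qed.

(** [Tor_quo_cons] consumes two consecutive degrees, so each parameter raises the lower end [a] of
    the range of vanishing by one. This is why [d + 1] consecutive degrees are assumed. *)
Lemma Tor_regular_quotient (n : A -> Prop) pre s a b : noeth A ->
    (forall u, ~ n u -> exists v, v * u = 1) ->
    (forall x, gen_ideal (catrev pre s) x <-> n x) ->
    chain_above (gen_ideal s) (size pre) n ->
    (forall i, (a <= i <= b)%N -> forall x : Tor i M (quo s), x = 0) ->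
    (a + size pre <= b)%N ->
  forall x : Tor b M (quo (catrev pre s)), x = 0.
Proof.
move=> nA nloc; elim: pre s a => [|g pre IH] s a Hn cn H ab.
  by apply: H; rewrite leqnn andbT -(addn0 a).
have [ps sg] := regular_prime nA nloc Hn cn.
rewrite /= in Hn ab *; rewrite addnS -addSn in ab.
apply: (IH (g :: s) a.+1) => //.
  apply: (@chain_aboveW _ (iadd (gen_ideal s) g)); first by move=> x /gen_ideal_cons.
  apply: chain_above_drop => //; apply/Hn/mem_lspan.
  by rewrite catrevE mem_cat mem_head orbT.
move=> [|i] // /andP[ai ib]; apply: Tor_quo_cons => //.
- exact: sg.
- by apply: H; rewrite (ltnW ib) andbT.
- by apply: H; rewrite ib andbT; apply: ltnW.
Qed.

End RegularQuotients.

(** * Growth of lengths against the normalizing power of [p] *)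

Section HilbertKunzBound.
Variables (Re : realType) (R : comNzRingType) (m : idealr R) (p : nat).
Hypothesis p_gt1 : (1 < p)%N.

Let p_gt0 : 0 < p%:R :> Re. Proof. by rewrite ltr0n ltnW. Qed.

Lemma powR_alpha_leq d l : (0 < l)%N ->
    (forall k (b : 'I_k -> {ideal_quot m}), pbasis p b -> (k <= l)%N) ->
  p%:R `^ (d%:R + alpha Re m p) <= (p ^ d * l)%:R :> Re.
Proof.
move=> l0 Hl.
have pdl : (pdegree {ideal_quot m} p <= l)%N.
  rewrite /pdegree; case: xgetP => [k _ [b]|//]; exact: Hl.
rewrite powRD ?(gt_eqF p_gt0) ?implybT // powR_mulrn ?(ltW p_gt0) // natrM natrX.
rewrite ler_pM2l ?exprn_gt0 // /alpha.
(* At the default value 0 of [pdegree], the convention [ln 0 = 0] makes [alpha] zero and [1 <= l]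
   suffices. *)
have [D0|D0] := posnP (pdegree {ideal_quot m} p).
  by rewrite D0 ln0 // mul0r powRr0 ler1n.
have lnp : ln p%:R != 0 :> Re by rewrite gt_eqF // ln_gt0 // ltr1n.
rewrite /powR gt_eqF // divfK // lnK ?ler_nat //.
by rewrite posrE ltr0n.
Qed.

Lemma powR_expn e x : (p ^ e)%:R `^ x = (p%:R `^ x) ^+ e :> Re.
Proof.
by rewrite natrX -powR_mulrn ?(ltW p_gt0) // -powRrM mulrC powRrM powR_mulrn // powR_ge0.
Qed.

Lemma length_geq (N : lmodType R) k : submod_chain N k -> (k%:R%:E <= length Re N)%E.
Proof. by move=> Nk; apply: ereal_sup_ubound; exists k. Qed.

Lemma length_growth_not_cvg0 (N : nat -> lmodType R) (x : Re) (r t E : nat) :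
    p%:R `^ x <= r%:R ->
    (forall e, exists k, submod_chain (N (e + E)%N) k /\ (r ^ e <= t * k)%N) ->
  ~ ((fun e : nat => (length Re (N e) * (((p ^ e)%:R `^ x)^-1)%:E)%E) @ \oo --> 0%E)%classic.
Proof.
move=> yr HN lim0; set y := p%:R `^ x in yr.
have y0 : 0 < y by apply: powR_gt0.
(* At [e = 0] the hypothesis reads [1 <= t * k]. *)
have t0 : (0 < t)%N.
  by have [k [_]] := HN 0%N; case: t {HN} => // _; rewrite mul0n.
have tR : 0 < t%:R :> Re by rewrite ltr0n.
pose delta : Re := (t%:R * y ^+ E)^-1.
have d0 : 0 < delta by rewrite invr_gt0 mulr_gt0 // exprn_gt0.
suff : (delta%:E <= 0)%E by rewrite lee_fin leNgt d0.
apply: (cvge_ge _ lim0); exists E => // e /= Ee.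
have [k [Nk rk]] := HN (e - E)%N; rewrite subnK // in Nk.
rewrite powR_expn -/y.
apply: (@le_trans _ _ (k%:R%:E * ((y ^+ e)^-1)%:E)%E); last first.
  by apply: lee_wpmul2r; [rewrite lee_fin invr_ge0 exprn_ge0 // ltW|apply: length_geq].
rewrite -EFinM lee_fin ler_pdivlMr ?exprn_gt0 //.
rewrite -(subnK Ee) exprD /delta invfM mulrACA mulVf ?gt_eqF ?exprn_gt0 // mulr1.
rewrite mulrC ler_pdivrMr //.
apply: (@le_trans _ _ (r%:R ^+ (e - E))).
  by apply: lerXn2r => //; rewrite nnegrE ?ler0n ?ltW.
by rewrite -natrX -natrM ler_nat mulnC.
Qed.

End HilbertKunzBound.

Theorem proposition4p1 (Re : realType)
  (R : comNzRingType) (m : idealr R) (hR : local_ring m)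
  (p : nat) (charRp : p \in [pchar R]) (hFfin : F_finite charRp)
  (d : nat) (hd : krull_dim_is R d)
  (M : lmodType R) (hM : finite_length M)
  (A : comNzRingType) (n : idealr A) (hA : regular_local_ring n)
  (phi : {rmorphism R -> A}) (hphi : forall x : R, x \in m -> phi x \in n)
  (hfin : fin_gen (restrict_scalars phi A^o)) (hdA : krull_dim_is A d)
  (j : nat)
  (hbeta : forall i : nat, (j <= i <= j + d)%N ->
     betaF_is m charRp d i M R^o (0%E : \bar Re)) :
  finite_proj_dim M.
Proof.
have p_gt1 : (1 < p)%N := prime_gt1 (pcharf_prime charRp).
have [lA _] := hA; have [nA _ _] := lA.
have [l [E [t [l0 Hl HW]]]] := regular_frobenius_summands hR hFfin hd hA hphi hfin hdA.
have TorA i : (j <= i <= j + d)%N -> forall x : Tor i M (restrict_scalars phi A^o), x = 0.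
  move=> /hbeta lim0; apply: contrapT => TorA.
  apply: (@length_growth_not_cvg0 Re R p p_gt1 (fun e => Tor i M (frob_mod charRp e R^o))
    (d%:R + alpha Re m p) (p ^ d * l) t E _ _ lim0).
    exact: powR_alpha_leq.
  move=> e; have [W [f [g [<- fg]]]] := HW e.
  exact: Tor_chain fg TorA.
have [xs [sxs xsn cxs]] := regular_local_gens hA hdA.
have Hxs x : gen_ideal (catrev (rev xs) [::]) x <-> x \in n.
  by rewrite catrevE cats0 revK.
pose L := quo phi (catrev (rev xs) [::]).
have TorL : forall x : Tor (j + d) M L, x = 0.
  apply: (Tor_regular_quotient (n := fun x => x \in n) (a := j)).
  - exact: noetherianP.
  - exact: local_unitN.
  - exact: Hxs.
  - by rewrite size_rev sxs.
  - by move=> i /TorA; apply: Tor_quo_nil.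
  - by rewrite size_rev sxs.
have fgL : fin_gen L.
  have [k [g Hg]] := hfin.
  apply: (@fin_gen_family _ L 'I_k (fun i => quo_pi phi _ (g i))) => y.
  have [x <-] := quo_surj y; have [a ->] := (Hg x).1 isT; exists a.
  by rewrite linear_sum; apply: eq_bigr => i _; rewrite linearZ.
have PL a (y : L) : a \in m -> a *: y = 0.
  move=> /hphi na; have [x <-] := quo_surj y.
  rewrite -linearZ; apply/quo_pi0/Hxs.
  exact: (idealMr (x : A) (prime_id (local_prime lA)) na).
have L0 : exists y : L, y <> 0.
  exists (quo_pi phi _ (1 : A)) => /quo_pi0 /Hxs.
  exact: (prime1 (local_prime lA)).
exact: (Tor_residue_proj_dim hR fgL PL L0 (M := exist _ M (finite_length_fin_gen hM)) TorL).
Qed.
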